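(* Let $\{\Phi_t\}_{t\ge 0}$ be a primitive quantum Markov semigroup on $M_n(\mathbb{C})$ with generator $\mathcal{L}$ that is KMS-symmetric with respect to its faithful invariant state $\rho$. For every $1<p<\infty$, $$\alpha_p(\mathcal{L})\;\ge\;\frac{\lambda_{\mathrm{KMS}}}{\log s_-^{-1}+2}\;\ge\;\frac{h_\rho(\mathcal{L})^2s_-^2}{2s_+^2\|\mathcal{L}\|_{\mathrm{KMS},\rho}}\,\frac{1}{\log s_-^{-1}+2}.$$ Furthermore, $$\alpha_2(\mathcal{L})\;\ge\;\frac{2\lambda_{\mathrm{KMS}}}{\log s_-^{-1}+2}\;\ge\;\frac{2h_\rho(\mathcal{L})^2s_-^2}{2s_+^2\|\mathcal{L}\|_{\mathrm{KMS},\rho}}\,\frac{1}{\log s_-^{-1}+2}.$$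
   Context: Throughout $n\ge 2$ and $M_n(\mathbb{C})$ carries the unnormalized trace $\mathrm{Tr}$. A quantum Markov semigroup is a norm-continuous semigroup $\{\Phi_t\}_{t\ge0}$ of unital completely positive linear maps on $M_n(\mathbb{C})$ with $\Phi_0=\mathrm{Id}$; its generator $\mathcal{L}$ is defined by $\Phi_t=e^{-t\mathcal{L}}$. A faithful state $\rho$ has positive definite density matrix $D_\rho$, $\rho(X)=\mathrm{Tr}(D_\rho X)$; $s_-$ and $s_+$ are the smallest and largest eigenvalues of $D_\rho$. The KMS inner product is $\langle X,Y\rangle_{\mathrm{KMS},\rho}=\mathrm{Tr}(X^*D_\rho^{1/2}YD_\rho^{1/2})$, with norm $\|X\|_{\mathrm{KMS},\rho}$; for a linear map, $\|\mathcal{L}\|_{\mathrm{KMS},\rho}=\sup_{X\ne0}\|\mathcal{L}(X)\|_{\mathrm{KMS},\rho}/\|X\|_{\mathrm{KMS},\rho}$. The semigroup is KMS-symmetric with respect to $\rho$ if $\langle X,\Phi_t(Y)\rangle_{\mathrm{KMS},\rho}=\langle \Phi_t(X),Y\rangle_{\mathrm{KMS},\rho}$ for all $t\ge0$ and all $X,Y$. It is primitive if it admits a faithful invariant state and $\ker\mathcal{L}=\mathbb{C}I$; $\rho$ is then the unique invariant state. Projection Dirichlet conductance: $h_\rho(\mathcal{L})=\inf_{P}\dfrac{\langle P,\mathcal{L}(P)\rangle_{\mathrm{KMS},\rho}}{\min\{\rho(P),1-\rho(P)\}}$, the infimum over all orthogonal projections $P\in M_n(\mathbb{C})$ with $P\ne0,I$.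 Spectral gap: $\lambda_{\mathrm{KMS}}=\inf\left\{\dfrac{\langle X,\mathcal{L}(X)\rangle_{\mathrm{KMS},\rho}}{\|X\|_{\mathrm{KMS},\rho}^2}: 0\ne X=X^*\in M_n(\mathbb{C}),\ \rho(X)=0\right\}$. For $1<p<\infty$ and $X\in M_n(\mathbb{C})$, let $\|X\|_{p,\rho}=[\mathrm{Tr}(|D_\rho^{1/(2p)}XD_\rho^{1/(2p)}|^p)]^{1/p}$ and, writing $Y=|D_\rho^{1/(2p)}XD_\rho^{1/(2p)}|^p$ (with $0\log0=0$), $$\mathrm{Ent}_{p,\rho}(X)=\frac1p\mathrm{Tr}\big(Y(\log Y-\log D_\rho)\big)-\frac1p\|X\|_{p,\rho}^p\log\|X\|_{p,\rho}^p.$$ For positive definite $X$ and $1<p,q<\infty$ let $I_{p,q}(X)=D_\rho^{-\frac1{2p}}\big(D_\rho^{\frac1{2q}}XD_\rho^{\frac1{2q}}\big)^{q/p}D_\rho^{-\frac1{2p}}$. The $p$-Dirichlet form is $\mathcal{E}_{p,\mathcal{L}}(X)=\frac{p}{2(p-1)}\big\langle I_{\frac{p}{p-1},p}(X),\mathcal{L}(X)\big\rangle_{\mathrm{KMS},\rho}$, and the logarithmic Sobolev constant is $\alpha_p(\mathcal{L})=\inf\{\mathcal{E}_{p,\mathcal{L}}(X)/\mathrm{Ent}_{p,\rho}(X):\ X>0,\ X\notin\mathbb{C}I\}$. *)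

(* Defs.v *)
From mathcomp Require Import all_boot all_order all_algebra.
From mathcomp Require Import complex.
From mathcomp Require Import all_classical all_reals.
From mathcomp Require Import topology normedtype sequences exp.

Set Implicit Arguments.
Unset Strict Implicit.
Unset Printing Implicit Defensive.

Import Order.TTheory GRing.Theory Num.Theory.
Import numFieldNormedType.Exports.

Local Open Scope classical_set_scope.
Local Open Scope ring_scope.
Local Open Scope complex_scope.
Local Open Scope sesquilinear_scope.

(* The complex field is R[i] for a real field R : realType, so M_n(C) is
   'M[R[i]]_n and X^* is X ^t*.

   A complex quantity that is real on mathematical grounds (e.g. the KMS
   product of two self-adjoint matrices) is read in R through complex.Re, so
   that the infima, suprema and powers below are those of R. *)

Section Matrices.
Variables (R : realType) (m : nat).
Implicit Types A X : 'M[R[i]]_m.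

Definition selfadjoint A : Prop := A ^t* = A.

(* 0 <= z in R[i] entails that z is real. *)
Definition psd A : Prop :=
  selfadjoint A /\ forall v : 'rV[R[i]]_m, 0 <= (v *m A *m v ^t*) 0 0.

Definition posdef A : Prop :=
  selfadjoint A /\
  forall v : 'rV[R[i]]_m, v != 0 -> 0 < (v *m A *m v ^t*) 0 0.

Definition projection A : Prop := selfadjoint A /\ A *m A = A.

Definition rtr A : R := complex.Re (\tr A).

(* The set of eigenvalues is finite, so for a self-adjoint A and m > 0 these
   bounds are attained. *)
Definition min_eig A : R := inf [set s : R | eigenvalue A s%:C].
Definition max_eig A : R := sup [set s : R | eigenvalue A s%:C].

(* Functional calculus f(A); meaningful when A is self-adjoint, where
   A = (spectralmx A)^-1 *m diag_mx (spectral_diag A) *m spectralmx A with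
   spectralmx A unitary and spectral_diag A real. *)
Definition mxcalc (f : R -> R) A : 'M[R[i]]_m :=
  invmx (spectralmx A)
  *m diag_mx (map_mx (fun z => (f (complex.Re z))%:C) (spectral_diag A))
  *m spectralmx A.

Definition mxpow A (r : R) : 'M[R[i]]_m := mxcalc (fun x => x `^ r) A.

(* The library sets ln 0 = 0, so A *m mxlog A is A log A with 0 log 0 = 0. *)
Definition mxlog A : 'M[R[i]]_m := mxcalc (@ln R) A.

Definition mxabs X : 'M[R[i]]_m := mxpow (X ^t* *m X) 2^-1.

Definition cstar_norm X : R := Num.sqrt (max_eig (X ^t* *m X)).

Definition map_norm (N : 'M[R[i]]_m -> R) (F : 'M[R[i]]_m -> 'M[R[i]]_m) : R :=
  sup [set N (F X) / N X | X in [set X | X != 0]].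

End Matrices.

Section Semigroups.
Variables (R : realType) (n : nat).
Local Notation M := 'M[R[i]]_n.
Implicit Types (F : {linear M -> M}) (Phi : R -> {linear M -> M}).

(* The ampliation id_k (x) F is F applied to each n x n block of a k x k block
   matrix. *)
Definition completely_positive F : Prop :=
  forall (k : nat) (A : 'M[R[i]]_(\sum_(i < k) n)),
    psd A -> psd (\mxblock_(i < k, j < k) F (submxblock A i j)).

Definition norm_continuous Phi : Prop :=
  forall t : R, 0 <= t ->
    map_norm (@cstar_norm R n) (fun X => Phi s X - Phi t X)
      @[s --> within [set s : R | 0 <= s] (nbhs t)] --> (0 : R).

(* Only the values Phi t with 0 <= t matter. *)
Definition quantum_markov_semigroup Phi : Prop :=
  [/\ forall t, 0 <= t -> completely_positive (Phi t),
      forall t, 0 <= t -> Phi t 1%:M = 1%:M,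
      forall X, Phi 0 X = X,
      forall s t, 0 <= s -> 0 <= t -> forall X, Phi (s + t) X = Phi s (Phi t X)
    & norm_continuous Phi].

(* Phi_t = e^{-tL}, as a norm-convergent exponential series of linear maps *)
Definition generator Phi (L : {linear M -> M}) : Prop :=
  forall t : R, 0 <= t ->
    map_norm (@cstar_norm R n)
      (fun X => (\sum_(k < N) ((- t) ^+ k / k`!%:R)%:C *: iter k L X) - Phi t X)
      @[N --> \oo] --> (0 : R).

Definition faithful_state (D : M) : Prop := posdef D /\ \tr D = 1.

Definition invariant_state Phi (D : M) : Prop :=
  forall t, 0 <= t -> forall X, \tr (D *m Phi t X) = \tr (D *m X).

Definition primitive Phi (L : {linear M -> M}) : Prop :=
  (exists D, faithful_state D /\ invariant_state Phi D) /\
  forall X, L X = 0 <-> exists c : R[i], X = c%:M.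

End Semigroups.

(* The density matrix D stands for the faithful state rho(X) = Tr(D X). *)
Section KMS.
Variables (R : realType) (n : nat) (D : 'M[R[i]]_n).
Local Notation M := 'M[R[i]]_n.
Implicit Types (X Y P : M) (L : {linear M -> M}) (p q : R).

Definition kms X Y : R[i] :=
  \tr (X ^t* *m mxpow D 2^-1 *m Y *m mxpow D 2^-1).

Definition kms_norm X : R := Num.sqrt (complex.Re (kms X X)).

Definition kms_symmetric (Phi : R -> {linear M -> M}) : Prop :=
  forall t, 0 <= t -> forall X Y, kms X (Phi t Y) = kms (Phi t X) Y.

Definition conductance L : R :=
  inf [set complex.Re (kms P (L P))
           / Num.min (rtr (D *m P)) (1 - rtr (D *m P))
      | P in [set P : M | [/\ projection P, P <> 0 & P <> 1%:M]]].

Definition spectral_gap L : R :=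
  inf [set complex.Re (kms X (L X)) / kms_norm X ^+ 2
      | X in [set X : M | [/\ X <> 0, selfadjoint X & \tr (D *m X) = 0]]].

Definition weighted p X : M :=
  mxpow D (2 * p)^-1 *m X *m mxpow D (2 * p)^-1.

Definition pnorm p X : R :=
  rtr (mxpow (mxabs (weighted p X)) p) `^ p^-1.

Definition Ent p X : R :=
  let Y := mxpow (mxabs (weighted p X)) p in
  p^-1 * rtr (Y *m (mxlog Y - mxlog D))
  - p^-1 * (pnorm p X `^ p * ln (pnorm p X `^ p)).

Definition power_map p q X : M :=
  mxpow D (- (2 * p)^-1) *m mxpow (weighted q X) (q / p)
  *m mxpow D (- (2 * p)^-1).

Definition dirichlet p L X : R :=
  p / (2 * (p - 1)) * complex.Re (kms (power_map (p / (p - 1)) p X) (L X)).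

Definition log_sobolev p L : R :=
  inf [set dirichlet p L X / Ent p X
      | X in [set X : M | posdef X /\ ~ exists c : R[i], X = c%:M]].

End KMS.

(* Main.v *)
(** Cheeger part: complete positivity turns the Dirichlet form of an observable
    [X = sum_k x_k P_k] into a classical one.  In the eigenframe of [D], a
    Lyapunov equation produces matrices [V_j] and hence weights
    [w_kl = sum_j |(V_j)_kl|^2 >= 0], for which [<X, L X>] lies between [s_-] and
    [s_+] times [sum_kl w_kl (x_k - x_l)^2].  The classical Cheeger inequality for
    [w] and the distribution of [X] under [rho] then yields the gap bound; the
    two-sided comparison costs the factor [s_-^2 / s_+^2].

    Log-Sobolev part: put [D^(1/2p) X D^(1/2p) = Y^(1/p)] and
    [I_z = D^(-z/2) Y^z D^(-z/2)].  Then [X = I_(1/p)], and the [p]-Dirichlet form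
    is [p / (2 (p - 1))] times the value at [z = 1/p] of
    [f z = <I_(1 - conj z), L I_z>], an exponential polynomial in [z].  On [Re z = 0],
    [I_z] is unitary and contractivity of the semigroup gives [Re f >= 0].  On
    [Re z = 1/2] the gap gives [Re f >= lambda (tau - F^2)], where [tau = Tr Y] and
    [F = sum_ij |<v_i, u_j>|^2 sqrt (y_i s_j)] for eigenbases [v] of [Y] and [u] of
    [D].  The minimum principle on the strip interpolates to [z = 1/p], the
    symmetry of [L] exchanging [z] and [1 - z].  Finally [p Ent] is a classical
    relative entropy with respect to the coupling [|<v_i, u_j>|^2] and is at most
    [(ln (1 / s_-) + 2) (tau - F^2)]. *)

Require Import Defs.
From mathcomp Require Import all_boot all_order all_algebra.
From mathcomp Require Import complex.
From mathcomp Require Import all_classical all_reals.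
From mathcomp Require Import topology normedtype derive realfun sequences exp trigo.
From mathcomp Require Import ring lra.

Set Implicit Arguments.
Unset Strict Implicit.
Unset Printing Implicit Defensive.

Import Order.TTheory GRing.Theory Num.Theory.
Import numFieldNormedType.Exports.
Local Open Scope ring_scope.

(** * Classical Cheeger inequality *)

(** The spectral projections P_k of [X] need not be KMS-orthogonal, so no sign of <P_k, L P_l> is
    available and the Dirichlet form is not visibly a graph form; hence the detour through squared
    commutators. These are built for each completely positive [Phi t]. The resulting weights are
    written linearly in the map, vanish off the diagonal at the identity, and so pass to [L] by
    differentiation at [t = 0]. The strip has width 1/2 because 1 - conj z = z on Re z = 1/2, where
    the form becomes diagonal and the gap applies. The gap speaks of centred self-adjoint matrices
    and [I_z] is neither, so it is first extended to a variance inequality for all matrices. The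
    minimum principle gives a bound of slope 2; reflected at 1/2 it yields 2 min (1/p, 1 - 1/p).
    Together with p / (2 (p - 1)) and the p of p Ent this makes min (p, p / (p - 1)), which is at
    least 1 for every p and equals 2 at p = 2. An infimum or supremum carries information only over
    a nonempty set bounded on the right side, so test elements and bounds accompany the
    estimates. *)

Section ClassicalCheeger.
Variables (R : realFieldType) (T : finType).
Variables (w : T -> T -> R) (pi : T -> R) (H : R).
Hypothesis w_ge0 : forall k l, 0 <= w k l.
Hypothesis pi_ge0 : forall k, 0 <= pi k.
Hypothesis H_ge0 : 0 <= H.

Definition total_variation (g : T -> R) := \sum_k \sum_l w k l * `|g k - g l|.

Lemma total_variation_ge0 g : 0 <= total_variation g.
Proof. by apply: sumr_ge0 => k _; apply: sumr_ge0 => l _; rewrite mulr_ge0. Qed.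

(* Peel off the lowest positive level of [g]. *)
Lemma coarea_le g : (forall k, 0 <= g k) ->
  (forall A : {set T}, A \subset [set k | 0 < g k] ->
     H * (\sum_(k in A) pi k) <= total_variation (fun k => (k \in A)%:R)) ->
  H * (\sum_k pi k * g k) <= total_variation g.
Proof.
move: {-1}#|_| (leqnn #|[set k | 0 < g k]|) => m.
elim: m g => [|m IH] g gm g0 iso.
  rewrite big1 ?mulr0 ?total_variation_ge0// => k _.
  have : k \notin [set k | 0 < g k].
    by move: gm; rewrite leqn0 cards_eq0 => /eqP->; rewrite inE.
  rewrite inE -leNgt => gk; have -> : g k = 0 by apply/le_anti; rewrite gk g0.
  by rewrite mulr0.
set A := [set k | 0 < g k] in gm iso *.
have gA k : k \notin A -> g k = 0.
  by rewrite inE -leNgt => gk; apply/le_anti; rewrite gk g0.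
have [A0|/finset.set0Pn[k0 k0A]] := eqVneq A finset.set0.
  by apply: IH => //; rewrite -/A A0 cards0.
case: (@arg_minP _ _ _ k0 (fun k => k \in A) g k0A) => k1 k1A kmin.
set c := g k1 in kmin.
have c0 : 0 < c by move: k1A; rewrite inE.
pose g' k := if k \in A then g k - c else 0.
have g'0 k : 0 <= g' k.
  by rewrite /g'; case: ifP => // kA; rewrite subr_ge0 kmin.
have sub : [set k | 0 < g' k] \subset A :\ k1.
  apply/fintype.subsetP => k; rewrite !inE /g'; case: ifP; last by rewrite ltxx.
  rewrite inE => ->; rewrite andbT; apply: contraTN => /eqP ->.
  by rewrite /c subrr ltxx.
have subA : [set k | 0 < g' k] \subset A by apply: fintype.subset_trans sub (finset.subsetDl _ _).
have h1 : H * (\sum_k pi k * g' k) <= total_variation g'.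
  apply: IH => //; last by move=> B BA; apply: iso; apply: fintype.subset_trans BA subA.
  by rewrite -ltnS (leq_trans _ gm)// (cardsD1 k1 A) k1A ltnS fintype.subset_leq_card.
have h2 := iso A (subxx _).
have e1 : \sum_k pi k * g k = \sum_k pi k * g' k + c * \sum_(k in A) pi k.
  rewrite [\sum_(k in A) _]big_mkcond mulr_sumr -big_split /=; apply: eq_bigr => k _.
  by rewrite /g'; case: ifPn => [_|/gA ->]; ring.
(* Off [A] both [g] and [g'] vanish and on [A] they differ by [c], so removing the level [c]
   reverses the sign of no difference. *)
have e2 : total_variation g
  = total_variation g' + c * total_variation (fun k => (k \in A)%:R).
  rewrite /total_variation mulr_sumr -big_split; apply: eq_bigr => k _ /=.
  rewrite mulr_sumr -big_split; apply: eq_bigr => l _ /=.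
  rewrite mulrCA -mulrDr; congr (_ * _); rewrite /g'.
  have cl x : x \in A -> c <= g x by exact: kmin.
  case: ifPn => kA; case: ifPn => lA; rewrite ?(gA _ kA) ?(gA _ lA).
  - by rewrite subrr normr0 mulr0 addr0; congr `|_|; ring.
  - rewrite !subr0 normr1 (ger0_norm (g0 _)) ger0_norm ?subr_ge0 ?cl//; ring.
  - rewrite !sub0r !normrN normr1 (ger0_norm (g0 _)) ger0_norm ?subr_ge0 ?cl//; ring.
  - by rewrite subrr normr0; ring.
rewrite e1 e2 mulrDr mulrCA lerD// ler_pM2l//.
Qed.

Hypothesis pi_sum1 : \sum_k pi k = 1.
Hypothesis isoperimetry : forall A : {set T},
  H * Num.min (\sum_(k in A) pi k) (1 - \sum_(k in A) pi k)
    <= total_variation (fun k => (k \in A)%:R).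

Lemma subset_sum_le (A B : {set T}) : A \subset B ->
  \sum_(k in A) pi k <= \sum_(k in B) pi k.
Proof.
move=> /fintype.subsetP AB; rewrite [leLHS]big_mkcond [leRHS]big_mkcond; apply: ler_sum => k _.
by case: ifP => [/AB ->//|_]; case: ifP.
Qed.

(** The positive and negative parts of [g] each live on a set of mass at most 1/2, where the minimum
    in [isoperimetry] is the mass itself. Both sides of the inequality split additively over the two
    parts. *)
Lemma isoperimetry_L1 g :
  \sum_(k in [set k | (0 < g k)%R]) pi k <= 2^-1 ->
  \sum_(k in [set k | (g k < 0)%R]) pi k <= 2^-1 ->
  H * (\sum_k pi k * `|g k|) <= total_variation g.
Proof.
have pos f : (forall k, 0 <= f k) -> \sum_(k in [set k | (0 < f k)%R]) pi k <= 2^-1 ->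
    H * (\sum_k pi k * f k) <= total_variation f.
  move=> f0 fh; apply: coarea_le => // A /subset_sum_le Asub.
  apply: le_trans (isoperimetry A); rewrite ler_wpM2l//.
  by have := le_trans Asub fh; rewrite le_min lexx /=; lra.
move=> hp hn.
have h1 : H * (\sum_k pi k * Num.max (g k) 0) <= total_variation (fun k => Num.max (g k) 0).
  apply: pos => [k|]; first by rewrite le_max lexx orbT.
  by apply: le_trans hp; apply: subset_sum_le; apply/fintype.subsetP => k; rewrite !inE lt_max ltxx orbF.
have h2 : H * (\sum_k pi k * Num.max (- g k) 0) <= total_variation (fun k => Num.max (- g k) 0).
  apply: pos => [k|]; first by rewrite le_max lexx orbT.
  by apply: le_trans hn; apply: subset_sum_le; apply/fintype.subsetP => k; rewrite !inE lt_max ltxx orbF oppr_gt0.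
have gp (a : R) : 0 <= a -> Num.max a 0 = a by move=> a0; rewrite max_l.
have gn (a : R) : 0 <= a -> Num.max (- a) 0 = 0 by move=> a0; rewrite max_r ?oppr_le0.
have np (a : R) : a < 0 -> Num.max a 0 = 0 by move=> a0; rewrite max_r// ltW.
have nn (a : R) : a < 0 -> Num.max (- a) 0 = - a by move=> a0; rewrite max_l ?oppr_ge0 ?ltW.
have sg (a : R) : 0 <= a \/ a < 0 by case: (leP 0 a) => a0; [left|right].
have e1 : \sum_k pi k * `|g k| =
   \sum_k pi k * Num.max (g k) 0 + \sum_k pi k * Num.max (- g k) 0.
  rewrite -big_split; apply: eq_bigr => k _ /=; rewrite -mulrDr; congr (_ * _).
  have [gk|gk] := sg (g k); first by rewrite gp// gn// ger0_norm// addr0.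
  by rewrite np// nn// ltr0_norm// add0r.
have e2 : total_variation g =
   total_variation (fun k => Num.max (g k) 0) + total_variation (fun k => Num.max (- g k) 0).
  rewrite /total_variation -big_split; apply: eq_bigr => k _ /=.
  rewrite -big_split; apply: eq_bigr => l _ /=; rewrite -mulrDr; congr (_ * _).
  have [gk|gk] := sg (g k); have [gl|gl] := sg (g l).
  - by rewrite (gp _ gk) (gp _ gl) (gn _ gk) (gn _ gl) subrr normr0 addr0.
  - rewrite (gp _ gk) (gn _ gk) (np _ gl) (nn _ gl) subr0 sub0r opprK ger0_norm; last lra.
    by rewrite ger0_norm// ltr0_norm.
  - rewrite (np _ gk) (nn _ gk) (gp _ gl) (gn _ gl) subr0 sub0r !normrN.
    by rewrite (ger0_norm gl) (ltr0_norm gk) ltr0_norm; lra.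
  - by rewrite (np _ gk) (np _ gl) (nn _ gk) (nn _ gl) subrr normr0 add0r -normrN; congr `|_|; ring.
by rewrite e1 e2 mulrDr lerD.
Qed.

(** Take the smallest value of [x] whose strict upper set has mass at most 1/2. Were its strict
    lower set heavier than 1/2, the next smaller value would qualify as well. *)
Lemma weighted_median (x : T -> R) : exists m : R,
  \sum_(k in [set k | (m < x k)%R]) pi k <= 2^-1 /\
  \sum_(k in [set k | (x k < m)%R]) pi k <= 2^-1.
Proof.
have [k0 _] : exists k0 : T, true.
  have [k0 _|T0] := pickP (fun _ : T => true); first by exists k0.
  by move: pi_sum1; rewrite big_pred0 => // /eqP; rewrite eq_sym oner_eq0.
pose above k := \sum_(j in [set j | (x k < x j)%R]) pi j <= 2^-1.
case: (@arg_maxP _ _ _ k0 xpredT x isT) => k1 _ k1max.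
have ak1 : above k1.
  rewrite /above big1 ?invr_ge0 ?ler0n// => j; rewrite inE => lt.
  by have : x j <= x k1 := k1max j isT; rewrite leNgt lt.
case: (@arg_minP _ _ _ k1 above x ak1) => k2 ak2 k2min.
exists (x k2); split => //.
rewrite leNgt; apply/negP => big.
have [j0 j0P] : exists j, x j < x k2.
  have [j jP|none] := pickP (fun j => x j < x k2); first by exists j.
  by move: big; rewrite big_pred0 ?ltNge ?invr_ge0 ?ler0n// => j; rewrite inE none.
case: (@arg_maxP _ _ _ j0 (fun j => x j < x k2) x j0P) => j jP jmax.
have : above j; last by move=> /k2min; rewrite (leNgt (x k2)) jP.
rewrite /above.
have : \sum_(i in [set i | x j < x i]) pi i + \sum_(i in [set i | x i < x k2]) pi i <= 1.
  rewrite -pi_sum1 [X in X + _]big_mkcond [X in _ + X]big_mkcond -big_split.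
  apply: ler_sum => i _; rewrite !inE /=.
  case: ifP => lt1; case: ifP => lt2; rewrite ?addr0 ?add0r//.
  by have : x i <= x j := jmax _ lt2; rewrite leNgt lt1.
by lra.
Qed.

Lemma cauchy_schwarz_sum (I : finType) (a f g : I -> R) : (forall i, 0 <= a i) ->
  (\sum_i a i * (f i * g i)) ^+ 2
    <= (\sum_i a i * f i ^+ 2) * (\sum_i a i * g i ^+ 2).
Proof.
move=> a0; set F := \sum_i a i * f i ^+ 2; set G := \sum_i _ * g i ^+ 2.
set B := \sum_i _ * (f i * g i).
have q (s t : R) : 0 <= s ^+ 2 * F - 2 * s * t * B + t ^+ 2 * G.
  have -> : s ^+ 2 * F - 2 * s * t * B + t ^+ 2 * G
    = \sum_i a i * (s * f i - t * g i) ^+ 2.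
    rewrite /F /B /G !mulr_sumr -sumrB -big_split; apply: eq_bigr => i _ /=; ring.
  by apply: sumr_ge0 => i _; rewrite mulr_ge0 ?sqr_ge0.
have F0 : 0 <= F by apply: sumr_ge0 => i _; rewrite mulr_ge0 ?sqr_ge0.
have [F0'|F1] := eqVneq F 0.
  have [->|B0] := eqVneq B 0; first by rewrite F0' mul0r expr0n.
  (* With [F = 0] the quadratic is affine in [s]; this [s] gives it the value -1, a
     contradiction. *)
  have := q ((G + 1) / (2 * B)) 1; rewrite F0'.
  have -> : 2 * ((G + 1) / (2 * B)) * 1 * B = G + 1 by field.
  by lra.
have Fp : 0 < F by rewrite lt_neqAle eq_sym F1.
have := q B F.
have -> : B ^+ 2 * F - 2 * B * F * B + F ^+ 2 * G = F * (F * G - B ^+ 2) by ring.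
by rewrite pmulr_rge0// subr_ge0.
Qed.

(** The L1 inequality is applied to the signed square [g = y |y|] of [y = x - m]: it has the same
    positive and negative sets as [y], and |g k - g l| <= |y k - y l| (|y k| + |y l|).
    Cauchy-Schwarz and the degree bound absorb the last factor. [w] is not assumed symmetric, hence
    the degree [w k l + w l k]. *)
Lemma classical_cheeger (K : R) (x : T -> R) :
  (forall k, \sum_l (w k l + w l k) <= K * pi k) ->
  exists m : R, H ^+ 2 * (\sum_k pi k * (x k - m) ^+ 2)
    <= 2 * K * \sum_k \sum_l w k l * (x k - x l) ^+ 2.
Proof.
move=> deg; have [m [mp mn]] := weighted_median x; exists m.
pose y k := x k - m.
have ineq1 : H * (\sum_k pi k * y k ^+ 2)
    <= \sum_k \sum_l w k l * (`|y k - y l| * (`|y k| + `|y l|)).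
  pose g k := y k * `|y k|.
  have e k : `|g k| = y k ^+ 2 by rewrite normrM normr_id -expr2 real_normK ?num_real.
  have gp k : (0 < g k) = (m < x k).
    rewrite /g -(subr_gt0 m) -/(y k); case: (ltrgt0P (y k)) => yk; rewrite ?mulr0 ?ltxx//.
      by rewrite mulr_gt0.
    by apply/negbTE; rewrite -leNgt mulrN oppr_le0 -expr2 sqr_ge0.
  have gn k : (g k < 0) = (x k < m).
    rewrite /g -(subr_lt0 m) -/(y k); case: (ltrgt0P (y k)) => yk; rewrite ?mulr0 ?ltxx//.
      by apply/negbTE; rewrite -leNgt mulr_ge0// ltW.
    by rewrite mulrN oppr_lt0 -expr2 exprn_even_gt0//= lt_eqF.
  have : H * (\sum_k pi k * `|g k|) <= total_variation g.
    apply: isoperimetry_L1.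
      by rewrite (eq_bigl (fun k => k \in [set k | m < x k]))// => k; rewrite !inE gp.
    by rewrite (eq_bigl (fun k => k \in [set k | x k < m]))// => k; rewrite !inE gn.
  under eq_bigr do rewrite e.
  move=> /le_trans; apply; apply: ler_sum => k _; apply: ler_sum => l _.
  rewrite ler_wpM2l// /g; move: (y k) (y l) => a b.
  case: (lerP 0 a) => a0; case: (lerP 0 b) => b0;
  rewrite ?(ger0_norm a0) ?(ltr0_norm a0) ?(ger0_norm b0) ?(ltr0_norm b0).
  - have -> : a * a - b * b = (a - b) * (a + b) by ring.
    by rewrite normrM [`|a + b|]ger0_norm// addr_ge0.
  - rewrite (ger0_norm (x := a - b)); last lra.
    by rewrite ler_norml; apply/andP; split; nra.
  - rewrite (ler0_norm (x := a - b)); last lra.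
    by rewrite ler_norml; apply/andP; split; nra.
  - have -> : a * - a - b * - b = (a - b) * (- a - b) by ring.
    by rewrite normrM [`|- a - b|]ger0_norm; lra.
have ineq2 := @cauchy_schwarz_sum (T * T)%type (fun p => w p.1 p.2)
  (fun p => `|y p.1 - y p.2|) (fun p => `|y p.1| + `|y p.2|) (fun p => w_ge0 _ _).
move: ineq1; rewrite pair_big /= => ineq1.
have S0 : 0 <= \sum_k pi k * y k ^+ 2.
  by apply: sumr_ge0 => k _; rewrite mulr_ge0 ?sqr_ge0.
have ineq3 : \sum_(p : T * T) w p.1 p.2 * (`|y p.1| + `|y p.2|) ^+ 2
    <= 2 * K * \sum_k pi k * y k ^+ 2.
  have step (p : T * T) : w p.1 p.2 * (`|y p.1| + `|y p.2|) ^+ 2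
      <= 2 * (w p.1 p.2 * y p.1 ^+ 2) + 2 * (w p.1 p.2 * y p.2 ^+ 2).
    rewrite -[y p.1 ^+ 2]real_normK ?num_real// -[y p.2 ^+ 2]real_normK ?num_real//.
    move: (w_ge0 p.1 p.2) (sqr_ge0 (`|y p.1| - `|y p.2|)); set v := w _ _.
    by move=> v0 d0; have := mulr_ge0 v0 d0; lra.
  apply: le_trans (ler_sum _ (fun p _ => step p)) _.
  rewrite big_split /= -!mulr_sumr.
  rewrite -(pair_bigA _ (fun k l => w k l * y k ^+ 2)) -(pair_bigA _ (fun k l => w k l * y l ^+ 2)) /=.
  rewrite [X in 2 * _ + 2 * X]exchange_big /= -mulrDr -mulrA ler_pM2l ?ltr0n//.
  rewrite -big_split mulr_sumr; apply: ler_sum => k _ /=.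
  rewrite -big_split /= mulrA.
  have -> : \sum_l (w k l * y k ^+ 2 + w l k * y k ^+ 2) = (\sum_l (w k l + w l k)) * y k ^+ 2.
    by rewrite mulr_suml; apply: eq_bigr => l _; rewrite mulrDl.
  by rewrite ler_wpM2r ?sqr_ge0.
rewrite pair_big /=.
have -> : \sum_(p : T * T) w p.1 p.2 * (x p.1 - x p.2) ^+ 2
   = \sum_(p : T * T) w p.1 p.2 * `|y p.1 - y p.2| ^+ 2.
  by apply: eq_bigr => p _; rewrite real_normK ?num_real// /y; congr (_ * _ ^+ 2); ring.
rewrite -/(y _); set S := \sum_k _ in ineq1 ineq3 S0 *.
move: ineq2 => /=; set E := \sum_(p : T * T) w p.1 p.2 * `|y p.1 - y p.2| ^+ 2 => ineq2.
have E0 : 0 <= E by apply: sumr_ge0 => p _; apply: mulr_ge0; [exact: w_ge0 | exact: sqr_ge0].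
have [->|S1] := eqVneq S 0.
  (* What is left is the sign of [K]; the degree bound at a point of positive mass provides it. *)
  rewrite mulr0 mulr_ge0// mulr_ge0//.
  have [k0 pk] : exists k0, 0 < pi k0.
    have [k0 pk|none] := pickP (fun k => 0 < pi k); first by exists k0.
    move: pi_sum1; rewrite big1 => [/eqP|k _]; first by rewrite eq_sym oner_eq0.
    by apply/le_anti; rewrite pi_ge0 leNgt none.
  rewrite -(pmulr_lge0 _ pk); apply: le_trans (deg k0).
  by apply: sumr_ge0 => l _; rewrite addr_ge0.
have Sp : 0 < S by rewrite lt_neqAle eq_sym S1.
rewrite -(ler_pM2r Sp).
have -> : H ^+ 2 * S * S = (H * S) ^+ 2 by ring.
apply: le_trans (_ : E * (2 * K * S) <= _); last by rewrite mulrC mulrAC.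
apply: le_trans (le_trans ineq2 _); last by rewrite ler_wpM2l.
by rewrite ler_sqr ?nnegrE ?(le_trans _ ineq1)// mulr_ge0.
Qed.

End ClassicalCheeger.

(** * Real inequalities and the minimum principle on a strip *)

Section RealAnalysis.
Variable R : realType.
Implicit Types (x y u : R).

Lemma derivable_continuous (f df : R -> R) : (forall x, is_derive x 1 f (df x)) ->
  continuous f.
Proof.
by move=> fd x; apply/differentiable_continuous/derivable1_diffP; case: (fd x).
Qed.

Lemma mean_value (f df : R -> R) (a b : R) : (forall x, is_derive x 1 f (df x)) ->
  a < b -> exists2 c, a < c < b & f b - f a = df c * (b - a).
Proof.
move=> fd ab.
have [|c cab E] := MVT ab (fun x _ => fd x).
  by apply: continuous_subspaceT; exact: derivable_continuous fd.
by exists c => //; move: cab; rewrite in_itv.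
Qed.

Lemma expR_ge_quadratic u : 0 <= u -> 1 + u + u ^+ 2 / 2 <= expR u.
Proof.
rewrite le_eqVlt => /predU1P[<-|u0]; first by rewrite expR0; lra.
pose f x := expR x - (x + x ^+ 2 / 2).
have fd x : is_derive x 1 f (expR x - (1 + x)).
  apply: is_derive_eq; rewrite !scaler0 add0r /GRing.scale /=; lra.
have [c /andP[c0 _]] := mean_value fd u0.
rewrite /f expR0 !subr0 expr0n /= mul0r addr0 subr0.
have := expR_ge1Dx c => h; have : 0 <= (expR c - (1 + c)) * u by rewrite mulr_ge0; lra.
by move=> h1 h2; move: h1; rewrite -h2; lra.
Qed.

(** The Pade bound (2 + u) / (2 - u) <= e^u: [f] is nonincreasing because (1 - x) e^x <= 1. It
    serves the case [u < 0] of the discriminant. *)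
Lemma expR_pade u : u <= 0 -> 2 + u <= expR u * (2 - u).
Proof.
rewrite le_eqVlt => /predU1P[->|u0]; first by rewrite expR0; lra.
pose f x := expR x * (2 - x) - x.
have fd x : is_derive x 1 f (expR x * (1 - x) - 1).
  apply: is_derive_eq; rewrite /GRing.scale /=; lra.
have [c /andP[_ c0]] := mean_value fd u0.
rewrite /f expR0 !subr0 => E.
have ce : expR c * (1 - c) <= 1.
  rewrite -[leRHS](expRxMexpNx_1 c) ler_pM2l ?expR_gt0//.
  by have := expR_ge1Dx (- c); lra.
have : 0 <= (expR c * (1 - c) - 1) * u by apply: mulr_le0; [lra | exact: ltW].
by move: E; lra.
Qed.

(* The discriminant of the quadratic in [F] of [entropy_pointwise]; it is
   convex in [u] with minimum [0] at [u = 0]. *)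
Lemma discriminant_le (l u : R) : 0 <= l -> u <= l ->
  (l + 2) ^+ 2 <= (l + 1 + expR u) * (l + 2 - u).
Proof.
move=> l0 ul.
have -> : (l + 1 + expR u) * (l + 2 - u)
  = (l + 2) ^+ 2 + ((l + 2) * (expR u - 1 - u) - u * (expR u - 1)) by ring.
rewrite lerDl.
have e1 : 0 <= expR u - 1 - u by have := expR_ge1Dx u; lra.
have [u0|u0] := leP 0 u.
  have := expR_ge_quadratic u0; move: e1; set e := expR u => e1 e2.
  have : (u + 2) * (e - 1 - u) <= (l + 2) * (e - 1 - u) by rewrite ler_wpM2r//; lra.
  by nra.
have := expR_pade (ltW u0); move: e1; set e := expR u => e1 e2.
have : 2 * (e - 1 - u) <= (l + 2) * (e - 1 - u) by rewrite ler_wpM2r//; lra.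
by nra.
Qed.

(** In the application [t ^+ 2] is a probability density and [F] the mean of [t]; the term in
    [t ^+ 2 - 1] then averages to 0 and the inequality becomes Ent (t^2) <= (l + 2) Var t. As an
    inequality in [F] it is quadratic with leading coefficient [l + 1 + t ^+ 2]. The constant 2 is
    the ratio of entropy to variance to second order near t = 1. *)
Lemma entropy_pointwise (l t F : R) : 0 <= l -> 0 < t -> ln (t ^+ 2) <= l ->
  t ^+ 2 * ln (t ^+ 2) <= (l + 2) * (t - F) ^+ 2 + F ^+ 2 * (t ^+ 2 - 1).
Proof.
move=> l0 t0 tl; have t20 : 0 < t ^+ 2 by rewrite exprn_gt0.
have := discriminant_le l0 tl; rewrite lnK//.
move: tl; set u := ln _ => tl disc.
rewrite -subr_ge0.
set a := l + 1 + t ^+ 2.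
have a0 : 0 < a by rewrite /a; lra.
rewrite -(pmulr_rge0 _ a0).
have -> : a * ((l + 2) * (t - F) ^+ 2 + F ^+ 2 * (t ^+ 2 - 1) - t ^+ 2 * u)
  = (a * F - (l + 2) * t) ^+ 2
    + t ^+ 2 * ((l + 1 + t ^+ 2) * (l + 2 - u) - (l + 2) ^+ 2) by rewrite /a; ring.
by rewrite addr_ge0 ?sqr_ge0// mulr_ge0 ?sqr_ge0// subr_ge0.
Qed.

(** The Caratheodory slope [g] of [f'] at [c] is continuous with value [d] there. If [d < 0], then
    [f'] is negative just to the right of [c], and the mean value theorem contradicts minimality. *)
Lemma second_derivative_min (f f' : R -> R) (a b c d : R) :
  a < c < b -> (forall x, is_derive x 1 f (f' x)) -> is_derive c 1 f' d ->
  (forall x, a < x < b -> f c <= f x) -> 0 <= d.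
Proof.
move=> /andP[ac cb] fd f'd fmin.
have f'c : f' c = 0.
  have ab : a <= b by apply/ltW/(lt_trans ac).
  have [|||_ <-] := @derive1_at_min R f a b c ab.
  - by move=> t _; case: (fd t).
  - by rewrite in_itv /= ac cb.
  - by move=> t; rewrite in_itv; exact: fmin.
  by case: (fd c).
have /is_derive1_caratheodory[g [gE gc gcd]] := f'd.
rewrite leNgt; apply/negP => d0.
have : \forall z \near c, g z < 0.
  by apply: (cvgr_lt _ gc); rewrite gcd.
move=> /nbhs_ballP[e /= e0 eP].
pose h := Num.min (e / 2) ((b - c) / 2).
have h0 : 0 < h by rewrite lt_min !divr_gt0// subr_gt0.
have he : h <= e / 2 by rewrite ge_min lexx.
have hb : h <= (b - c) / 2 by rewrite ge_min lexx orbT.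
have ch : c < c + h by rewrite ltrDl.
have [z /andP[cz zh]] := mean_value fd ch.
have := fmin (c + h); rewrite (lt_trans ac)//=; have -> : c + h < b by lra.
move=> /(_ isT); have := gE z; rewrite f'c subr0 => -> le1 E.
have gz : g z < 0.
  by apply: eP; rewrite /ball /= ltr_norml; apply/andP; split; lra.
have : g z * (z - c) < 0 by rewrite nmulr_rlt0// subr_gt0.
have hh : c + h - c = h by ring.
rewrite hh in E; move=> neg; have : g z * (z - c) * h < 0 by rewrite nmulr_rlt0.
by rewrite -E; lra.
Qed.

Lemma is_derive_bigsum (T : Type) (s : seq T) (f : T -> R -> R) (df : T -> R) x :
  (forall t, is_derive x 1 (f t) (df t)) ->
  is_derive x 1 (fun x => \sum_(t <- s) f t x) (\sum_(t <- s) df t).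
Proof.
move=> fd; elim: s => [|t s IH].
  rewrite big_nil (_ : (fun x => _) = cst 0); first exact: is_derive_cst.
  by apply/funext => z; rewrite big_nil.
rewrite big_cons (_ : (fun x => _) = f t + (fun x => \sum_(t <- s) f t x)).
  exact: is_deriveD.
by apply/funext => z; rewrite big_cons.
Qed.

Lemma continuous_bigsum (T : Type) (X : topologicalType) (s : seq T) (f : T -> X -> R) :
  (forall t, continuous (f t)) -> continuous (fun p => \sum_(t <- s) f t p).
Proof.
move=> fc; elim: s => [|t s IH] z.
  rewrite (_ : (fun p => _) = cst 0); first exact: cst_continuous.
  by apply/funext => w; rewrite big_nil.
rewrite (_ : (fun p => _) = f t + (fun p => \sum_(t <- s) f t p)).
  by apply: continuousD; [exact: fc | exact: IH].
by apply/funext => w; rewrite big_cons.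
Qed.

(** Real part of the sum of (a + i b) e^(mu (x + i y)) over the triples ((a, b), mu) of [s]. The
    frequencies are real, which keeps the sum bounded on vertical strips. *)
Definition strip_sum (s : seq (R * R * R)) x y : R :=
  \sum_(t <- s) expR (t.2 * x) * (t.1.1 * cos (t.2 * y) - t.1.2 * sin (t.2 * y)).

Lemma strip_sum_lower_bound s : exists B, forall x y, 0 <= x <= 2^-1 ->
  B <= strip_sum s x y.
Proof.
elim: s => [|[[a b] mu] s [B HB]].
  by exists 0 => x y _; rewrite /strip_sum big_nil.
exists (- (expR `|mu| * (`|a| + `|b|)) + B) => x y x01.
rewrite /strip_sum big_cons /= lerD ?HB//.
rewrite lerNl; apply: (@le_trans _ _ `|expR (mu * x) * (a * cos (mu * y) - b * sin (mu * y))|).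
  by rewrite -normrN ler_norm.
rewrite normrM (ger0_norm (expR_ge0 _)); apply: ler_pM => //; first exact: expR_ge0.
  rewrite ler_expR (le_trans (ler_norm _))// normrM ler_piMr//.
  by rewrite ger0_norm; lra.
apply: le_trans (ler_normB _ _) _; rewrite !normrM lerD// ler_piMr//.
  by rewrite ler_norml cos_geN1 cos_le1.
by rewrite ler_norml sin_geN1 sin_le1.
Qed.

(* Minimum principle on a rectangle: [strip_sum] is harmonic in [(x, y)], and the
   barrier [e (y^2 - 2x^2 + 1/2)] is strictly superharmonic, nonnegative on the
   strip and unbounded as [|y|] grows. *)
Lemma three_lines s (M : R) :
  (forall y, 0 <= strip_sum s 0 y) -> (forall y, M <= strip_sum s 2^-1 y) ->
  forall x, 0 <= x <= 2^-1 -> 2 * M * x <= strip_sum s x 0.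
Proof.
move=> le0 le1 x0 /andP[x00 x01].
pose v e x y := strip_sum s x y - 2 * M * x + e * (y ^+ 2 - 2 * x ^+ 2 + 2^-1).
(* Letting [e] tend to 0 amounts to one choice: [e] is the supposed deficit [d] at [(x0, 0)], where
   the barrier adds at most [d / 2]. *)
suff vpos e : 0 < e -> 0 <= v e x0 0.
  rewrite leNgt; apply/negP => neg.
  have d0 : 0 < 2 * M * x0 - strip_sum s x0 0 by lra.
  have := vpos _ d0; rewrite /v expr0n /= sub0r.
  move: d0; set d := 2 * M * x0 - _ => d0.
  have -> : strip_sum s x0 0 - 2 * M * x0 = - d by rewrite /d; ring.
  have : d * (- (2 * x0 ^+ 2) + 2^-1) <= d * 2^-1.
    by rewrite ler_pM2l// gerDr oppr_le0 mulr_ge0// sqr_ge0.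
  by lra.
move=> e0.
pose uxx x y := \sum_(t <- s) t.2 ^+ 2 * (expR (t.2 * x) *
  (t.1.1 * cos (t.2 * y) - t.1.2 * sin (t.2 * y))).
pose ux x y := \sum_(t <- s) t.2 * (expR (t.2 * x) *
  (t.1.1 * cos (t.2 * y) - t.1.2 * sin (t.2 * y))).
pose uy x y := \sum_(t <- s) expR (t.2 * x) *
  (t.2 * (- t.1.1 * sin (t.2 * y) - t.1.2 * cos (t.2 * y))).
pose vx x y := ux x y - 2 * M - 4 * e * x.
pose vy x y := uy x y + 2 * e * y.
have dx y x : is_derive x 1 (fun x => v e x y) (vx x y).
  have h := @is_derive_bigsum _ s (fun t x => expR (t.2 * x) *
    (t.1.1 * cos (t.2 * y) - t.1.2 * sin (t.2 * y)))
    (fun t => t.2 * (expR (t.2 * x) * (t.1.1 * cos (t.2 * y) - t.1.2 * sin (t.2 * y)))) x.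
  have {h} h : is_derive x 1 (fun x => strip_sum s x y) (ux x y).
    by apply: h => t; apply: is_derive_eq; rewrite /GRing.scale /=; ring.
  by apply: is_derive_eq; rewrite /vx /GRing.scale /=; ring.
have dxx y x : is_derive x 1 (fun x => vx x y) (uxx x y - 4 * e).
  have h := @is_derive_bigsum _ s (fun t x => t.2 * (expR (t.2 * x) *
    (t.1.1 * cos (t.2 * y) - t.1.2 * sin (t.2 * y))))
    (fun t => t.2 ^+ 2 * (expR (t.2 * x) * (t.1.1 * cos (t.2 * y) - t.1.2 * sin (t.2 * y)))) x.
  have {h} h : is_derive x 1 (fun x => ux x y) (uxx x y).
    by apply: h => t; apply: is_derive_eq; rewrite /GRing.scale /=; ring.
  by apply: is_derive_eq; rewrite /vx /GRing.scale /=; ring.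
have dy x y : is_derive y 1 (fun y => v e x y) (vy x y).
  have h := @is_derive_bigsum _ s (fun t y => expR (t.2 * x) *
    (t.1.1 * cos (t.2 * y) - t.1.2 * sin (t.2 * y)))
    (fun t => expR (t.2 * x) * (t.2 * (- t.1.1 * sin (t.2 * y) - t.1.2 * cos (t.2 * y)))) y.
  have {h} h : is_derive y 1 (fun y => strip_sum s x y) (uy x y).
    by apply: h => t; apply: is_derive_eq; rewrite /GRing.scale /=; ring.
  by apply: is_derive_eq; rewrite /vy /GRing.scale /=; ring.
have dyy x y : is_derive y 1 (fun y => vy x y) (- uxx x y + 2 * e).
  have h := @is_derive_bigsum _ s (fun t y => expR (t.2 * x) *
    (t.2 * (- t.1.1 * sin (t.2 * y) - t.1.2 * cos (t.2 * y))))
    (fun t => - (t.2 ^+ 2 * (expR (t.2 * x) * (t.1.1 * cos (t.2 * y) - t.1.2 * sin (t.2 * y))))) y.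
  have {h} h : is_derive y 1 (fun y => uy x y) (- uxx x y).
    rewrite /uxx -sumrN.
    by apply: h => t; apply: is_derive_eq; rewrite /GRing.scale /=; ring.
  by apply: is_derive_eq; rewrite /vy /GRing.scale /=; ring.
have vcont : continuous (fun p : R * R => v e p.1 p.2).
  have c1 : continuous (fun p : R * R => p.1) by move=> p; exact: cvg_fst.
  have c2 : continuous (fun p : R * R => p.2) by move=> p; exact: cvg_snd.
  have cm (k : R) (f : R * R -> R) : continuous f -> continuous (fun p => k * f p).
    by move=> fc p; apply: continuousM; [exact: cst_continuous | exact: fc].
  have csq (f : R * R -> R) : continuous f -> continuous (fun p => f p ^+ 2).
    by move=> fc p; apply: continuousM; exact: fc.
  have cterm t : continuous (fun p : R * R => expR (t.2 * p.1) *
      (t.1.1 * cos (t.2 * p.2) - t.1.2 * sin (t.2 * p.2))).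
    move=> q; apply: cvgM.
      by apply: (@continuous_comp _ _ _ (fun p : R * R => t.2 * p.1)); [exact: (cm)|exact: continuous_expR].
    apply: cvgB.
      apply: (cm) => {}q.
      by apply: (@continuous_comp _ _ _ (fun p : R * R => t.2 * p.2)); [exact: (cm)|exact: continuous_cos].
    apply: (cm) => {}q.
    by apply: (@continuous_comp _ _ _ (fun p : R * R => t.2 * p.2)); [exact: (cm)|exact: continuous_sin].
  move=> p; apply: cvgD.
    by apply: cvgB; [exact: continuous_bigsum | exact: cm c1 p].
  apply: (cm) => {}p; apply: cvgD; last exact: cvg_cst.
  by apply: cvgB; [exact: csq c2 p | exact: cm (csq _ c1) p].
have [B HB] := strip_sum_lower_bound s.
(* Height of the rectangle: [e N^2 >= |B| + |M|] lets the barrier outweigh the lower bound [B] and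
   the linear term on the horizontal sides. *)
pose N := 1 + (`|B| + `|M|) / e.
have N1 : 1 <= N by rewrite lerDl divr_ge0 ?addr_ge0 ?normr_ge0// ltW.
have N2 : `|B| + `|M| <= e * N ^+ 2.
  have : e * N <= e * N ^+ 2.
    by rewrite ler_pM2l// expr2 ler_peMl//; lra.
  have -> : e * N = e + (`|B| + `|M|) by rewrite /N; field; rewrite gt_eqF.
  by lra.
pose A := (`[0, 2^-1] `*` `[- N, N])%classic : set (R * R).
have Acomp : compact A by apply: compact_setX; exact: segment_compact.
have half0 : 0 <= 2^-1 :> R by lra.
have A0 : (A !=set0)%classic.
  by exists (0, 0) => /=; split => /=; rewrite in_itv /=; apply/andP; split=> //; lra.
have [|[xc yc]] := @compact_EVT_min _ R (fun p => v e p.1 p.2) A A0 Acomp.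
  exact: continuous_subspaceT.
rewrite inE /A /= => -[]; rewrite !in_itv /= => /andP[xc0 xc1] /andP[yc0 yc1] vmin.
have vminA x y : 0 <= x <= 2^-1 -> - N <= y <= N -> v e xc yc <= v e x y.
  by move=> hx hy; apply: (vmin (x, y)); rewrite inE /A /=; split; rewrite in_itv.
apply: (@le_trans _ _ (v e xc yc)); last by apply: vminA; rewrite ?x00//; apply/andP; split; lra.
have bar x y : 0 <= x <= 2^-1 -> e * y ^+ 2 <= e * (y ^+ 2 - 2 * x ^+ 2 + 2^-1).
  by move=> /andP[hx hx']; rewrite ler_pM2l//; nra.
have Mx x : 0 <= x <= 2^-1 -> `|2 * M * x| <= `|M|.
  move=> /andP[hx hx']; rewrite !normrM ger0_norm// (ger0_norm hx) mulrC mulrA ler_piMl//; lra.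
have ends x y : 0 <= x <= 2^-1 -> y ^+ 2 = N ^+ 2 -> 0 <= v e x y.
  move=> hx yN; rewrite /v; have := bar x y hx; rewrite yN => b1.
  have := HB x y hx; have := Mx x hx; rewrite ler_norml => /andP[_ m1].
  have := ler_norm (- B); rewrite normrN; move: N2 b1.
  by lra.
have [->|xn0] := eqVneq xc 0.
  rewrite /v; have := bar 0 yc; rewrite lexx half0 => /(_ isT).
  have := le0 yc; have : 0 <= e * yc ^+ 2 by rewrite mulr_ge0 ?sqr_ge0// ltW.
  by lra.
have [->|xn1] := eqVneq xc 2^-1.
  rewrite /v; have := bar 2^-1 yc; rewrite lexx half0 => /(_ isT).
  have := le1 yc; have : 0 <= e * yc ^+ 2 by rewrite mulr_ge0 ?sqr_ge0// ltW.
  by lra.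
have [yN|yn0] := eqVneq yc (- N); first by apply: ends; rewrite ?xc0// yN sqrrN.
have [yN|yn1] := eqVneq yc N; first by apply: ends; rewrite ?xc0// yN.
exfalso.
have xI : 0 < xc < 2^-1 by rewrite !lt_neqAle eq_sym xn0 xn1 xc0.
have yI : - N < yc < N by rewrite !lt_neqAle eq_sym yn0 yn1 yc0.
(* At an interior minimum both second derivatives are nonnegative, yet their sum, the Laplacian, is
   [- 2 e]. *)
have h1 : 0 <= uxx xc yc - 4 * e.
  apply: (second_derivative_min xI (dx yc) (dxx yc xc)) => x /andP[hx hx'].
  by apply: vminA; rewrite ?yc0// !ltW.
have h2 : 0 <= - uxx xc yc + 2 * e.
  apply: (second_derivative_min yI (dy xc) (dyy xc yc)) => y /andP[hy hy'].
  by apply: vminA; rewrite ?xc0// !ltW.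
by lra.
Qed.

End RealAnalysis.

Local Open Scope complex_scope.
Local Open Scope sesquilinear_scope.

(** * Functional calculus in a unitary eigenframe *)

Section ComplexNumbers.
Variable R : realType.
Implicit Types (z w : R[i]) (a b : R).
Local Notation Re := (@complex.Re R).

Lemma ReD z w : Re (z + w) = Re z + Re w.
Proof. by case: z; case: w. Qed.

Lemma ReN z : Re (- z) = - Re z.
Proof. by case: z. Qed.

Lemma ReB z w : Re (z - w) = Re z - Re w.
Proof. by rewrite ReD ReN. Qed.

Lemma Re_sum (I : Type) (r : seq I) (P : pred I) (F : I -> R[i]) :
  Re (\sum_(i <- r | P i) F i) = \sum_(i <- r | P i) Re (F i).
Proof. exact: (big_morph Re ReD). Qed.

Lemma Re_mulrC a z : Re (a%:C * z) = a * Re z.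
Proof. by case: z => x y /=; rewrite mul0r subr0. Qed.

Lemma ReJ z : Re (Num.conj z) = Re z.
Proof. by case: z. Qed.

Lemma conjCE z : Num.conj z = conjc z.
Proof. by []. Qed.

Lemma conj_real a : Num.conj (a%:C : R[i]) = a%:C.
Proof. by rewrite conjCE conjc_real. Qed.

Definition nsq z : R := Re z ^+ 2 + complex.Im z ^+ 2.

Lemma mulr_conj z : z * Num.conj z = (nsq z)%:C.
Proof.
rewrite conjCE /nsq; case: z => x y /=.
by apply/eqP; rewrite eq_complex /=; apply/andP; split; apply/eqP; ring.
Qed.

Lemma nsq_ge0 z : 0 <= nsq z.
Proof. by rewrite addr_ge0 ?sqr_ge0. Qed.

Lemma nsqM z w : nsq (z * w) = nsq z * nsq w.
Proof. by rewrite /nsq; case: z => x y; case: w => u v /=; ring. Qed.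

Lemma nsqC a : nsq a%:C = a ^+ 2.
Proof. by rewrite /nsq /= expr0n addr0. Qed.

Lemma nsq_eq0 z : (nsq z == 0) = (z == 0).
Proof.
by rewrite /nsq paddr_eq0 ?sqr_ge0// !sqrf_eq0 eq_complex; case: z.
Qed.

End ComplexNumbers.

Section Adjoint.
Variable C : numClosedFieldType.

Lemma adj_mul m n p (A : 'M[C]_(m, n)) (B : 'M[C]_(n, p)) :
  (A *m B)^t* = B^t* *m A^t*.
Proof. by rewrite trmx_mul map_mxM. Qed.

Lemma adjD m n (A B : 'M[C]_(m, n)) : (A + B)^t* = A^t* + B^t*.
Proof. by rewrite linearD map_mxD. Qed.

Lemma adjN m n (A : 'M[C]_(m, n)) : (- A)^t* = - A^t*.
Proof. by rewrite linearN map_mxN. Qed.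

Lemma adjB m n (A B : 'M[C]_(m, n)) : (A - B)^t* = A^t* - B^t*.
Proof. by rewrite adjD adjN. Qed.

Lemma adjZ m n (c : C) (A : 'M[C]_(m, n)) : (c *: A)^t* = Num.conj c *: A^t*.
Proof. by rewrite linearZ /= map_mxZ. Qed.

Lemma adj1 n : (1%:M : 'M[C]_n)^t* = 1%:M.
Proof. by rewrite trmx1 map_mx1. Qed.

Lemma adj_delta m n (i : 'I_m) (j : 'I_n) :
  (delta_mx i j : 'M[C]_(m, n))^t* = delta_mx j i.
Proof. by rewrite trmx_delta map_delta_mx. Qed.

Lemma tr_adj n (A : 'M[C]_n) : \tr (A^t*) = Num.conj (\tr A).
Proof. by rewrite /mxtrace rmorph_sum /=; apply: eq_bigr => i _; rewrite !mxE. Qed.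

Lemma unitarymxV n (U : 'M[C]_n) : U \is unitarymx -> U^t* *m U = 1%:M.
Proof. by move/unitarymxP/mulmx1C. Qed.

End Adjoint.

Section Calculus.
Variables (C : numClosedFieldType) (n : nat).
Local Notation M := 'M[C]_n.
Implicit Types (U V A X : M) (g h : 'I_n -> C).

(** The rows of [U] are left eigenvectors, as for [spectralmx]. The eigenframe is a parameter so
    that all functions of a matrix can share one; [ccalc_uniq] makes its choice immaterial. *)
Definition ccalc U g : M := U^t* *m diag_mx (\row_i g i) *m U.

Lemma ccalc_entry U g a b : ccalc U g a b = \sum_i Num.conj (U i a) * g i * U i b.
Proof.
by rewrite mxE; apply: eq_bigr => i _; rewrite mul_mx_diag !mxE.
Qed.

Lemma eq_ccalc U g h : g =1 h -> ccalc U g = ccalc U h.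
Proof. by move=> gh; apply/matrixP => a b; rewrite !ccalc_entry; apply: eq_bigr => i _; rewrite gh. Qed.

Lemma ccalcM U g h : U \is unitarymx ->
  ccalc U g *m ccalc U h = ccalc U (fun i => g i * h i).
Proof.
move=> Uu; rewrite /ccalc !mulmxA.
rewrite -[U^t* *m diag_mx _ *m U *m U^t*]mulmxA (unitarymxP Uu) mulmx1.
rewrite -[_ *m diag_mx _ *m diag_mx _]mulmxA mulmx_diag.
suff -> : \row_j ((\row_i g i) 0 j * (\row_i h i) 0 j) = \row_i (g i * h i) by [].
by apply/rowP => i; rewrite !mxE.
Qed.

Lemma ccalc_adj U g : (ccalc U g)^t* = ccalc U (fun i => Num.conj (g i)).
Proof.
apply/matrixP => a b; rewrite !mxE rmorph_sum.
by apply: eq_bigr => i _; rewrite !mul_mx_diag !mxE !rmorphM /= conjCK; ring.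
Qed.

Lemma ccalc_const U c : U \is unitarymx -> ccalc U (fun=> c) = c%:M.
Proof.
move=> Uu; rewrite /ccalc.
have -> : \row__ c = const_mx c :> 'rV_n by apply/rowP => i; rewrite !mxE.
by rewrite diag_const_mx mul_mx_scalar -scalemxAl unitarymxV// scalemx1.
Qed.

Lemma ccalcZ U c g : c *: ccalc U g = ccalc U (fun i => c * g i).
Proof.
apply/matrixP => a b; rewrite mxE !ccalc_entry mulr_sumr.
by apply: eq_bigr => i _; rewrite !mulrA [c * _]mulrC.
Qed.

Lemma ccalcD U g h : ccalc U g + ccalc U h = ccalc U (fun i => g i + h i).
Proof.
apply/matrixP => a b; rewrite mxE !ccalc_entry -big_split /=.
by apply: eq_bigr => i _; rewrite mulrDr mulrDl.
Qed.

Lemma ccalc_tr U g : U \is unitarymx -> \tr (ccalc U g) = \sum_i g i.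
Proof.
move=> Uu; rewrite /ccalc mxtrace_mulC mulmxA (unitarymxP Uu) mul1mx mxtrace_diag.
by apply: eq_bigr => i _; rewrite mxE.
Qed.

Lemma ccalc_row U g i : U \is unitarymx -> row i U *m ccalc U g = g i *: row i U.
Proof.
move=> Uu; rewrite /ccalc !mulmxA -row_mul (unitarymxP Uu) row1 rowE scalemxAl.
congr (_ *m _); apply/rowP => j; rewrite mul_mx_diag !mxE eqxx /=.
by case: eqP => [->|]; rewrite ?mulr1 ?mul1r// mulr0 mul0r.
Qed.

Lemma row_unitary U i j : U \is unitarymx ->
  (row i U *m (row j U)^t*) 0 0 = (i == j)%:R.
Proof.
move=> Uu; have /matrixP/(_ i j) := unitarymxP Uu; rewrite !mxE => <-.
by apply: eq_bigr => k _; rewrite !mxE.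
Qed.

Lemma row_unitary_neq0 U i : U \is unitarymx -> row i U != 0.
Proof.
move=> Uu; apply/eqP => r0; have := row_unitary i i Uu.
by rewrite r0 mul0mx mxE eqxx => /eqP; rewrite eq_sym oner_eq0.
Qed.

Lemma unitary_coord_neq0 U (v : 'rV_n) : U \is unitarymx -> v != 0 ->
  exists i, (v *m U^t*) 0 i != 0.
Proof.
move=> Uu v0; apply/rV0Pn; apply: contra_neq v0 => /(congr1 (mulmx^~ U)).
by rewrite -mulmxA unitarymxV// mulmx1 mul0mx.
Qed.

Lemma ccalc_form U g (v : 'rV[C]_n) :
  (v *m ccalc U g *m v^t*) 0 0 =
  \sum_i g i * ((v *m U^t*) 0 i * Num.conj ((v *m U^t*) 0 i)).
Proof.
rewrite /ccalc !mulmxA.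
have -> : v *m U^t* *m diag_mx (\row_i g i) *m U *m v^t* =
   v *m U^t* *m diag_mx (\row_i g i) *m (v *m U^t*)^t*.
  by rewrite adj_mul trmxCK -!mulmxA.
rewrite mxE; apply: eq_bigr => i _.
by rewrite mul_mx_diag; move: (v *m U^t*) => w; rewrite !mxE -mulrA mulrCA.
Qed.

(* [P U^*] intertwines the two diagonal forms, hence their images by [f]. *)
Lemma ccalc_uniq (f : C -> C) U V g h : U \is unitarymx -> V \is unitarymx ->
  ccalc U g = ccalc V h -> ccalc U (f \o g) = ccalc V (f \o h).
Proof.
move=> Uu Vu E; pose Q := U *m V^t*.
have VQ : V = Q^t* *m U by rewrite /Q adj_mul trmxCK -mulmxA unitarymxV// mulmx1.
have QE i j : g i * Q i j = Q i j * h j.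
  have : U *m (ccalc U g) *m V^t* = U *m ccalc V h *m V^t* by rewrite E.
  rewrite /ccalc !mulmxA (unitarymxP Uu) mul1mx -[_ *m V *m _]mulmxA (unitarymxP Vu) mulmx1.
  rewrite -mulmxA -/Q => /matrixP/(_ i j).
  by rewrite mul_diag_mx mul_mx_diag !mxE.
have QfE : diag_mx (\row_i f (g i)) *m Q = Q *m diag_mx (\row_i f (h i)).
  move: (Q) QE => B BE; apply/matrixP => i j.
  rewrite mul_diag_mx mul_mx_diag !mxE; have := BE i j.
  have [->|b0] := eqVneq (B i j) 0; first by rewrite !mulr0 !mul0r.
  by rewrite mulrC => /(mulfI b0) ->; rewrite mulrC.
have -> : ccalc V (f \o h) = U^t* *m (Q *m diag_mx (\row_i f (h i))) *m V.
  by rewrite /Q !mulmxA unitarymxV// mul1mx.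
by rewrite -QfE /Q /ccalc -!mulmxA unitarymxV// mulmx1.
Qed.

Lemma ccalc_eigen U g z : U \is unitarymx ->
  eigenvalue (ccalc U g) z <-> exists i, z = g i.
Proof.
move=> Uu; split=> [/eigenvalueP[v vA v0]|[i ->]].
  have [i vi] := unitary_coord_neq0 Uu v0.
  exists i; move/(congr1 (fun B => B *m U^t*)): vA => /=.
  rewrite /ccalc !mulmxA -[_ *m U *m _]mulmxA (unitarymxP Uu) mulmx1 -scalemxAl.
  move/matrixP/(_ 0 i); rewrite mul_mx_diag; move: (v *m U^t*) vi => w wi.
  by rewrite !mxE mulrC => /(mulIf wi).
by apply/eigenvalueP; exists (row i U); [exact: ccalc_row | exact: row_unitary_neq0].
Qed.

Lemma normal_diag A : A \is normalmx ->
  A = ccalc (spectralmx A) (fun i => spectral_diag A 0 i).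
Proof.
move=> /orthomx_spectralP; rewrite (invmx_unitary (spectral_unitarymx A)).
move=> {1}->; rewrite /ccalc; congr (_ *m diag_mx _ *m _).
by apply/rowP => i; rewrite mxE.
Qed.

Lemma hermitian_diag_conj U g : U \is unitarymx -> (ccalc U g)^t* = ccalc U g ->
  forall i, Num.conj (g i) = g i.
Proof.
move=> Uu; rewrite ccalc_adj => E i.
have /(congr1 (mulmx (row i U))) := E; rewrite !ccalc_row// => /matrixP.
have /rV0Pn[j Uj] := row_unitary_neq0 i Uu.
by move=> /(_ 0 j); move: (row i U) Uj => u uj; rewrite !mxE => /(mulIf uj).
Qed.

Lemma ccalc_normal U g : U \is unitarymx -> ccalc U g \is normalmx.
Proof.
move=> Uu; apply/normalmxP; rewrite ccalc_adj !(ccalcM _ _ Uu).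
by apply: eq_ccalc => i; rewrite mulrC.
Qed.

(** Moves the functional calculus of the statement, which is tied to [spectralmx], to an arbitrary
    eigenframe. *)
Lemma spectral_calc (f : C -> C) U g A : U \is unitarymx -> A = ccalc U g ->
  invmx (spectralmx A) *m diag_mx (map_mx f (spectral_diag A)) *m spectralmx A
  = ccalc U (f \o g).
Proof.
move=> Uu AE; have Pu := spectral_unitarymx A.
have An : A \is normalmx by rewrite AE ccalc_normal.
have := normal_diag An; rewrite {1}AE => E.
rewrite (ccalc_uniq f Uu Pu E) (invmx_unitary Pu) /ccalc.
congr (_ *m diag_mx _ *m _).
by apply/rowP => i; rewrite !mxE.
Qed.

End Calculus.

Section RealCalculus.
Variables (R : realType) (n : nat).
Local Notation C := R[i].
Local Notation M := 'M[C]_n.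
Local Notation Re := (@complex.Re R).
Implicit Types (U V A X : M) (d : 'I_n -> R).

Definition rcalc U d : M := ccalc U (fun i => (d i)%:C).

Lemma mxcalcE (f : R -> R) U d A : U \is unitarymx ->
  A = rcalc U d -> mxcalc f A = rcalc U (f \o d).
Proof.
by move=> Uu AE; exact: (spectral_calc (fun z => (f (Re z))%:C) Uu AE).
Qed.

Lemma selfadjoint_rcalc U d : selfadjoint (rcalc U d).
Proof. by rewrite /selfadjoint /rcalc ccalc_adj; apply: eq_ccalc => i; rewrite conj_real. Qed.

Lemma selfadjoint_diag A : selfadjoint A ->
  exists U d, U \is unitarymx /\ A = rcalc U d.
Proof.
move=> Asa; have An : A \is normalmx by apply/normalmxP; rewrite Asa.
have Pu := spectral_unitarymx A.
have AE := normal_diag An.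
exists (spectralmx A), (fun i => Re (spectral_diag A 0 i)); split; first exact: Pu.
have sp_real i : (Re (spectral_diag A 0 i))%:C = spectral_diag A 0 i.
  apply: RRe_real; apply/CrealP; move: i.
  by apply: (hermitian_diag_conj Pu); rewrite -AE.
by rewrite [LHS]AE; apply: eq_ccalc => i; rewrite sp_real.
Qed.

Lemma rcalc_form U d (v : 'rV[C]_n) :
  (v *m rcalc U d *m v^t*) 0 0 = (\sum_i d i * nsq ((v *m U^t*) 0 i))%:C.
Proof.
by rewrite ccalc_form rmorph_sum; apply: eq_bigr => i _; rewrite mulr_conj rmorphM.
Qed.

Lemma rcalc_row_form U d i : U \is unitarymx ->
  (row i U *m rcalc U d *m (row i U)^t*) 0 0 = (d i)%:C.
Proof.
by move=> Uu; rewrite ccalc_row// -scalemxAl mxE row_unitary// eqxx mulr1.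
Qed.

Lemma posdef_rcalcP U d : U \is unitarymx ->
  posdef (rcalc U d) <-> forall i, 0 < d i.
Proof.
move=> Uu; split=> [[_ pd] i|d0].
  by have := pd _ (row_unitary_neq0 i Uu); rewrite rcalc_row_form// ltcR.
split; first exact: selfadjoint_rcalc.
move=> v v0; rewrite rcalc_form ltcR.
have [i vi] := unitary_coord_neq0 Uu v0.
rewrite (bigD1 i)//= ltr_wpDr//.
  by apply: sumr_ge0 => j _; rewrite mulr_ge0 ?nsq_ge0//; exact/ltW.
by rewrite mulr_gt0// lt_neqAle nsq_ge0 eq_sym nsq_eq0 vi.
Qed.

Lemma psd_rcalcP U d : U \is unitarymx ->
  psd (rcalc U d) <-> forall i, 0 <= d i.
Proof.
move=> Uu; split=> [[_ pd] i|d0].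
  by have := pd (row i U); rewrite rcalc_row_form// lecR.
split=> [|v]; first exact: selfadjoint_rcalc.
by rewrite rcalc_form lecR sumr_ge0// => j _; rewrite mulr_ge0 ?nsq_ge0.
Qed.

Lemma eig_set U d : U \is unitarymx ->
  [set s : R | eigenvalue (rcalc U d) s%:C]%classic = range d.
Proof.
move=> Uu; apply/seteqP; split => [s /= /(ccalc_eigen _ _ Uu)[i /complexI ->]|].
  by exists i.
by move=> _ [i _ <-] /=; apply/(ccalc_eigen _ _ Uu); exists i.
Qed.

Lemma min_eigP U d (i0 : 'I_n) : U \is unitarymx ->
  (forall i, min_eig (rcalc U d) <= d i) /\ exists i, min_eig (rcalc U d) = d i.
Proof.
move=> Uu; rewrite /min_eig eig_set//.
case: (@arg_minP _ _ _ i0 xpredT d isT) => i _ imin.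
have -> : inf (range d) = d i.
  apply/eqP; rewrite eq_le; apply/andP; split.
    apply: ge_inf; last by exists i.
    by exists (d i) => _ [j _ <-]; exact: imin.
  by apply: lb_le_inf; [exists (d i), i | move=> _ [j _ <-]; exact: imin].
by split; [move=> j; exact: imin | exists i].
Qed.

Lemma max_eigP U d (i0 : 'I_n) : U \is unitarymx ->
  (forall i, d i <= max_eig (rcalc U d)) /\ exists i, max_eig (rcalc U d) = d i.
Proof.
move=> Uu; rewrite /max_eig eig_set//.
case: (@arg_maxP _ _ _ i0 xpredT d isT) => i _ imax.
have -> : sup (range d) = d i.
  apply/eqP; rewrite eq_le; apply/andP; split.
    by apply: ge_sup; [exists (d i), i | move=> _ [j _ <-]; exact: imax].
  apply: ub_le_sup; last by exists i.
  by exists (d i) => _ [j _ <-]; exact: imax.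
by split; [move=> j; exact: imax | exists i].
Qed.

Lemma Re_trB A X : Re (\tr (A - X)) = Re (\tr A) - Re (\tr X).
Proof. by rewrite mxtraceD ReD raddfN ReN. Qed.

Lemma Re_trZ (c : R) A : Re (\tr (c%:C *: A)) = c * Re (\tr A).
Proof. by rewrite mxtraceZ Re_mulrC. Qed.

End RealCalculus.

(** * Complex powers and the coupled entropy *)

Section ComplexPowers.
Variable R : realType.
Local Notation C := R[i].
Local Notation Re := (@complex.Re R).
Implicit Types (x y : R) (g h : R -> R -> C).

Definition cexp x y : C := (expR x * cos y) +i* (expR x * sin y).

Lemma cexpD x y x' y' : cexp (x + x') (y + y') = cexp x y * cexp x' y'.
Proof.
by rewrite /cexp expRD cosD sinD; apply/eqP; rewrite eq_complex /=; apply/andP; split;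
 apply/eqP; ring.
Qed.

Lemma cexp0 : cexp 0 0 = 1.
Proof. by rewrite /cexp expR0 cos0 sin0 mulr0 mulr1. Qed.

Lemma cexp_real x : cexp x 0 = (expR x)%:C.
Proof. by rewrite /cexp cos0 sin0 mulr0 mulr1. Qed.

Lemma conj_cexp x y : Num.conj (cexp x y) = cexp x (- y).
Proof. by rewrite conjCE /cexp /= cosN sinN mulrN. Qed.

Definition cpow (a x y : R) : C := cexp (x * ln a) (y * ln a).

Lemma cpowD a x y x' y' : cpow a (x + x') (y + y') = cpow a x y * cpow a x' y'.
Proof. by rewrite /cpow !mulrDl cexpD. Qed.

Lemma cpow0 a : cpow a 0 0 = 1.
Proof. by rewrite /cpow !mul0r cexp0. Qed.

Lemma cpow_real a x : 0 < a -> cpow a x 0 = (a `^ x)%:C.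
Proof. by move=> a0; rewrite /cpow mul0r cexp_real /powR gt_eqF. Qed.

Lemma cpow1 a : 0 < a -> cpow a 1 0 = a%:C.
Proof. by move=> a0; rewrite cpow_real// powRr1// ltW. Qed.

Lemma conj_cpow a x y : Num.conj (cpow a x y) = cpow a x (- y).
Proof. by rewrite conj_cexp -mulNr. Qed.

Lemma nsq_cpow a x y : 0 < a -> nsq (cpow a x y) = (a `^ x) ^+ 2.
Proof.
move=> a0; apply: complexI; rewrite -mulr_conj conj_cpow -cpowD subrr cpow_real//.
by rewrite powRD ?expr2//; apply/implyP => _; rewrite gt_eqF.
Qed.

(** Exponential polynomials in x + i y with real frequencies. The class contains the complex powers
    and is closed under sums and products, so the minimum principle for [strip_sum] suffices. *)
Definition exp_poly g : Prop := exists s : seq (C * R),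
  forall x y, g x y = \sum_(t <- s) t.1 * cexp (t.2 * x) (t.2 * y).

Lemma exp_poly_ext g h : (forall x y, g x y = h x y) -> exp_poly g -> exp_poly h.
Proof. by move=> gh [s sE]; exists s => x y; rewrite -gh. Qed.

Lemma exp_poly_const c : exp_poly (fun _ _ => c).
Proof.
by exists [:: (c, 0)] => x y; rewrite big_seq1 /= !mul0r cexp0 mulr1.
Qed.

Lemma exp_polyD g h : exp_poly g -> exp_poly h -> exp_poly (fun x y => g x y + h x y).
Proof. by move=> [s sE] [t tE]; exists (s ++ t) => x y; rewrite sE tE big_cat. Qed.

Lemma exp_polyM g h : exp_poly g -> exp_poly h -> exp_poly (fun x y => g x y * h x y).
Proof.
move=> [s sE] [t tE]; exists [seq (u.1 * v.1, u.2 + v.2) | u <- s, v <- t] => x y.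
rewrite sE tE big_allpairs_dep /= mulr_suml; apply: eq_bigr => u _.
rewrite mulr_sumr; apply: eq_bigr => v _ /=.
by rewrite !mulrDl cexpD; ring.
Qed.

Lemma exp_poly_sum (I : Type) (r : seq I) (F : I -> R -> R -> C) :
  (forall i, exp_poly (F i)) -> exp_poly (fun x y => \sum_(i <- r) F i x y).
Proof.
move=> Fp; elim: r => [|i r IH].
  by apply: exp_poly_ext (exp_poly_const 0) => x y; rewrite big_nil.
by apply: exp_poly_ext (exp_polyD (Fp i) IH) => x y; rewrite big_cons.
Qed.

Lemma exp_poly_cpow a (k b : R) : exp_poly (fun x y => cpow a (k * x + b) (k * y)).
Proof.
exists [:: (cexp (b * ln a) 0, k * ln a)] => x y; rewrite big_seq1 /= -cexpD add0r.
by rewrite /cpow; congr cexp; ring.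
Qed.

Lemma exp_poly_three_lines g (M : R) : exp_poly g ->
  (forall y, 0 <= Re (g 0 y)) -> (forall y, M <= Re (g 2^-1 y)) ->
  forall x, 0 <= x <= 2^-1 -> 2 * M * x <= Re (g x 0).
Proof.
move=> [s sE] g0 g1 x x01.
pose s' := [seq (Re t.1, complex.Im t.1, t.2) | t <- s].
have E x' y' : Re (g x' y') = strip_sum s' x' y'.
  rewrite sE Re_sum /strip_sum big_map; apply: eq_bigr => -[[a b] mu] _ /=.
  by ring.
rewrite E; apply: three_lines x01 => y; rewrite -E; [exact: g0 | exact: g1].
Qed.

End ComplexPowers.

Section Entropy.
Variables (R : realType) (I J : finType).
Variables (a : I -> J -> R) (y : I -> R) (s : J -> R) (smin : R).
Hypothesis a_ge0 : forall i j, 0 <= a i j.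
Hypothesis a_row : forall i, \sum_j a i j = 1.
Hypothesis a_col : forall j, \sum_i a i j = 1.
Hypothesis y_gt0 : forall i, 0 < y i.
Hypothesis s_gt0 : forall j, 0 < s j.
Hypothesis s_sum1 : \sum_j s j = 1.
Hypothesis smin_gt0 : 0 < smin.
Hypothesis smin_le : forall j, smin <= s j.

Let tau := \sum_i y i.
Let F := \sum_i \sum_j a i j * (Num.sqrt (y i) * Num.sqrt (s j)).

(** For the spectra [y] of Y and [s] of D, coupled by the overlaps [a] of their eigenbases, this is
    Tr (Y (log Y - log D)) - tau log tau: the relative entropy of a_ij y_i with respect to a_ij tau
    s_j. *)
Definition coupled_entropy :=
  \sum_i y i * ln (y i) - \sum_i \sum_j a i j * (y i * ln (s j)) - tau * ln tau.

Let I_nonempty : exists i : I, true.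
Proof.
have [j _] : exists j : J, true.
  have [j _|J0] := pickP (fun _ : J => true); first by exists j.
  by move: s_sum1; rewrite big_pred0 => // /eqP; rewrite eq_sym oner_eq0.
have [i _|I0] := pickP (fun _ : I => true); first by exists i.
by have := a_col j; rewrite big_pred0 => // /eqP; rewrite eq_sym oner_eq0.
Qed.

Let y_le_tau i : y i <= tau.
Proof. by rewrite /tau (bigD1 i)//= lerDl sumr_ge0// => k _; rewrite ltW. Qed.

Let tau_gt0 : 0 < tau.
Proof. by have [i _] := I_nonempty; exact: lt_le_trans (y_le_tau i). Qed.

Let sum_ay : \sum_i \sum_j a i j * y i = tau.
Proof. by apply: eq_bigr => i _; rewrite -mulr_suml a_row mul1r. Qed.

Let sum_as : \sum_i \sum_j a i j * s j = 1.
Proof.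
by rewrite exchange_big /= -s_sum1; apply: eq_bigr => j _; rewrite -mulr_suml a_col mul1r.
Qed.

Let entropyE : coupled_entropy =
  \sum_i \sum_j a i j * (y i * (ln (y i) - ln (s j) - ln tau)).
Proof.
rewrite /coupled_entropy /tau mulr_suml -!sumrB; apply: eq_bigr => i _.
rewrite -[X in X - _ - _]mul1r -[X in _ - _ - X]mul1r -(a_row i) !mulr_suml -!sumrB.
by apply: eq_bigr => j _; ring.
Qed.

(** The added terms sum to 0 because [a] has unit row and column sums; they make every summand
    nonnegative by [gibbs]. *)
Let entropy_sum : coupled_entropy = \sum_i \sum_j
  a i j * (y i * (ln (y i) - ln (s j) - ln tau) - y i + tau * s j).
Proof.
have E : \sum_i \sum_j a i j * (tau * s j) = \sum_i \sum_j a i j * y i.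
  rewrite sum_ay -[RHS]mulr1 -sum_as mulr_sumr; apply: eq_bigr => i _.
  by rewrite mulr_sumr; apply: eq_bigr => j _; ring.
transitivity (coupled_entropy + (\sum_i \sum_j a i j * (tau * s j)
    - \sum_i \sum_j a i j * y i)); first by rewrite E subrr addr0.
rewrite entropyE -sumrB -big_split; apply: eq_bigr => i _ /=; rewrite -sumrB -big_split; apply: eq_bigr => j _ /=.
by ring.
Qed.

Let gibbs (b c : R) : 0 < b -> 0 < c ->
  0 <= b * (ln b - ln c) - b + c /\ (b * (ln b - ln c) - b + c = 0 -> b = c).
Proof.
move=> b0 c0; have cb0 : 0 < c / b by rewrite divr_gt0.
have E : b * (ln b - ln c) - b + c = b * (c / b - 1 - ln (c / b)).
  by rewrite ln_div ?posrE//; field; rewrite gt_eqF.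
rewrite E; split.
  by rewrite pmulr_rge0// -[c / b]lnK ?posrE// expRK; have := expR_ge1Dx (ln (c / b)); lra.
move/eqP; rewrite mulf_eq0 (gt_eqF b0) /= => /eqP E0.
have [l0|l0] := eqVneq (ln (c / b)) 0.
  move: l0 => /eqP; rewrite ln_eq0// => /eqP cb.
  by rewrite -[RHS](@divfK _ b) ?gt_eqF// cb mul1r.
by have := expR_gt1Dx l0; rewrite lnK ?posrE//; lra.
Qed.

Let term_ge0 i j :
  0 <= a i j * (y i * (ln (y i) - ln (s j) - ln tau) - y i + tau * s j) /\
  (a i j * (y i * (ln (y i) - ln (s j) - ln tau) - y i + tau * s j) = 0 ->
    a i j = 0 \/ y i = tau * s j).
Proof.
have [h1 h2] := gibbs (y_gt0 i) (mulr_gt0 tau_gt0 (s_gt0 j)).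
have E : y i * (ln (y i) - ln (s j) - ln tau) = y i * (ln (y i) - ln (tau * s j)).
  by rewrite lnM ?posrE//; ring.
rewrite E; split; first by rewrite mulr_ge0.
by move/eqP; rewrite mulf_eq0 => /orP[/eqP|/eqP/h2]; [left|right].
Qed.

(** Equality case of the Gibbs inequality: nonnegative summands with a nonpositive sum all vanish.
    It shows later that [Ent] is positive at non-scalar matrices. *)
Lemma coupled_entropy_eq0 : coupled_entropy <= 0 ->
  forall i j, a i j = 0 \/ y i = tau * s j.
Proof.
move=> S0 i j; have [t0 teq] := term_ge0 i j; apply: teq.
apply/le_anti; rewrite t0 andbT; apply: le_trans S0; rewrite entropy_sum.
rewrite (bigD1 i)//= [X in _ <= X + _](bigD1 j)//= -[X in _ <= X]addrA lerDl addr_ge0//.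
  by apply: sumr_ge0 => k _; case: (term_ge0 i k).
by apply: sumr_ge0 => k _; apply: sumr_ge0 => l _; case: (term_ge0 k l).
Qed.

(* With [t = sqrt (y / (tau s))] under the probability weights [a s], the left
   side is the mean of [t^2 ln t^2], and [t^2 <= 1 / smin]. *)
Lemma coupled_entropy_le :
  coupled_entropy <= (ln smin^-1 + 2) * (tau - F ^+ 2).
Proof.
set l := ln smin^-1.
have smin1 : smin <= 1.
  have [j _] : exists j : J, true.
    have [j _|J0] := pickP (fun _ : J => true); first by exists j.
    by move: s_sum1; rewrite big_pred0 => // /eqP; rewrite eq_sym oner_eq0.
  apply: le_trans (smin_le j) _; rewrite -s_sum1 (bigD1 j)//= lerDl sumr_ge0// => k _.
  exact/ltW.
have l0 : 0 <= l by rewrite ln_ge0// invf_ge1.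
pose rt := Num.sqrt tau.
have rt0 : 0 < rt by rewrite sqrtr_gt0.
have rt2 : rt ^+ 2 = tau by rewrite sqr_sqrtr// ltW.
pose t i j := Num.sqrt (y i) / (rt * Num.sqrt (s j)).
have t0 i j : 0 < t i j by rewrite divr_gt0 ?mulr_gt0 ?sqrtr_gt0.
have t2 i j : t i j ^+ 2 = y i / (tau * s j).
  by rewrite expr_div_n exprMn !sqr_sqrtr ?rt2// ltW.
have lnt i j : ln (t i j ^+ 2) = ln (y i) - ln (s j) - ln tau.
  by rewrite t2 ln_div ?posrE ?mulr_gt0// lnM ?posrE//; ring.
have tl i j : ln (t i j ^+ 2) <= l.
  rewrite ler_ln ?posrE ?invr_gt0 ?exprn_gt0// t2 ler_pdivrMr ?mulr_gt0//.
  apply: le_trans (y_le_tau i) _; rewrite mulrCA ler_peMr ?(ltW tau_gt0)//.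
  by rewrite ler_pdivlMl// mulr1.
(* [G] is the mean of [t] under the weights [a s], for which [t ^+ 2] has mean 1. *)
pose G := F / rt.
have step i j : a i j * (y i * (ln (y i) - ln (s j) - ln tau))
   <= a i j * (tau * s j * ((l + 2) * (t i j - G) ^+ 2 + G ^+ 2 * (t i j ^+ 2 - 1))).
  rewrite ler_wpM2l// -lnt.
  have -> : y i * ln (t i j ^+ 2) = tau * s j * (t i j ^+ 2 * ln (t i j ^+ 2)).
    by rewrite {2}t2; field; rewrite !gt_eqF.
  by rewrite ler_pM2l ?mulr_gt0//; exact: entropy_pointwise.
rewrite entropyE; apply: le_trans (ler_sum _ (fun i _ => ler_sum _ (fun j _ => step i j))) _.
have st i j : s j * t i j = Num.sqrt (y i) * Num.sqrt (s j) / rt.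
  rewrite -{1}[s j]sqr_sqrtr ?ltW// /t; field.
  by rewrite !gt_eqF ?sqrtr_gt0.
have E i j : a i j * (tau * s j * ((l + 2) * (t i j - G) ^+ 2 + G ^+ 2 * (t i j ^+ 2 - 1)))
  = (l + 2 + G ^+ 2) * (a i j * y i)
   - 2 * (l + 2) * G * rt * (a i j * (Num.sqrt (y i) * Num.sqrt (s j)))
   + (l + 1) * G ^+ 2 * tau * (a i j * s j).
  have -> : a i j * (tau * s j * ((l + 2) * (t i j - G) ^+ 2 + G ^+ 2 * (t i j ^+ 2 - 1)))
    = a i j * ((l + 2 + G ^+ 2) * (tau * s j * t i j ^+ 2)
       - 2 * (l + 2) * G * tau * (s j * t i j) + (l + 1) * G ^+ 2 * tau * s j) by ring.
  rewrite st t2.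
  have -> : tau * s j * (y i / (tau * s j)) = y i by field; rewrite !gt_eqF.
  by rewrite -rt2; field; rewrite gt_eqF.
under eq_bigr => i _ do under eq_bigr => j _ do rewrite E.
under eq_bigr => i _ do rewrite big_split sumrB -!mulr_sumr.
rewrite big_split sumrB -!mulr_sumr sum_ay sum_as -/F.
have GF : G * rt = F by rewrite /G mulfVK// gt_eqF.
have G2 : G ^+ 2 * tau = F ^+ 2 by rewrite -rt2 -exprMn GF.
rewrite le_eqVlt; apply/orP; left; apply/eqP.
rewrite /=; have -> : (l + 2 + G ^+ 2) * tau - 2 * (l + 2) * G * rt * F + (l + 1) * G ^+ 2 * tau * 1
  = (l + 2) * tau + G ^+ 2 * tau - 2 * (l + 2) * (G * rt) * F + (l + 1) * (G ^+ 2 * tau) by ring.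
by rewrite GF G2; ring.
Qed.

End Entropy.

(** * The generator as a derivative *)

Section EntrywiseNorm.
Variables (R : realType) (n : nat).
Local Notation C := R[i].
Local Notation M := 'M[C]_n.
Local Notation Re := (@complex.Re R).
Local Notation normc := (@Normc.normc R).
Implicit Types (z w : C) (X Y : M).

Lemma normc_sqr z : normc z ^+ 2 = nsq z.
Proof. by case: z => a b; rewrite /nsq /= sqr_sqrtr// addr_ge0 ?sqr_ge0. Qed.

Lemma normc_ge0 z : 0 <= normc z.
Proof. by case: z => a b; exact: sqrtr_ge0. Qed.

Lemma normcD z w : normc (z + w) <= normc z + normc w.
Proof. exact: le_normcD. Qed.

Lemma normc_real (a : R) : normc a%:C = `|a|.
Proof. by rewrite /= expr0n addr0 sqrtr_sqr. Qed.

Lemma normRe_le z : `|Re z| <= normc z.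
Proof.
rewrite -(@ler_sqr _ `|_|) ?nnegrE ?normc_ge0// normc_sqr real_normK ?num_real//.
by rewrite lerDl sqr_ge0.
Qed.

Lemma normc_sum (I : Type) (r : seq I) (F : I -> C) :
  normc (\sum_(i <- r) F i) <= \sum_(i <- r) normc (F i).
Proof.
elim: r => [|i r IH]; first by rewrite !big_nil Normc.normc0.
by rewrite !big_cons (le_trans (normcD _ _))// lerD2l.
Qed.

(** An auxiliary norm: the values on matrix units bound a linear map for it, and both the operator
    norm and the KMS norm are compared with it. *)
Definition l1 X : R := \sum_a \sum_b normc (X a b).

Lemma l1_ge0 X : 0 <= l1 X.
Proof. by do 2 (apply: sumr_ge0 => ? _); exact: normc_ge0. Qed.

Lemma l1_entry X a b : normc (X a b) <= l1 X.
Proof.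
rewrite /l1 (bigD1 a)//= (bigD1 b)//= -addrA lerDl addr_ge0//.
  by apply: sumr_ge0 => j _; exact: normc_ge0.
by apply: sumr_ge0 => i _; apply: sumr_ge0 => j _; exact: normc_ge0.
Qed.

Lemma l1_gt0 X : X != 0 -> 0 < l1 X.
Proof.
move=> X0; rewrite lt_neqAle l1_ge0 andbT eq_sym; apply: contra_neq X0 => l0.
apply/matrixP => a b; rewrite [RHS]mxE; apply: Normc.eq0_normc.
by apply/le_anti; rewrite normc_ge0 -l0 l1_entry.
Qed.

Lemma l1D X Y : l1 (X + Y) <= l1 X + l1 Y.
Proof.
rewrite -big_split; apply: ler_sum => a _; rewrite -big_split; apply: ler_sum => b _ /=.
by rewrite mxE normcD.
Qed.

Lemma l1Z z X : l1 (z *: X) = normc z * l1 X.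
Proof.
rewrite /l1 mulr_sumr; apply: eq_bigr => a _; rewrite mulr_sumr; apply: eq_bigr => b _.
by rewrite mxE Normc.normcM.
Qed.

Lemma l10 : l1 0 = 0.
Proof. by rewrite -(scale0r (0 : M)) l1Z Normc.normc0 mul0r. Qed.

Lemma l1_sum (I : Type) (r : seq I) (F : I -> M) :
  l1 (\sum_(i <- r) F i) <= \sum_(i <- r) l1 (F i).
Proof.
elim: r => [|i r IH]; first by rewrite !big_nil l10.
by rewrite !big_cons (le_trans (l1D _ _))// lerD2l.
Qed.

Lemma l1_linear_bound (F : {linear M -> M}) : exists2 K, 0 <= K &
  forall X, l1 (F X) <= K * l1 X.
Proof.
exists (\sum_a \sum_b l1 (F (delta_mx a b))).
  by do 2 (apply: sumr_ge0 => ? _); exact: l1_ge0.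
move=> X; rewrite {1}(matrix_sum_delta X) linear_sum (le_trans (l1_sum _ _))//.
rewrite mulr_suml; apply: ler_sum => a _; rewrite linear_sum (le_trans (l1_sum _ _))//.
rewrite mulr_suml; apply: ler_sum => b _.
by rewrite linearZ l1Z mulrC ler_wpM2l ?l1_ge0 ?l1_entry.
Qed.

Lemma l1_tr (B X : M) : `|Re (\tr (B *m X))| <= l1 B * l1 X.
Proof.
apply: le_trans (normRe_le _) _; rewrite /mxtrace (le_trans (normc_sum _ _))//.
rewrite mulr_suml; apply: ler_sum => a _; rewrite mxE (le_trans (normc_sum _ _))//.
rewrite mulr_suml; apply: ler_sum => b _.
by rewrite Normc.normcM ler_wpM2l ?normc_ge0 ?l1_entry.
Qed.

(** [map_norm] is a supremum and dominates the quotients only if they are bounded above; comparing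
    [N] with [l1] in both directions gives the bound [c * K * c']. *)
Lemma map_norm_bound (N : M -> R) (F : M -> M) (c c' K : R) :
  0 <= c -> 0 <= c' -> 0 <= K ->
  (forall X, N X <= c * l1 X) -> (forall X, l1 X <= c' * N X) ->
  (forall X, l1 (F X) <= K * l1 X) ->
  forall X, X != 0 -> N (F X) <= map_norm N F * N X.
Proof.
move=> c0 c'0 K0 Nl lN FK X X0.
have N0 Y : Y != 0 -> 0 < N Y.
  move=> /l1_gt0 l0; have := lt_le_trans l0 (lN Y).
  have [->|c'1] := eqVneq c' 0; first by rewrite mul0r ltxx.
  by rewrite pmulr_rgt0// lt_neqAle eq_sym c'1.
rewrite -(ler_pdivrMr _ _ (N0 _ X0)); apply: ub_le_sup; last by exists X.
exists (c * K * c') => _ [Y /= Y0 <-]; rewrite (ler_pdivrMr _ _ (N0 _ Y0)).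
apply: le_trans (Nl _) _; rewrite -!mulrA ler_wpM2l//.
by apply: le_trans (FK _) _; rewrite ler_wpM2l.
Qed.

Lemma row_form m (v : 'rV[C]_m) : (v *m v^t*) 0 0 = (\sum_i nsq (v 0 i))%:C.
Proof.
rewrite mxE rmorph_sum; apply: eq_bigr => i _.
by rewrite !mxE mulr_conj.
Qed.

Definition fro2 X : R := \sum_a \sum_b nsq (X a b).

Lemma fro2_ge0 X : 0 <= fro2 X.
Proof. by do 2 (apply: sumr_ge0 => ? _); exact: nsq_ge0. Qed.

Lemma nsq_le_fro2 X a b : nsq (X a b) <= fro2 X.
Proof.
rewrite /fro2 (bigD1 a)//= (bigD1 b)//= -addrA lerDl addr_ge0//.
  by apply: sumr_ge0 => j _; exact: nsq_ge0.
by apply: sumr_ge0 => i _; apply: sumr_ge0 => j _; exact: nsq_ge0.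
Qed.

Lemma fro2_eq0 X : fro2 X = 0 -> X = 0.
Proof.
move=> f0; apply/matrixP => a b; rewrite [RHS]mxE; apply/eqP; rewrite -nsq_eq0.
by apply/eqP/le_anti; rewrite nsq_ge0 -f0 nsq_le_fro2.
Qed.

Lemma fro2_le_l1 X : fro2 X <= l1 X ^+ 2.
Proof.
rewrite [leRHS]expr2 {1}/l1 mulr_suml; apply: ler_sum => a _.
rewrite mulr_suml; apply: ler_sum => b _.
by rewrite -normc_sqr expr2 ler_wpM2l ?normc_ge0 ?l1_entry.
Qed.

Lemma l1_le_fro2 X : l1 X <= (n * n)%:R * Num.sqrt (fro2 X).
Proof.
have e a b : normc (X a b) <= Num.sqrt (fro2 X).
  rewrite -ler_sqr ?nnegrE ?normc_ge0 ?sqrtr_ge0// normc_sqr sqr_sqrtr ?fro2_ge0//.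
  exact: nsq_le_fro2.
apply: le_trans (_ : \sum_(a < n) \sum_(b < n) Num.sqrt (fro2 X) <= _).
  by apply: ler_sum => a _; apply: ler_sum => b _.
by rewrite !sumr_const !card_ord -mulrnA [leRHS]mulr_natl.
Qed.

Lemma tr_gram X : Re (\tr (X^t* *m X)) = fro2 X.
Proof.
rewrite /fro2 exchange_big Re_sum; apply: eq_bigr => b _; rewrite mxE Re_sum.
by apply: eq_bigr => a _; rewrite !mxE mulrC mulr_conj.
Qed.

Hypothesis n_gt0 : (0 < n)%N.

(** The squared norm is the largest of the [n] nonnegative eigenvalues of the Gram matrix of [X],
    and [fro2 X] is their sum. *)
Lemma cstar_norm_trace X :
  cstar_norm X ^+ 2 <= fro2 X <= n%:R * cstar_norm X ^+ 2.
Proof.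
have Gsa : selfadjoint (X^t* *m X) by rewrite /selfadjoint adj_mul trmxCK.
have [U [d [Uu E]]] := selfadjoint_diag Gsa.
have d0 : forall i, 0 <= d i.
  apply/(psd_rcalcP _ Uu); rewrite -E; split=> // v.
  have -> : v *m (X^t* *m X) *m v^t* = (v *m X^t*) *m (v *m X^t*)^t*.
    by rewrite adj_mul trmxCK !mulmxA.
  by rewrite row_form lecR; apply: sumr_ge0 => i _; exact: nsq_ge0.
rewrite -tr_gram /cstar_norm E.
have [mle [i0 mE]] := max_eigP d (Ordinal n_gt0) Uu.
have -> : Re (\tr (rcalc U d)) = \sum_i d i by rewrite ccalc_tr// Re_sum.
rewrite sqr_sqrtr ?mE//; apply/andP; split.
  by rewrite (bigD1 i0)//= lerDl sumr_ge0.
rewrite mulr_natl -[X in _ <= _ *+ X](card_ord n) -sumr_const -mE; apply: ler_sum => i _.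
exact: mle.
Qed.

Lemma cstar_norm_le_l1 X : cstar_norm X <= l1 X.
Proof.
rewrite -ler_sqr ?nnegrE ?sqrtr_ge0 ?l1_ge0//.
by have /andP[h _] := cstar_norm_trace X; apply: le_trans h (fro2_le_l1 X).
Qed.

Lemma l1_le_cstar_norm X : l1 X <= (n * n)%:R * Num.sqrt n%:R * cstar_norm X.
Proof.
apply: le_trans (l1_le_fro2 X) _; rewrite -mulrA ler_wpM2l//.
have /andP[_ h] := cstar_norm_trace X.
rewrite -(ger0_norm (sqrtr_ge0 _ : 0 <= cstar_norm X)) -sqrtr_sqr -sqrtrM//.
exact: ler_wsqrtr.
Qed.

End EntrywiseNorm.

Section Generator.
Variables (R : realType) (n : nat).
Local Notation C := R[i].
Local Notation M := 'M[C]_n.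
Local Notation Re := (@complex.Re R).
Variables (Phi : R -> {linear M -> M}) (L : {linear M -> M}).
Hypothesis n_gt0 : (0 < n)%N.
Hypothesis genL : generator Phi L.

Lemma exp_tail_le (K t : R) (N : nat) : 0 <= K -> 0 <= t <= 1 ->
  \sum_(2 <= k < N) (t ^+ k / k`!%:R) * K ^+ k <= t ^+ 2 * expR K.
Proof.
move=> K0 /andP[t0 t1].
apply: (@le_trans _ _ (t ^+ 2 * \sum_(2 <= k < N) (K ^+ k / k`!%:R))).
  rewrite mulr_sumr; apply: ler_sum_nat => k /andP[k2 _].
  rewrite mulrAC [t ^+ 2 * _]mulrA ler_wpM2r ?invr_ge0 ?ler0n// ler_wpM2r ?exprn_ge0//.
  by rewrite ler_wiXn2l.
rewrite ler_wpM2l ?sqr_ge0//.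
have ndec : nondecreasing_seq (series (exp_coeff K)).
  by apply: nondecreasing_series => k _ _; exact: exp_coeff_ge0.
have [N2|N2] := leqP N 2; first by rewrite big_geq// expR_ge0.
apply: le_trans (nondecreasing_cvgn_le ndec (is_cvg_series_exp_coeff K) N).
rewrite /series /= [leRHS](@big_cat_nat _ _ _ 2)//= ?(ltnW N2)// lerDr.
by apply: sumr_ge0 => k _; exact: exp_coeff_ge0.
Qed.

(** [generator] says that the exponential series converges in map norm. Its terms of order 0 and 1
    are split off, the tail from order 2 is at most a multiple of [t ^+ 2] uniformly in the number
    of terms, and the remainder vanishes in the limit. *)
Lemma generator_quadratic (B X : M) : exists K : R, forall t : R, 0 < t <= 1 ->
  `|Re (\tr (B *m X)) - Re (\tr (B *m Phi t X)) - t * Re (\tr (B *m L X))| <= K * t ^+ 2.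
Proof.
have [KL KL0 KLb] := l1_linear_bound L.
have iterb k Y : l1 (iter k L Y) <= KL ^+ k * l1 Y.
  elim: k => [|k IH] /=; first by rewrite expr0 mul1r.
  by rewrite (le_trans (KLb _))// exprS -mulrA ler_wpM2l.
exists (l1 B * (expR KL * l1 X)) => t /andP[t0 t1].
have [->|X0] := eqVneq X 0.
  have z : Re (\tr (B *m (0 : M))) = 0 by rewrite mulmx0 mxtrace0.
  rewrite (linear0 (Phi t)) (linear0 L) z mulr0 !subr0 normr0 l10.
  by rewrite !mulr0 mul0r.
have [Kt Kt0 Ktb] := l1_linear_bound (Phi t).
pose term k (Y : M) : M := ((- t) ^+ k / k`!%:R)%:C *: iter k L Y.
pose rem N (Y : M) : M := \sum_(k < N) term k Y - Phi t Y.
have termb k Y : l1 (term k Y) <= t ^+ k / k`!%:R * KL ^+ k * l1 Y.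
  rewrite l1Z normc_real normrM normrX normrN (gtr0_norm t0) normfV normr_nat -mulrA.
  by rewrite ler_wpM2l// divr_ge0 ?exprn_ge0// ltW.
have rem_lim : (map_norm (@cstar_norm R n) (rem N) @[N --> \oo] --> (0 : R))%classic.
  exact: genL (ltW t0).
have remb N Y : l1 (rem N Y) <= (\sum_(k < N) t ^+ k / k`!%:R * KL ^+ k + Kt) * l1 Y.
  rewrite (le_trans (l1D _ _))// mulrDl lerD//.
    rewrite (le_trans (l1_sum _ _))// mulr_suml; apply: ler_sum => k _; exact: termb.
  by rewrite -scaleN1r l1Z -[-1](rmorphN1 (real_complex R)) normc_real normrN normr1 mul1r.
have cstar1 (Y : M) : cstar_norm Y <= 1 * l1 Y by rewrite mul1r cstar_norm_le_l1.
have remX N : l1 (rem N X) <= (n * n)%:R * Num.sqrt n%:R * cstar_norm X * map_norm (@cstar_norm R n) (rem N).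
  apply: le_trans (l1_le_cstar_norm n_gt0 _) _; rewrite -[leRHS]mulrA ler_wpM2l ?mulr_ge0 ?sqrtr_ge0//.
  rewrite mulrC; apply: (map_norm_bound ler01 _ _ cstar1 (l1_le_cstar_norm n_gt0) (remb N)) X0.
    by rewrite mulr_ge0 ?sqrtr_ge0.
  rewrite addr_ge0// sumr_ge0// => k _.
  by rewrite mulr_ge0 ?exprn_ge0// divr_ge0 ?exprn_ge0// ltW.
set lhs := `|_|.
have bound N : (2 <= N)%N -> lhs <= l1 B * (expR KL * l1 X) * t ^+ 2
   + l1 B * ((n * n)%:R * Num.sqrt n%:R * cstar_norm X * map_norm (@cstar_norm R n) (rem N)).
  move=> N2.
  have E : X - Phi t X - t%:C *: L X = rem N X - \sum_(2 <= k < N) term k X.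
    rewrite /rem -(big_mkord xpredT (fun k => term k X)) (@big_cat_nat _ _ _ 2)//=.
    rewrite big_nat_recr//= big_nat1 /term /= expr0 expr1 fact0 !divr1 scale1r.
    rewrite rmorphN scaleNr.
    by rewrite [X in _ = X - _]addrAC addrK addrAC.
  have -> : lhs = `|Re (\tr (B *m (rem N X - \sum_(2 <= k < N) term k X)))|.
    by rewrite -E !mulmxBr !Re_trB -scalemxAr Re_trZ.
  rewrite mulmxBr Re_trB (le_trans (ler_normB _ _))// addrC lerD//.
    apply: le_trans (l1_tr _ _) _; rewrite -!mulrA ler_wpM2l ?l1_ge0//.
    rewrite (le_trans (l1_sum _ _))//.
    apply: le_trans (ler_sum _ (fun k _ => termb k X)) _.
    have -> : expR KL * (l1 X * t ^+ 2) = t ^+ 2 * expR KL * l1 X by ring.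
    by rewrite -mulr_suml ler_wpM2r ?l1_ge0// exp_tail_le// (ltW t0).
  by apply: le_trans (l1_tr _ _) _; rewrite ler_wpM2l ?l1_ge0.
set c := l1 B * (_ * l1 X) * t ^+ 2 in bound *.
set c' := l1 B in bound; set c'' := _ * cstar_norm X in bound.
have lim : ((c + c' * (c'' * map_norm (@cstar_norm R n) (rem N))) @[N --> \oo] --> c + c' * (c'' * 0))%classic.
  apply: cvgD; first exact: cvg_cst; apply: cvgM; first exact: cvg_cst.
  by apply: cvgM; first exact: cvg_cst.
rewrite !mulr0 addr0 in lim; rewrite -(cvg_lim _ lim)//; apply: limr_ge; first by apply/cvg_ex; exists c.
by near=> N; apply: bound; near: N; exists 2%N.
Unshelve. all: by end_near. Qed.

(* A functional on maps [M -> M] that is differentiable along the semigroup at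
   [t = 0], its derivative being minus its value at the generator. *)
Definition gen_diff (l : (M -> M) -> R) : Prop := exists K : R,
  forall t : R, 0 < t <= 1 -> `|l id - l (Phi t) - t * l L| <= K * t ^+ 2.

Lemma gen_diff_tr (B X : M) : gen_diff (fun F => Re (\tr (B *m F X))).
Proof. exact: generator_quadratic. Qed.

Lemma gen_diff_ext l l' : l =1 l' -> gen_diff l -> gen_diff l'.
Proof. by move=> ll' [K HK]; exists K => t; rewrite -!ll'; exact: HK. Qed.

Lemma gen_diffD l l' : gen_diff l -> gen_diff l' -> gen_diff (fun F => l F + l' F).
Proof.
move=> [K HK] [K' HK']; exists (K + K') => t t01.
rewrite mulrDl; apply: le_trans (lerD (HK t t01) (HK' t t01)).
apply: le_trans (ler_normD _ _).
by rewrite le_eqVlt; apply/orP; left; apply/eqP; congr `|_|; ring.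
Qed.

Lemma gen_diffZ c l : gen_diff l -> gen_diff (fun F => c * l F).
Proof.
move=> [K HK]; exists (`|c| * K) => t t01.
have -> : c * l id - c * l (Phi t) - t * (c * l L) = c * (l id - l (Phi t) - t * l L) by ring.
by rewrite normrM -mulrA ler_wpM2l ?HK.
Qed.

Lemma gen_diff_sum (I : Type) (r : seq I) (l : I -> (M -> M) -> R) :
  (forall i, gen_diff (l i)) -> gen_diff (fun F => \sum_(i <- r) l i F).
Proof.
move=> lK; elim: r => [|i r IH].
  exists 0 => t _; rewrite !big_nil mulr0 !subrr normr0 mul0r.
  exact: lexx.
by apply: gen_diff_ext (gen_diffD (lK i) IH) => F; rewrite big_cons.
Qed.

(** The passage from the semigroup to [L]: an inequality valid for every [Phi t] and an equality at
    [t = 0] may be differentiated. *)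
Lemma gen_diff_ge0 l : gen_diff l -> (forall t, 0 < t -> l (Phi t) <= l id) -> 0 <= l L.
Proof.
move=> [K HK] mono; rewrite leNgt; apply/negP => neg.
(* For this [t] the quadratic error is at most half of [t |l L|]. *)
pose t := Num.min 1 (- l L / (2 * (`|K| + 1))).
have K1 : 0 < `|K| + 1 by rewrite ltr_wpDl.
have t0 : 0 < t by rewrite lt_min ltr01 divr_gt0 ?oppr_gt0// mulr_gt0.
have t01 : 0 < t <= 1 by rewrite t0 ge_min lexx.
have tK : t * (2 * (`|K| + 1)) <= - l L.
  by rewrite -ler_pdivlMr ?mulr_gt0// ge_min lexx orbT.
have := HK t t01; have := mono t t0; move: (ler_norm (l id - l (Phi t) - t * l L)) => h1 h2 h3.
have h4 : - t * l L <= K * t ^+ 2 by lra.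
have h5 : K * t ^+ 2 <= (`|K| + 1) * t ^+ 2.
  by rewrite ler_wpM2r ?sqr_ge0//; have := ler_norm K; lra.
have h6 : t * (t * (2 * (`|K| + 1))) <= t * - l L by rewrite ler_wpM2l// ltW.
have h7 : 0 < (`|K| + 1) * t ^+ 2 by rewrite mulr_gt0 ?exprn_gt0.
by move: h6 h5 h4 h7; set k := `|K| + 1; rewrite !expr2; nra.
Qed.

Lemma gen_diff_eq0 l : gen_diff l -> (forall t, 0 < t -> l (Phi t) = l id) -> l L = 0.
Proof.
move=> g e; apply/le_anti/andP; split; last first.
  by apply: (gen_diff_ge0 g) => t t0; rewrite e.
rewrite -oppr_ge0 -mulN1r; apply: (gen_diff_ge0 (gen_diffZ (-1) g)) => t t0.
by rewrite e.
Qed.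

End Generator.

(** * Completely positive maps *)

Section BlockForms.
Variables (C : numClosedFieldType) (k n : nat).

Lemma adj_mxrow m (A : 'I_k -> 'M[C]_(m, n)) :
  (\mxrow_(i < k) A i)^t* = \mxcol_(i < k) (A i)^t*.
Proof. by apply/matrixP => i j; rewrite !mxE. Qed.

Lemma adj_mxcol m (A : 'I_k -> 'M[C]_(n, m)) :
  (\mxcol_(i < k) A i)^t* = \mxrow_(i < k) (A i)^t*.
Proof. by apply/matrixP => i j; rewrite !mxE. Qed.

Lemma adj_mxblock (A : 'I_k -> 'I_k -> 'M[C]_n) :
  (\mxblock_(i < k, j < k) A i j)^t* = \mxblock_(i < k, j < k) (A j i)^t*.
Proof. by apply/matrixP => i j; rewrite !mxE. Qed.

Lemma mxblock_form (G : 'I_k -> 'I_k -> 'M[C]_n) (v : 'I_k -> 'rV[C]_n) :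
  (\mxrow_(i < k) v i) *m (\mxblock_(i < k, j < k) G i j) *m (\mxrow_(i < k) v i)^t*
  = \sum_i \sum_j v i *m G i j *m (v j)^t*.
Proof.
rewrite adj_mxrow mul_mxrow_mxblock mul_mxrow_mxcol exchange_big.
by apply: eq_bigr => j _; rewrite mulmx_suml.
Qed.

Lemma mxblock_gram (B : 'I_k -> 'M[C]_n) :
  \mxblock_(i < k, j < k) (B i *m (B j)^t*)
  = (\mxcol_(i < k) B i) *m (\mxcol_(i < k) B i)^t*.
Proof. by rewrite adj_mxcol mul_mxcol_mxrow. Qed.

End BlockForms.

Section CompletePositivity.
Variables (R : realType) (n : nat).
Local Notation C := R[i].
Local Notation M := 'M[C]_n.
Local Notation Re := (@complex.Re R).
Variable F : {linear M -> M}.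
Hypothesis Fcp : completely_positive F.

Lemma cp_psd k (B : 'I_k -> M) :
  psd (\mxblock_(i < k, j < k) F (B i *m (B j)^t*)).
Proof.
have : psd (\mxblock_(i < k, j < k) (B i *m (B j)^t*)).
  rewrite mxblock_gram; set G := \mxcol_(i < k) B i.
  split=> [|v]; first by rewrite /selfadjoint adj_mul trmxCK.
  have -> : v *m (G *m G^t*) *m v^t* = (v *m G) *m (v *m G)^t*.
    by rewrite adj_mul !mulmxA.
  by rewrite row_form lecR; apply: sumr_ge0 => i _; exact: nsq_ge0.
move/Fcp; have -> // : \mxblock_(i < k, j < k)
    F (submxblock (\mxblock_(i < k, j < k) (B i *m (B j)^t*)) i j)
  = \mxblock_(i < k, j < k) F (B i *m (B j)^t*).
by apply: eq_mxblock => i j; rewrite mxblockK.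
Qed.

Lemma cp_form k (B : 'I_k -> M) (v : 'I_k -> 'rV[C]_n) :
  0 <= \sum_i \sum_j (v i *m F (B i *m (B j)^t*) *m (v j)^t*) 0 0.
Proof.
have [_ /(_ (\mxrow_(i < k) v i))] := cp_psd B.
by rewrite mxblock_form summxE; under eq_bigr do rewrite summxE.
Qed.

(** [F] sends the Gram block matrix of [X] and the identity to a self-adjoint block matrix; the
    off-diagonal blocks are compared. *)
Lemma cp_adj X : F (X^t*) = (F X)^t*.
Proof.
pose B (i : 'I_2) : M := if i == 0 then X else 1%:M.
have [sa _] := cp_psd B.
have : \mxblock_(i < 2, j < 2) F (B i *m (B j)^t*) =
       \mxblock_(i < 2, j < 2) (F (B j *m (B i)^t*))^t*.
  by rewrite -[LHS]sa adj_mxblock.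
move/eq_mxblockP/(_ 1 0); rewrite /B /= mul1mx => ->.
by rewrite (adj1 _ n) mulmx1.
Qed.

Hypothesis F1 : F 1%:M = 1%:M.

(** Positivity of [F] on the Gram block matrix of [W] and the identity, tested on the vector
    [(a, - b)], reads [0 <= 2 - 2 r] with [r] the real part to be bounded. *)
Lemma cp_contract (W : M) (a b : 'rV[C]_n) : W *m W^t* = 1%:M ->
  (a *m a^t*) 0 0 = 1 -> (b *m b^t*) 0 0 = 1 ->
  Re ((a *m F W *m b^t*) 0 0) <= 1.
Proof.
move=> WW aa bb.
pose B (i : 'I_2) : M := if i == 0 then W else 1%:M.
pose v (i : 'I_2) : 'rV[C]_n := if i == 0 then a else - b.
have := cp_form B v; rewrite !big_ord_recl !big_ord0 /= !addr0 /B /v /=.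
rewrite (adj1 _ n) !mulmx1 !mul1mx WW F1 !mulmx1 cp_adj.
have -> : ((- b) *m (F W)^t* *m a^t*) 0 0 = - Num.conj ((a *m F W *m b^t*) 0 0).
  rewrite mulNmx mulNmx mxE -mulmxA -(adj_mul a (F W)).
  have -> : b *m (a *m F W)^t* = (a *m F W *m b^t*)^t* by rewrite [RHS]adj_mul trmxCK.
  by rewrite [(_ ^t*) 0 0]mxE mxE.
have -> : (a *m F W *m (- b)^t*) 0 0 = - (a *m F W *m b^t*) 0 0.
  by rewrite adjN mulmxN mxE.
have -> : ((- b) *m (- b)^t*) 0 0 = 1 by rewrite adjN mulmxN mulNmx opprK.
rewrite aa lecE => /andP[_]; rewrite !ReD !ReN ReJ /=.
by lra.
Qed.

End CompletePositivity.

(** * Lyapunov equation and the squared-commutator identity *)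

Section Lyapunov.
Variables (R : realType) (m : nat).
Local Notation C := R[i].

(* The smallest eigenvector [v] of [N] satisfies
   [0 <= <v, G v> = 2 d <v, diag(x) v>], where [d] is its eigenvalue. *)
Lemma lyapunov_psd (G : 'M[C]_m) (x : 'I_m -> R) : psd G -> (forall i, 0 < x i) ->
  exists W : 'M[C]_m, forall i j, G i j / (x i + x j)%:C = (W^t* *m W) i j.
Proof.
move=> [Gsa Gpsd] x0.
pose N : 'M[C]_m := \matrix_(i, j) (G i j / (x i + x j)%:C).
have Nsa : selfadjoint N.
  apply/matrixP => i j; rewrite !mxE fmorph_div /= conj_real addrC.
  by rewrite -[in RHS]Gsa !mxE.
have [U [d [Uu NE]]] := selfadjoint_diag Nsa.
have d0 k : 0 <= d k.
  pose v := row k U.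
  have vN : v *m N = (d k)%:C *: v by rewrite NE; exact: ccalc_row.
  have Nv : N *m v^t* = (d k)%:C *: v^t*.
    by rewrite -[N]Nsa -adj_mul vN adjZ conj_real.
  pose q := \sum_i x i * nsq (v 0 i).
  have q0 : 0 < q.
    have /rV0Pn[i vi] : v != 0 := row_unitary_neq0 k Uu.
    rewrite /q (bigD1 i)//= ltr_wpDr//.
      by apply: sumr_ge0 => j _; rewrite mulr_ge0 ?nsq_ge0// ltW.
    by rewrite mulr_gt0// lt_neqAle nsq_ge0 eq_sym nsq_eq0 vi.
  have := Gpsd v.
  have -> : (v *m G *m v^t*) 0 0 = (2 * d k * q)%:C.
    have -> : (v *m G *m v^t*) 0 0 = \sum_i \sum_j v 0 i * G i j * Num.conj (v 0 j).
      rewrite mxE exchange_big; apply: eq_bigr => j _; rewrite !mxE mulr_suml.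
      by apply: eq_bigr => i _; rewrite !mxE.
    (* [G = diag(x) N + N diag(x)], and each half is evaluated by letting [N] act on the eigenvector
       from one side. *)
    have step i j : v 0 i * G i j * Num.conj (v 0 j) =
        (x i)%:C * (v 0 i * (N i j * (v^t*) j 0))
        + (x j)%:C * ((v 0 i * N i j) * Num.conj (v 0 j)).
      have xx0 : (x i + x j)%:C != 0 by rewrite (inj_eq (@complexI R) _ 0) gt_eqF// addr_gt0.
      have -> : G i j = ((x i)%:C + (x j)%:C) * N i j.
        by rewrite mxE -rmorphD mulrCA divff// mulr1.
      by rewrite !mxE; ring.
    under eq_bigr => i _ do under eq_bigr => j _ do rewrite step.
    under eq_bigr do rewrite big_split; rewrite big_split /=.
    have -> : \sum_i \sum_j (x i)%:C * (v 0 i * (N i j * (v^t*) j 0))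
       = (d k)%:C * q%:C.
      rewrite [q%:C]rmorph_sum mulr_sumr; apply: eq_bigr => i _ /=.
      rewrite -mulr_sumr -mulr_sumr.
      have -> : \sum_j N i j * (v^t*) j 0 = (d k)%:C * Num.conj (v 0 i).
        by have /matrixP/(_ i 0) := Nv; rewrite mxE => ->; rewrite !mxE.
      by rewrite rmorphM /= -mulr_conj; ring.
    have -> : \sum_i \sum_j (x j)%:C * (v 0 i * N i j * Num.conj (v 0 j))
       = (d k)%:C * q%:C.
      rewrite exchange_big [q%:C]rmorph_sum mulr_sumr; apply: eq_bigr => j _ /=.
      rewrite -mulr_sumr -mulr_suml.
      have -> : \sum_i v 0 i * N i j = (d k)%:C * v 0 j.
        by have /matrixP/(_ 0 j) := vN; rewrite mxE => ->; rewrite mxE.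
      by rewrite rmorphM /= -mulr_conj; ring.
    have -> : 2 * d k * q = d k * q + d k * q by ring.
    by rewrite rmorphD rmorphM.
  by rewrite lecR pmulr_lge0// pmulr_rge0.
exists (rcalc U (fun i => Num.sqrt (d i))) => i j.
rewrite (selfadjoint_rcalc U _) ccalcM//.
have -> : ccalc U (fun i => (Num.sqrt (d i))%:C * (Num.sqrt (d i))%:C) = rcalc U d.
  by apply: eq_ccalc => k; rewrite -rmorphM -expr2 sqr_sqrtr.
by rewrite -NE mxE.
Qed.

End Lyapunov.

Section CommutatorTrace.
Variables (C : numClosedFieldType) (n : nat).
Implicit Types V X S : 'M[C]_n.

Lemma commutator_trace V X S : X^t* = X ->
  \tr ((V *m X - X *m V)^t* *m S *m (V *m X - X *m V) *m S) =
  \tr (X *m (V^t* *m S *m V) *m X *m S) + \tr (X *m S *m X *m (V *m S *m V^t*))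
  - (\tr (X *m (V *m (S *m X) *m V^t*) *m S) + \tr (X *m S *m (V *m (X *m S) *m V^t*))).
Proof.
move=> Xsa; rewrite adjB !adj_mul Xsa !mulmxBl !mulmxBr !mulmxBl !raddfB /= !mulmxA.
have -> : \tr (V^t* *m X *m S *m X *m V *m S) = \tr (X *m S *m X *m V *m S *m V^t*).
  by rewrite -!mulmxA mxtrace_mulC !mulmxA.
have -> : \tr (V^t* *m X *m S *m V *m X *m S) = \tr (X *m S *m V *m X *m S *m V^t*).
  by rewrite -!mulmxA mxtrace_mulC !mulmxA.
have -> : \tr (X *m V^t* *m S *m X *m V *m S) = \tr (X *m V *m S *m X *m V^t* *m S).
  have -> : X *m V^t* *m S *m X *m V *m S = (X *m V^t* *m S) *m (X *m V *m S) by rewrite !mulmxA.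
  by rewrite mxtrace_mulC !mulmxA.
by ring.
Qed.

(** Expanding the squared commutators, each of the two square terms sums to half of Tr (X S X S) by
    a normalization, and the cross terms together recover Tr (X S FX S) by the last hypothesis. *)
Lemma derivation_trace (J : finType) (V : J -> 'M[C]_n) X S FX : X^t* = X ->
  \sum_j (V j)^t* *m S *m V j = 2^-1 *: S ->
  \sum_j V j *m S *m (V j)^t* = 2^-1 *: S ->
  (\sum_j V j *m (S *m X) *m (V j)^t*) *m S + S *m (\sum_j V j *m (X *m S) *m (V j)^t*)
    = S *m FX *m S ->
  \tr (X *m S *m X *m S) - \tr (X *m S *m FX *m S) =
  \sum_j \tr ((V j *m X - X *m V j)^t* *m S *m (V j *m X - X *m V j) *m S).
Proof.
move=> Xsa TS TS' FE.
under eq_bigr do rewrite commutator_trace//.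
rewrite sumrB [X in _ = X - _]big_split [X in _ = _ - X]big_split /=.
have -> : \sum_i \tr (X *m ((V i)^t* *m S *m V i) *m X *m S) = 2^-1 * \tr (X *m S *m X *m S).
  rewrite -mxtraceZ; transitivity (\tr (X *m (\sum_j (V j)^t* *m S *m V j) *m X *m S)).
    by rewrite mulmx_sumr !mulmx_suml raddf_sum.
  by rewrite TS -scalemxAr -!scalemxAl.
have -> : \sum_i \tr (X *m S *m X *m (V i *m S *m (V i)^t*)) = 2^-1 * \tr (X *m S *m X *m S).
  rewrite -mxtraceZ; transitivity (\tr (X *m S *m X *m (\sum_j V j *m S *m (V j)^t*))).
    by rewrite mulmx_sumr raddf_sum.
  by rewrite TS' -scalemxAr.
have -> : \tr (X *m S *m FX *m S) =
   \sum_i \tr (X *m (V i *m (S *m X) *m (V i)^t*) *m S)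
   + \sum_i \tr (X *m S *m (V i *m (X *m S) *m (V i)^t*)).
  have -> : X *m S *m FX *m S = X *m (S *m FX *m S) by rewrite !mulmxA.
  rewrite -FE mulmxDr mxtraceD !mulmx_suml !mulmx_sumr !raddf_sum.
  by congr (_ + _); apply: eq_bigr => i _; rewrite !mulmxA.
by rewrite -mulrDl (_ : 2^-1 + 2^-1 = 1 :> C) ?mul1r// -[2^-1]mul1r -mulrDl -mulr2n divff// pnatr_eq0.
Qed.

End CommutatorTrace.

(** * Dirichlet form as a sum of squared commutators *)

Section MatrixUnits.
Variables (C : numClosedFieldType) (n : nat).
Local Notation M := 'M[C]_n.

Lemma linear_entries (F : {linear M -> M}) X a d :
  F X a d = \sum_b \sum_c X b c * F (delta_mx b c) a d.
Proof.
rewrite {1}(matrix_sum_delta X) linear_sum summxE; apply: eq_bigr => b _.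
by rewrite linear_sum summxE; apply: eq_bigr => c _; rewrite linearZ mxE.
Qed.

Lemma mulmx3_entry (A B D : M) a d :
  (A *m B *m D) a d = \sum_b \sum_c A a b * B b c * D c d.
Proof.
rewrite mxE exchange_big; apply: eq_bigr => c _.
by rewrite mxE mulr_suml.
Qed.

End MatrixUnits.

Section DerivationForm.
Variables (R : realType) (n : nat).
Local Notation C := R[i].
Local Notation M := 'M[C]_n.
Local Notation Re := (@complex.Re R).
Variables (s : 'I_n -> R) (F : {linear M -> M}) (i0 : 'I_n).
Hypothesis s_gt0 : forall i, 0 < s i.
Hypothesis F_form : forall k (B : 'I_k -> M) (v : 'I_k -> 'rV[C]_n),
  0 <= \sum_i \sum_j (v i *m F (B i *m (B j)^t*) *m (v j)^t*) 0 0.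
Hypothesis F_adj : forall X, F (X^t*) = (F X)^t*.
Hypothesis F1 : F 1%:M = 1%:M.
Let q i := Num.sqrt (s i).
Definition sqrt_diag : M := diag_mx (\row_i (Num.sqrt (s i))%:C).
Let S := sqrt_diag.
Hypothesis F_inv : forall X, \tr (S *m S *m F X) = \tr (S *m S *m X).

Let q_gt0 i : 0 < q i. Proof. by rewrite sqrtr_gt0. Qed.

Let I := ('I_n * 'I_n)%type.

(** The Choi matrix of [F] with pairs of indices flattened: position [(a, b), (d, c)] holds the
    entry [a, d] of [F] at the matrix unit [b, c]. *)
Let G : 'M[C]_#|{: I}| := \matrix_(x, y)
  F (delta_mx (enum_val x).2 (enum_val y).2) (enum_val x).1 (enum_val y).1.

Let sum_pairs (f : 'I_#|{: I}| -> C) :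
  \sum_x f x = \sum_b \sum_a f (enum_rank ((a, b) : I)).
Proof.
rewrite (reindex (@enum_rank I)) /=; last exact/onW_bij/enum_rank_bij.
rewrite exchange_big pair_big /=; apply: eq_bigr => -[a b] _; reflexivity.
Qed.

Let G_psd : psd G.
Proof.
split=> [|z].
  apply/matrixP => x y; rewrite !mxE.
  by rewrite -(adj_delta C (enum_val y).2 (enum_val x).2) F_adj !mxE.
pose v b : 'rV[C]_n := \row_a z 0 (enum_rank ((a, b) : I)).
pose B b : M := delta_mx b i0.
have := F_form B v.
suff -> : (z *m G *m z^t*) 0 0 =
   \sum_b \sum_c (v b *m F (B b *m (B c)^t*) *m (v c)^t*) 0 0 by [].
have -> : (z *m G *m z^t*) 0 0 = \sum_x \sum_y z 0 x * G x y * Num.conj (z 0 y).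
  rewrite mxE exchange_big; apply: eq_bigr => y _; rewrite !mxE mulr_suml.
  by apply: eq_bigr => x _; rewrite !mxE.
rewrite sum_pairs; apply: eq_bigr => b _.
under eq_bigr do rewrite sum_pairs.
rewrite exchange_big; apply: eq_bigr => c _.
rewrite (adj_delta _ c i0) mul_delta_mx.
rewrite [RHS]mxE exchange_big; apply: eq_bigr => d _; rewrite !mxE mulr_suml.
by apply: eq_bigr => a _; rewrite !mxE !enum_rankK.
Qed.

(** Let T be the completely positive map with Kraus matrices [V j]. Dividing the Choi matrix
    entrywise by [q b / q a + q c / q d] makes T solve T(S X) S + S T(X S) = S F(X) S. Invariance of
    the state and unitality of [F] give the two normalizations required by [derivation_trace]. *)
Lemma derivation_form : exists V : 'I_#|{: I}| -> M,
  (forall a b d c, \sum_j V j a b * Num.conj (V j d c)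
     = F (delta_mx b c) a d / (q b / q a + q c / q d)%:C) /\
  (forall X, X^t* = X ->
     \tr (X *m S *m X *m S) - \tr (X *m S *m F X *m S) =
     \sum_j \tr ((V j *m X - X *m V j)^t* *m S *m (V j *m X - X *m V j) *m S)).
Proof.
have [|W WE] := lyapunov_psd (x := fun x => q (enum_val x).2 / q (enum_val x).1) G_psd.
  by move=> x; rewrite divr_gt0.
pose V j : M := \matrix_(a, b) Num.conj (W j (enum_rank ((a, b) : I))).
have VV a b d c : \sum_j V j a b * Num.conj (V j d c)
     = F (delta_mx b c) a d / (q b / q a + q c / q d)%:C.
  have := WE (enum_rank ((a, b) : I)) (enum_rank ((d, c) : I)).
  rewrite [G _ _]mxE !enum_rankK /= => ->; rewrite mxE; apply: eq_bigr => j _.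
  by rewrite !mxE conjCK.
exists V; split; first exact: VV.
move=> X Xsa.
have qC a : (q a)%:C != 0 by rewrite (inj_eq (@complexI R) _ 0) gt_eqF.
have qqC a b : (q a + q b)%:C != 0 by rewrite (inj_eq (@complexI R) _ 0) gt_eqF// addr_gt0.
have qqD a b : (q a)%:C + (q b)%:C != 0 by rewrite -rmorphD qqC.
have qqC' a b c d : (q b / q a + q c / q d)%:C != 0.
  by rewrite (inj_eq (@complexI R) _ 0) gt_eqF// addr_gt0// divr_gt0.
have SE a b : S a b = (q a)%:C *+ (a == b) by rewrite !mxE.
have sumS1 (f : 'I_n -> C) a : \sum_b S a b * f b = (q a)%:C * f a.
  rewrite (bigD1 a)//= SE eqxx mulr1n big1 ?addr0// => b /negbTE ba.
  by rewrite SE eq_sym ba mulr0n mul0r.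
have sumS2 (f : 'I_n -> C) b : \sum_a f a * S a b = f b * (q b)%:C.
  rewrite (bigD1 b)//= SE eqxx mulr1n big1 ?addr0// => a /negbTE ba.
  by rewrite SE ba mulr0n mulr0.
have SA (A : M) a b : (S *m A) a b = (q a)%:C * A a b by rewrite mxE sumS1.
have AS (A : M) a b : (A *m S) a b = A a b * (q b)%:C by rewrite mxE sumS2.
have TE (Y : M) a d : (\sum_j V j *m Y *m (V j)^t*) a d =
    \sum_b \sum_c Y b c * (F (delta_mx b c) a d / (q b / q a + q c / q d)%:C).
  rewrite summxE; under eq_bigr do rewrite mulmx3_entry.
  rewrite exchange_big; apply: eq_bigr => b _; rewrite exchange_big; apply: eq_bigr => c _.
  rewrite -VV mulr_sumr; apply: eq_bigr => j _.
  by rewrite [((V j)^t*) c d]mxE [((V j)^T) c d]mxE; ring.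
have TS : \sum_j (V j)^t* *m S *m V j = 2^-1 *: S.
  apply/matrixP => b c; rewrite summxE.
  have -> : \sum_j ((V j)^t* *m S *m V j) b c
     = \sum_a (q a)%:C * \sum_j V j a c * Num.conj (V j a b).
    under eq_bigr do rewrite -mulmxA mxE.
    rewrite exchange_big; apply: eq_bigr => a _; rewrite mulr_sumr; apply: eq_bigr => j _.
    by rewrite SA [((V j)^t*) b a]mxE [((V j)^T) b a]mxE; ring.
  under eq_bigr do rewrite VV.
  (* The powers of [q a] combine to the density [S *m S], so the invariance of the state applies;
     the diagonal entry becomes [q c ^ 2 / (2 q c)]. *)
  have -> : \sum_a (q a)%:C * (F (delta_mx c b) a a / (q c / q a + q b / q a)%:C)
     = \tr (S *m S *m F (delta_mx c b)) / (q c + q b)%:C.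
    rewrite mulr_suml; apply: eq_bigr => a _; rewrite -mulmxA !SA.
    rewrite -[q c / q a + q b / q a]mulrDl rmorphM fmorphV; field.
    by rewrite !qC qqD.
  rewrite F_inv -mulmxA mxtrace_mulC -mulmxA.
  have -> : \tr (S *m (delta_mx c b *m S)) = (q c)%:C * ((c == b)%:R * (q b)%:C).
    rewrite /mxtrace (bigD1 c)//= SA AS mxE eqxx big1 ?addr0//.
      by rewrite /=; case: eqP => [->|]//; rewrite !mul0r !mulr0.
    by move=> a /negbTE ac; rewrite SA AS mxE ac mul0r mulr0.
  rewrite [RHS]mxE SE eq_sym; case: eqP => [->|_]; last by rewrite !(mul0r, mulr0).
  rewrite /= !mulr1n rmorphD /=; field.
  by rewrite -mulr2n -mulr_natr mulf_neq0 ?qC// pnatr_eq0.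
have TS' : \sum_j V j *m S *m (V j)^t* = 2^-1 *: S.
  apply/matrixP => a d; rewrite TE.
  (* On the diagonal [b = c] the factor [q b] cancels, and the sum over [b] is [F] at the
     identity. *)
  have -> : \sum_b \sum_c S b c * (F (delta_mx b c) a d / (q b / q a + q c / q d)%:C)
     = (\sum_b F (delta_mx b b) a d) / (1 / q a + 1 / q d)%:C.
    rewrite mulr_suml; apply: eq_bigr => b _; rewrite sumS1.
    have -> : q b / q a + q b / q d = q b * (1 / q a + 1 / q d) by ring.
    have h : (1 / q a + 1 / q d)%:C != 0.
      by rewrite (inj_eq (@complexI R) _ 0) gt_eqF// addr_gt0// divr_gt0.
    rewrite rmorphM /=; move: ((1 / q a + 1 / q d)%:C) h => k k0; field.
    by rewrite k0 qC.
  have -> : \sum_b F (delta_mx b b) a d = (F 1%:M) a d.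
    rewrite linear_entries; apply: eq_bigr => b _; rewrite (bigD1 b)//= !mxE eqxx mul1r.
    by rewrite big1 ?addr0// => c /negbTE cb; rewrite mxE eq_sym cb mul0r.
  rewrite F1 [RHS]mxE SE mxE; case: eqP => [->|_]; last by rewrite !(mul0r, mulr0).
  rewrite !mulr1n rmorphD !fmorph_div rmorph1; field.
  exact: qC.
apply: derivation_trace Xsa TS TS' _.
apply/matrixP => a d.
  rewrite mxE AS SA !TE AS SA linear_entries mulr_suml !mulr_sumr mulr_suml -big_split.
  apply: eq_bigr => b _ /=; rewrite mulr_suml !mulr_sumr mulr_suml -big_split.
  apply: eq_bigr => c _ /=; rewrite SA AS.
  have -> : (q b / q a + q c / q d)%:C = ((q b)%:C * (q d)%:C + (q c)%:C * (q a)%:C) / ((q a)%:C * (q d)%:C).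
    by rewrite rmorphD !fmorph_div; field; rewrite !qC.
  have h : (q b)%:C * (q d)%:C + (q c)%:C * (q a)%:C != 0.
    by rewrite -!rmorphM -rmorphD (inj_eq (@complexI R) _ 0) gt_eqF// addr_gt0// mulr_gt0.
  by field; rewrite h !qC.
Qed.

End DerivationForm.

(** * Passage to the eigenframe of the state *)

Section Frame.
Variables (C : numClosedFieldType) (n : nat).
Local Notation M := 'M[C]_n.
Implicit Types (U V X Y S Q A B : M) (F : {linear M -> M}).

(** Written as a composite of linear maps so that linearity is inferred. *)
Definition frame U F : {linear M -> M} :=
  mulmxr (U^t*) \o (mulmx U \o (F \o (mulmxr U \o mulmx (U^t*)))).

Lemma frameE U F X : frame U F X = U *m F (U^t* *m X *m U) *m U^t*.
Proof. by []. Qed.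

(** Exhibits each entry of the conjugated map as a trace of [F] at a fixed matrix against another,
    the kind of functional that [gen_diff_tr] differentiates along the semigroup. *)
Lemma frame_delta U F b c a d :
  frame U F (delta_mx b c) a d =
  \tr ((row d U)^t* *m row a U *m F ((row b U)^t* *m row c U)).
Proof.
have -> : (row b U)^t* *m row c U = U^t* *m delta_mx b c *m U.
  by rewrite !rowE adj_mul adj_delta !mulmxA -[_ *m delta_mx 0 c](mulmxA _ _) mul_delta_mx.
rewrite frameE; move: (F _) => Y.
rewrite -[in RHS]mulmxA mxtrace_mulC trace_mx11 -row_mul mxE [RHS]mxE.
by apply: eq_bigr => i _; rewrite [row a _ _ _]mxE !mxE.
Qed.

Lemma mxtrace_rot X Y A B : \tr (X *m A *m Y *m B) = \tr (B *m X *m A *m Y).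
Proof. by rewrite mxtrace_mulC !mulmxA. Qed.

Lemma frame_trace U S X Y :
  \tr (X^t* *m (U^t* *m S *m U) *m Y *m (U^t* *m S *m U)) =
  \tr ((U *m X *m U^t*)^t* *m S *m (U *m Y *m U^t*) *m S).
Proof.
rewrite !adj_mul trmxCK !mulmxA.
by rewrite [LHS]mxtrace_mulC !mulmxA.
Qed.

Lemma frameK U X : U \is unitarymx -> U^t* *m (U *m X *m U^t*) *m U = X.
Proof.
by move=> Uu; rewrite !mulmxA unitarymxV// mul1mx -mulmxA unitarymxV// mulmx1.
Qed.

Lemma frame_ccalc U Q (g : 'I_n -> C) :
  U *m ccalc Q g *m U^t* = ccalc (Q *m U^t*) g.
Proof. by rewrite /ccalc adj_mul trmxCK !mulmxA. Qed.

Lemma mul_unitarymx_adj Q U : Q \is unitarymx -> U \is unitarymx ->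
  Q *m U^t* \is unitarymx.
Proof. by move=> Qu Uu; rewrite mul_unitarymx// trmxC_unitary. Qed.

Lemma frame_selfadjoint U X : X^t* = X -> (U *m X *m U^t*)^t* = U *m X *m U^t*.
Proof. by move=> Xsa; rewrite !adj_mul trmxCK Xsa mulmxA. Qed.

Lemma frame_trace_sq X U A : U \is unitarymx ->
  \tr (U^t* *m A *m U *m (X *m X)) = \tr (A *m (U *m X *m U^t* *m (U *m X *m U^t*))).
Proof.
move=> Uu; rewrite -(mulmxA (U^t*) A U) -mulmxA mxtrace_mulC -!mulmxA.
by rewrite (mulmxA (U^t*) U) (unitarymxV Uu) mul1mx.
Qed.

Lemma commutator_frame Q V (g : 'I_n -> C) k l : Q \is unitarymx ->
  (Q *m (V *m ccalc Q g - ccalc Q g *m V) *m Q^t*) k l =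
  (Q *m V *m Q^t*) k l * (g l - g k).
Proof.
move=> Qu; pose D := diag_mx (\row_i g i).
have E1 : Q *m (V *m ccalc Q g) *m Q^t* = Q *m V *m Q^t* *m D.
  by rewrite /ccalc !mulmxA -[_ *m Q *m Q^t*](mulmxA _ Q) (unitarymxP Qu) mulmx1.
have E2 : Q *m (ccalc Q g *m V) *m Q^t* = D *m (Q *m V *m Q^t*).
  by rewrite /ccalc !mulmxA (unitarymxP Qu) mul1mx.
rewrite mulmxBr mulmxBl E1 E2; move: (Q *m V *m Q^t*) => A.
by rewrite mul_mx_diag mul_diag_mx !mxE; ring.
Qed.

Lemma hilbert_schmidt_frame Q X : Q \is unitarymx ->
  \tr ((Q *m X *m Q^t*)^t* *m (Q *m X *m Q^t*)) = \tr (X^t* *m X).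
Proof.
move=> Qu; rewrite !adj_mul trmxCK !mulmxA.
rewrite -[Q *m X^t* *m Q^t* *m Q](mulmxA _ (Q^t*)) unitarymxV// mulmx1.
by rewrite mxtrace_mulC !mulmxA (unitarymxV Qu) mul1mx.
Qed.

Lemma frame_adj U F : (forall X, F (X^t*) = (F X)^t*) ->
  forall X, frame U F (X^t*) = (frame U F X)^t*.
Proof.
move=> Fadj X; rewrite !frameE [RHS]adj_mul adj_mul -Fadj [(_ *m _ *m U)^t*]adj_mul.
by rewrite [(U^t* *m X)^t*]adj_mul trmxCK !mulmxA.
Qed.

Lemma frame1 U F : U \is unitarymx -> F 1%:M = 1%:M -> frame U F 1%:M = 1%:M.
Proof.
by move=> Uu F1; rewrite frameE mulmx1 (unitarymxV Uu) F1 mulmx1 (unitarymxP Uu).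
Qed.

Lemma frame_inv U F (Ds : M) : U \is unitarymx ->
  (forall X, \tr (U^t* *m Ds *m U *m F X) = \tr (U^t* *m Ds *m U *m X)) ->
  forall X, \tr (Ds *m frame U F X) = \tr (Ds *m X).
Proof.
move=> Uu Finv X; have := Finv (U^t* *m X *m U); rewrite frameE => E.
transitivity (\tr (U^t* *m Ds *m U *m F (U^t* *m X *m U))).
  by rewrite !mulmxA mxtrace_mulC !mulmxA.
rewrite E !mulmxA -[U^t* *m Ds *m U *m U^t*]mulmxA (unitarymxP Uu) mulmx1.
by rewrite mxtrace_mulC !mulmxA (unitarymxP Uu) mul1mx.
Qed.

Lemma frame_form_term U F (B B' : M) (v v' : 'rV[C]_n) :
  v *m frame U F (B *m B'^t*) *m v'^t* =
  (v *m U) *m F ((U^t* *m B) *m (U^t* *m B')^t*) *m (v' *m U)^t*.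
Proof. by rewrite frameE !adj_mul trmxCK !mulmxA. Qed.

(** Isolates the Gram sums of the entries of [V], which [derivation_form] expresses through [F];
    this turns squared moduli into an expression linear in the map. *)
Lemma gram_expand (J : finType) (V : J -> M) Q k l :
  \sum_j (Q *m V j *m Q^t*) k l * Num.conj ((Q *m V j *m Q^t*) k l) =
  \sum_a \sum_b \sum_d \sum_c Q k a * Num.conj (Q l b) * Num.conj (Q k d) * Q l c
    * \sum_j V j a b * Num.conj (V j d c).
Proof.
have E j : (Q *m V j *m Q^t*) k l * Num.conj ((Q *m V j *m Q^t*) k l) =
  \sum_a \sum_b \sum_d \sum_c Q k a * Num.conj (Q l b) * Num.conj (Q k d) * Q l c
    * (V j a b * Num.conj (V j d c)).
  have e : (Q *m V j *m Q^t*) k l = \sum_a \sum_b Q k a * V j a b * Num.conj (Q l b).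
    rewrite mulmx3_entry; apply: eq_bigr => a _; apply: eq_bigr => b _.
    by rewrite [(_^t*) b l]mxE mxE.
  rewrite e mulr_suml; apply: eq_bigr => a _; rewrite mulr_suml; apply: eq_bigr => b _.
  rewrite rmorph_sum mulr_sumr; apply: eq_bigr => d _.
  rewrite rmorph_sum mulr_sumr; apply: eq_bigr => c _.
  by rewrite !rmorphM /= conjCK; ring.
under eq_bigr do rewrite E.
rewrite exchange_big; apply: eq_bigr => a _; rewrite exchange_big; apply: eq_bigr => b _.
rewrite exchange_big; apply: eq_bigr => d _; rewrite exchange_big; apply: eq_bigr => c _.
by rewrite mulr_sumr.
Qed.

End Frame.

Section DirichletWeights.
Variables (R : realType) (n : nat).
Local Notation C := R[i].
Local Notation M := 'M[C]_n.
Local Notation Re := (@complex.Re R).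
Variables (U : M) (s : 'I_n -> R) (i0 : 'I_n) (smin smax : R).
Hypothesis Uu : U \is unitarymx.
Hypothesis s_gt0 : forall i, 0 < s i.
Hypothesis s_min : forall i, smin <= s i.
Hypothesis s_max : forall i, s i <= smax.
Let D : M := rcalc U s.
Let S : M := sqrt_diag s.
Let q i := Num.sqrt (s i).

Lemma mxpow_half : mxpow D 2^-1 = U^t* *m S *m U.
Proof.
rewrite /mxpow (mxcalcE _ Uu (erefl D)) /rcalc /ccalc /S /sqrt_diag.
have -> : \row_i ((@powR R ^~ 2^-1 \o s) i)%:C = \row_i (Num.sqrt (s i))%:C.
  by apply/rowP => i; rewrite !mxE /= powR12_sqrt// ltW.
by [].
Qed.

Lemma kms_frame X Y : kms D X Y =
  \tr ((U *m X *m U^t*)^t* *m S *m (U *m Y *m U^t*) *m S).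
Proof. by rewrite /kms mxpow_half frame_trace. Qed.

Lemma sqrt_diag_square : S *m S = diag_mx (\row_i (s i)%:C).
Proof.
rewrite /S /sqrt_diag mulmx_diag; congr diag_mx; apply/rowP => i.
by rewrite !mxE -rmorphM -expr2 sqr_sqrtr// ltW.
Qed.

Lemma weighted_square (K : M) :
  Re (\tr (K^t* *m S *m K *m S)) = \sum_a \sum_b q a * q b * nsq (K a b).
Proof.
rewrite exchange_big Re_sum; apply: eq_bigr => b _.
have -> : (K^t* *m S *m K *m S) b b = \sum_a (q a * q b * nsq (K a b))%:C.
  have -> : S = diag_mx (\row_i (q i)%:C) by [].
  rewrite mul_mx_diag mxE mxE mulr_suml; apply: eq_bigr => a _.
  rewrite mul_mx_diag; move: K => A; rewrite !mxE 2!rmorphM /= -mulr_conj.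
  by ring.
by rewrite Re_sum.
Qed.

Lemma weighted_square_bounds (K : M) :
  smin * Re (\tr (K^t* *m K)) <= Re (\tr (K^t* *m S *m K *m S))
    <= smax * Re (\tr (K^t* *m K)).
Proof.
rewrite weighted_square tr_gram /fro2 !mulr_sumr.
have smin_q a b : smin <= q a * q b.
  have [m0|m0] := ltP smin 0; first by apply: ltW; apply: lt_le_trans m0 _; rewrite mulr_ge0 ?sqrtr_ge0.
  have h i : Num.sqrt smin <= q i by exact: ler_wsqrtr.
  by rewrite -[smin]sqr_sqrtr// expr2 ler_pM ?sqrtr_ge0.
have smax_q a b : q a * q b <= smax.
  have m0 : 0 <= smax by apply: le_trans (s_max i0); rewrite ltW.
  have h i : q i <= Num.sqrt smax by exact: ler_wsqrtr.
  by rewrite -[smax]sqr_sqrtr// expr2 ler_pM ?sqrtr_ge0.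
by apply/andP; split; apply: ler_sum => a _; rewrite mulr_sumr; apply: ler_sum => b _;
  rewrite ler_wpM2r ?nsq_ge0.
Qed.

End DirichletWeights.

(** * Transition weights of a map and of the generator *)

Section Weights.
Variables (R : realType) (n : nat).
Local Notation C := R[i].
Local Notation M := 'M[C]_n.
Local Notation Re := (@complex.Re R).
Variables (U : M) (s : 'I_n -> R) (i0 : 'I_n) (smin smax : R).
Hypothesis Uu : U \is unitarymx.
Hypothesis s_gt0 : forall i, 0 < s i.
Hypothesis s_min : forall i, smin <= s i.
Hypothesis s_max : forall i, s i <= smax.
Let D : M := rcalc U s.
Let S : M := sqrt_diag s.
Let q i := Num.sqrt (s i).
Variable Q : M.
Hypothesis Qu : Q \is unitarymx.

(** Collects what is independent of the map: the change of basis from the eigenframe of [D] to that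
    of the observable, and the Lyapunov denominator. *)
Definition weight_coef (k l a b d c : 'I_n) : C :=
  let Q' := Q *m U^t* in
  Q' k a * Num.conj (Q' l b) * Num.conj (Q' k d) * Q' l c / (q b / q a + q c / q d)%:C.

(* For a completely positive unital [F], the transition weight between the
   spectral projections [k] and [l] of an observable diagonalized by [Q]. *)
Definition weight (F : M -> M) (k l : 'I_n) : R :=
  \sum_a \sum_b \sum_d \sum_c
    Re (\tr (weight_coef k l a b d c *: ((row d U)^t* *m row a U)
             *m F ((row b U)^t* *m row c U))).

Lemma weightE (F : {linear M -> M}) k l : weight F k l = Re (
  \sum_a \sum_b \sum_d \sum_c weight_coef k l a b d c * frame U F (delta_mx b c) a d).
Proof.
rewrite Re_sum; apply: eq_bigr => a _; rewrite Re_sum; apply: eq_bigr => b _.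
rewrite Re_sum; apply: eq_bigr => d _; rewrite Re_sum; apply: eq_bigr => c _.
by rewrite frame_delta -scalemxAl mxtraceZ.
Qed.

Lemma q_gt0 i : 0 < q i.
Proof. by rewrite sqrtr_gt0. Qed.

Lemma frame_unitary : Q *m U^t* \is unitarymx.
Proof. exact: (mul_unitarymx_adj Qu Uu). Qed.

(** At the identity only [a = b] and [c = d] survive, the denominator is 2, and the sum factors
    through the inner product of two distinct rows of a unitary matrix. *)
Lemma weight_id k l : k != l -> weight id k l = 0.
Proof.
move=> kl; rewrite (weightE idfun).
set Q' := Q *m U^t*.
have E a b d c : weight_coef k l a b d c * frame U idfun (delta_mx b c) a d =
  if (a == b) && (c == d) then
    2^-1 * ((Q' k a * Num.conj (Q' l a)) * (Num.conj (Q' k d) * Q' l d)) else 0.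
  have -> : frame U idfun (delta_mx b c) = delta_mx b c.
    by rewrite frameE !mulmxA (unitarymxP Uu) mul1mx -mulmxA (unitarymxP Uu) mulmx1.
  rewrite mxE [d == c]eq_sym; case: (eqVneq a b) => [<-|_]; last by rewrite mulr0.
  case: (eqVneq c d) => [->|_]; last by rewrite mulr0.
  rewrite /weight_coef !divff ?gt_eqF ?q_gt0// rmorphD rmorph1 /= -/Q'.
  by field.
under eq_bigr => a _ do under eq_bigr => b _ do under eq_bigr => d _ do under eq_bigr => c _ do rewrite E.
have -> : \sum_a \sum_b \sum_d \sum_c (if (a == b) && (c == d) then
    2^-1 * ((Q' k a * Num.conj (Q' l a)) * (Num.conj (Q' k d) * Q' l d)) else 0)
  = \sum_a \sum_d 2^-1 * ((Q' k a * Num.conj (Q' l a)) * (Num.conj (Q' k d) * Q' l d)).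
  apply: eq_bigr => a _; rewrite exchange_big; apply: eq_bigr => d _.
  rewrite (bigD1 a)//= (bigD1 d)//= !eqxx /= !big1 ?addr0//.
    by move=> b ba; rewrite big1// => c _; rewrite eq_sym (negbTE ba).
  by move=> c cd; rewrite (negbTE cd).
have Q'kl : \sum_a Q' k a * Num.conj (Q' l a) = 0.
  have /unitarymxP/matrixP/(_ k l) := frame_unitary.
  rewrite -/Q' mxE [RHS]mxE (negbTE kl) => orth; apply: etrans orth.
  by apply: eq_bigr => a _; move: (Q') => B; rewrite !mxE.
have -> : \sum_a \sum_d 2^-1 * ((Q' k a * Num.conj (Q' l a)) * (Num.conj (Q' k d) * Q' l d))
  = (\sum_a Q' k a * Num.conj (Q' l a)) * \sum_d 2^-1 * (Num.conj (Q' k d) * Q' l d).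
  rewrite mulr_suml; apply: eq_bigr => a _; rewrite mulr_sumr; apply: eq_bigr => d _.
  by rewrite mulrCA.
by rewrite Q'kl mul0r.
Qed.

Section OneMap.
Variable F : {linear M -> M}.
Hypothesis Fcp : completely_positive F.
Hypothesis F1 : F 1%:M = 1%:M.
Hypothesis Finv : forall X, \tr (D *m F X) = \tr (D *m X).

(** By [derivation_form] the weight is a sum over [j] of squared moduli of the entry [k, l] of
    [V j], read in the eigenframe of [X]. There the commutator with [X] multiplies that entry by
    [x l - x k]. Replacing the two factors [S] by a scalar costs [smin] or [smax]. *)
Lemma cp_weights : (forall k l, 0 <= weight F k l) /\
  forall x : 'I_n -> R, let X := rcalc Q x in
   smin * (\sum_k \sum_l weight F k l * (x k - x l) ^+ 2)
     <= Re (kms D X X) - Re (kms D X (F X))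
     <= smax * (\sum_k \sum_l weight F k l * (x k - x l) ^+ 2).
Proof.
have form k (B : 'I_k -> M) (v : 'I_k -> 'rV[C]_n) :
    0 <= \sum_i \sum_j (v i *m frame U F (B i *m (B j)^t*) *m (v j)^t*) 0 0.
  have := cp_form Fcp (fun i => U^t* *m B i) (fun i => v i *m U).
  by under eq_bigr => i _ do under eq_bigr => j _ do rewrite -frame_form_term.
have fadj := frame_adj U (cp_adj Fcp).
have f1 := frame1 Uu F1.
have finv X : \tr (S *m S *m frame U F X) = \tr (S *m S *m X).
  by rewrite (sqrt_diag_square s_gt0); exact: (frame_inv Uu).
have [V [VV VE]] := derivation_form i0 s_gt0 form fadj f1 finv.
pose Q' := Q *m U^t*.
have Q'u : Q' \is unitarymx := frame_unitary.
have wE k l : weight F k l = \sum_j nsq ((Q' *m V j *m Q'^t*) k l).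
  have G : \sum_a \sum_b \sum_d \sum_c weight_coef k l a b d c * frame U F (delta_mx b c) a d
    = \sum_j (Q' *m V j *m Q'^t*) k l * Num.conj ((Q' *m V j *m Q'^t*) k l).
    rewrite gram_expand.
    apply: eq_bigr => a _; apply: eq_bigr => b _; apply: eq_bigr => d _; apply: eq_bigr => c _.
    by rewrite VV /weight_coef mulrAC mulrA.
  by rewrite weightE G Re_sum; apply: eq_bigr => j _; rewrite mulr_conj.
split=> [k l|x /=]; last set X := rcalc Q x; first by rewrite wE; apply: sumr_ge0 => j _; exact: nsq_ge0.
pose X' := U *m X *m U^t*.
have X'E : X' = ccalc Q' (fun i => (x i)%:C) := frame_ccalc _ _ _.
have X'sa : X'^t* = X' by rewrite X'E; exact: selfadjoint_rcalc.
have E : Re (kms D X X) - Re (kms D X (F X)) =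
    \sum_j Re (\tr ((V j *m X' - X' *m V j)^t* *m S *m (V j *m X' - X' *m V j) *m S)).
  rewrite -ReB -Re_sum !(kms_frame Uu s_gt0) -/X' X'sa -(VE _ X'sa).
  have -> : frame U F X' = U *m F X *m U^t* by rewrite frameE (frameK _ Uu).
  by [].
have hs j : Re (\tr ((V j *m X' - X' *m V j)^t* *m (V j *m X' - X' *m V j)))
   = \sum_k \sum_l nsq ((Q' *m V j *m Q'^t*) k l) * (x k - x l) ^+ 2.
  rewrite -(hilbert_schmidt_frame _ Q'u) tr_gram /fro2; apply: eq_bigr => k _; apply: eq_bigr => l _.
  rewrite X'E commutator_frame// nsqM -rmorphB nsqC; congr (_ * _).
  by rewrite -sqrrN opprB.
have tot : \sum_k \sum_l weight F k l * (x k - x l) ^+ 2 =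
   \sum_j Re (\tr ((V j *m X' - X' *m V j)^t* *m (V j *m X' - X' *m V j))).
  under [RHS]eq_bigr do rewrite hs.
  rewrite [RHS]exchange_big; apply: eq_bigr => k _ /=.
  rewrite [RHS]exchange_big; apply: eq_bigr => l _ /=.
  by rewrite wE mulr_suml.
rewrite E tot !mulr_sumr; apply/andP; split; apply: ler_sum => j _;
  by have /andP[] := weighted_square_bounds i0 s_gt0 s_min s_max (V j *m X' - X' *m V j).
Qed.

End OneMap.

Section Limit.
Variables (Phi : R -> {linear M -> M}) (L : {linear M -> M}).
Hypothesis genL : generator Phi L.
Hypothesis Phi_cp : forall t, 0 <= t -> completely_positive (Phi t).
Hypothesis Phi_1 : forall t, 0 <= t -> Phi t 1%:M = 1%:M.
Hypothesis Phi_inv : invariant_state Phi D.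

Let n_gt0 : (0 < n)%N. Proof. exact: leq_ltn_trans (leq0n i0) (ltn_ord i0). Qed.

Lemma gen_diff_kms X Y : gen_diff Phi L (fun F => Re (kms D X (F Y))).
Proof.
pose A := mxpow D 2^-1.
apply: gen_diff_ext (gen_diff_tr n_gt0 genL (A *m X^t* *m A) Y) => F.
by congr Re; symmetry; exact: (mxtrace_rot (X^t*) (F Y) A A).
Qed.

Lemma gen_diff_weight k l : gen_diff Phi L (fun F => weight F k l).
Proof. by do 4 (apply: gen_diff_sum => ?); exact: gen_diff_tr. Qed.

(** Off the diagonal the weights of [Phi t] are nonnegative and those of the identity vanish, so
    minus the weights of [L] are nonnegative; the two comparisons are differentiated in the same
    way. Diagonal weights multiply zero differences and are set to 0. *)
Lemma dirichlet_weights : exists w : 'I_n -> 'I_n -> R, [/\ forall k l, 0 <= w k l, forall k, w k k = 0 &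
  forall x : 'I_n -> R, let X := rcalc Q x in
   smin * (\sum_k \sum_l w k l * (x k - x l) ^+ 2)
     <= Re (kms D X (L X)) <= smax * (\sum_k \sum_l w k l * (x k - x l) ^+ 2)].
Proof.
exists (fun k l => if k == l then 0 else - weight L k l); split=> [k l|k|x /=]; last set X := rcalc Q x.
  case: ifPn => [|kl]; first by rewrite lexx.
  have g := gen_diffZ (-1) (gen_diff_weight k l).
  rewrite -mulN1r; apply: (gen_diff_ge0 g) => t t0; rewrite !mulN1r lerN2.
  rewrite weight_id//.
  by have [w0 _] := cp_weights (Phi_cp (ltW t0)) (Phi_1 (ltW t0)) (Phi_inv (ltW t0)).
- by rewrite eqxx.
pose form (F : M -> M) := \sum_k \sum_l (x k - x l) ^+ 2 * weight F k l.
have g : gen_diff Phi L form.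
  by do 2 (apply: gen_diff_sum => ?); apply: gen_diffZ; exact: gen_diff_weight.
have form_id : form id = 0.
  apply: big1 => k _; apply: big1 => l _; have [->|kl] := eqVneq k l.
    by rewrite subrr expr0n mul0r.
  by rewrite weight_id// mulr0.
have -> : \sum_k \sum_l (if k == l then 0 else - weight L k l) * (x k - x l) ^+ 2 = - form L.
  rewrite -sumrN; apply: eq_bigr => k _; rewrite -sumrN; apply: eq_bigr => l _.
  have [->|kl] := eqVneq k l; first by rewrite subrr expr0n mulr0 mul0r oppr0.
  by rewrite mulNr mulrC.
have bounds t : 0 < t -> smin * form (Phi t) <= Re (kms D X X) - Re (kms D X (Phi t X))
    <= smax * form (Phi t).
  move=> t0.
  have [_ /(_ x)] := cp_weights (Phi_cp (ltW t0)) (Phi_1 (ltW t0)) (Phi_inv (ltW t0)).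
  by under eq_bigr => k _ do under eq_bigr => l _ do rewrite mulrC.
have lower : 0 <= Re (kms D X (L X)) + smin * form L.
  apply: (gen_diff_ge0 (gen_diffD (gen_diff_kms X X) (gen_diffZ smin g))) => t t0.
  by have /andP[] := bounds t t0; rewrite form_id mulr0; lra.
have upper : 0 <= -1 * Re (kms D X (L X)) + (- smax) * form L.
  apply: (gen_diff_ge0 (gen_diffD (gen_diffZ (-1) (gen_diff_kms X X)) (gen_diffZ (- smax) g))) => t t0.
  by have /andP[] := bounds t t0; rewrite form_id mulr0; lra.
by apply/andP; split; lra.
Qed.

End Limit.

End Weights.

(** * Cheeger inequality *)

Section Overlap.
Variables (C : numClosedFieldType) (n : nat).
Local Notation M := 'M[C]_n.
Implicit Types (U Q : M) (g h : 'I_n -> C).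

Lemma tr_ccalcM U Q g h :
  \tr (ccalc U g *m ccalc Q h) =
  \sum_k \sum_i g i * h k * ((Q *m U^t*) k i * Num.conj ((Q *m U^t*) k i)).
Proof.
pose O := Q *m U^t*.
have OE : O^t* = U *m Q^t* by rewrite /O adj_mul trmxCK.
transitivity (\tr (diag_mx (\row_i g i) *m O^t* *m diag_mx (\row_i h i) *m O)).
  by rewrite OE /O /ccalc -[LHS]mxtrace_mulC !mulmxA mxtrace_mulC !mulmxA mxtrace_mulC !mulmxA.
rewrite -/O; move: O {OE} => O.
rewrite exchange_big; apply: eq_bigr => i _; rewrite mxE; apply: eq_bigr => k _.
by rewrite mul_mx_diag mxE mul_diag_mx !mxE; ring.
Qed.

Lemma unitary_row_sum U k : U \is unitarymx ->
  \sum_i U k i * Num.conj (U k i) = 1.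
Proof.
move=> /unitarymxP/matrixP/(_ k k); rewrite mxE [RHS]mxE eqxx => E; apply: etrans E.
by apply: eq_bigr => i _; rewrite !mxE.
Qed.

Lemma unitary_col_sum U i : U \is unitarymx ->
  \sum_k U k i * Num.conj (U k i) = 1.
Proof.
move=> /unitarymxV/matrixP/(_ i i); rewrite mxE [RHS]mxE eqxx => E; apply: etrans E.
by apply: eq_bigr => k _; rewrite !mxE mulrC.
Qed.

End Overlap.

Section OverlapReal.
Variables (R : realType) (n : nat).
Local Notation C := R[i].
Local Notation M := 'M[C]_n.
Local Notation Re := (@complex.Re R).
Variables (U Q : M).
Hypothesis Uu : U \is unitarymx.
Hypothesis Qu : Q \is unitarymx.

Definition overlap (k i : 'I_n) : R := nsq ((Q *m U^t*) k i).

Lemma overlap_ge0 k i : 0 <= overlap k i.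
Proof. exact: nsq_ge0. Qed.

Lemma overlap_row k : \sum_i overlap k i = 1.
Proof.
apply: complexI; rewrite rmorph_sum rmorph1 -(unitary_row_sum k (mul_unitarymx_adj Qu Uu)).
by apply: eq_bigr => i _; rewrite mulr_conj.
Qed.

Lemma overlap_col i : \sum_k overlap k i = 1.
Proof.
apply: complexI; rewrite rmorph_sum rmorph1 -(unitary_col_sum i (mul_unitarymx_adj Qu Uu)).
by apply: eq_bigr => k _; rewrite mulr_conj.
Qed.

Lemma tr_rcalcM (s x : 'I_n -> R) :
  Re (\tr (rcalc U s *m rcalc Q x)) = \sum_k \sum_i overlap k i * (s i * x k).
Proof.
rewrite tr_ccalcM Re_sum; apply: eq_bigr => k _; rewrite Re_sum; apply: eq_bigr => i _.
by rewrite mulr_conj -2!rmorphM /= mulrC.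
Qed.

End OverlapReal.

Lemma quadratic_bound (R : realFieldType) (N a b c : R) : 0 < N ->
  b <= N ^+ 2 * a -> 0 <= N ^+ 2 * a - 2 * N * c + b -> c <= N * a.
Proof.
move=> N0 h1 h2; have : 2 * N * c <= 2 * N * (N * a) by lra.
by rewrite ler_pM2l// mulr_gt0.
Qed.

Section Gap.
Variables (R : realType) (n : nat).
Local Notation C := R[i].
Local Notation M := 'M[C]_n.
Local Notation Re := (@complex.Re R).
Variables (U : M) (s : 'I_n -> R) (smin smax : R).
Hypothesis n_ge2 : (2 <= n)%N.
Hypothesis Uu : U \is unitarymx.
Hypothesis s_gt0 : forall i, 0 < s i.
Hypothesis s_min : forall i, smin <= s i.
Hypothesis s_max : forall i, s i <= smax.
Hypothesis smin_gt0 : 0 < smin.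
Hypothesis s_sum1 : \sum_i s i = 1.
Let D : M := rcalc U s.
Let S : M := sqrt_diag s.
Let q i := Num.sqrt (s i).
Variables (Phi : R -> {linear M -> M}) (L : {linear M -> M}).
Hypothesis genL : generator Phi L.
Hypothesis Phi_cp : forall t, 0 <= t -> completely_positive (Phi t).
Hypothesis Phi_1 : forall t, 0 <= t -> Phi t 1%:M = 1%:M.
Hypothesis Phi_inv : invariant_state Phi D.

Let n_gt0 : (0 < n)%N. Proof. exact: leq_trans n_ge2. Qed.
Let i0 : 'I_n := Ordinal n_gt0.
Let i1 : 'I_n := Ordinal n_ge2.

Let smax_gt0 : 0 < smax.
Proof. exact: lt_le_trans (s_gt0 i0) (s_max i0). Qed.

Lemma kms_normE X : kms_norm D X ^+ 2 = Re (kms D X X).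
Proof.
rewrite /kms_norm sqr_sqrtr// (kms_frame Uu s_gt0) weighted_square.
by do 2 (apply: sumr_ge0 => ? _); rewrite mulr_ge0 ?nsq_ge0// mulr_ge0 ?sqrtr_ge0.
Qed.

Lemma kms_norm_weighted X : kms_norm D X ^+ 2 =
  \sum_a \sum_b q a * q b * nsq ((U *m X *m U^t*) a b).
Proof. by rewrite kms_normE (kms_frame Uu s_gt0) weighted_square. Qed.

Lemma Re_kms_weighted X Y : Re (kms D X Y) =
  \sum_a \sum_b q a * q b * (Re ((U *m X *m U^t*) a b) * Re ((U *m Y *m U^t*) a b)
    + complex.Im ((U *m X *m U^t*) a b) * complex.Im ((U *m Y *m U^t*) a b)).
Proof.
rewrite (kms_frame Uu s_gt0) exchange_big Re_sum; apply: eq_bigr => b _.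
have -> : sqrt_diag s = diag_mx (\row_i (q i)%:C) by [].
move: (U *m X *m U^t*) (U *m Y *m U^t*) => A B.
rewrite mul_mx_diag mxE mxE mulr_suml Re_sum; apply: eq_bigr => a _.
rewrite mul_mx_diag !mxE.
by case: (A a b) => x y; case: (B a b) => u v /=; ring.
Qed.

Lemma Re_kmsC X Y : Re (kms D X Y) = Re (kms D Y X).
Proof.
rewrite (Re_kms_weighted X) (Re_kms_weighted Y).
by apply: eq_bigr => a _; apply: eq_bigr => b _; ring.
Qed.

Lemma kms_norm_fro2 X : smin * fro2 X <= kms_norm D X ^+ 2 <= smax * fro2 X.
Proof.
rewrite kms_normE (kms_frame Uu s_gt0).
have := weighted_square_bounds i0 s_gt0 s_min s_max (U *m X *m U^t*).
by rewrite (hilbert_schmidt_frame _ Uu) tr_gram.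
Qed.

Lemma kms_norm_gt0 X : X <> 0 -> 0 < kms_norm D X ^+ 2.
Proof.
move=> X0; have /andP[h _] := kms_norm_fro2 X; apply: lt_le_trans h.
rewrite mulr_gt0// lt_neqAle fro2_ge0 andbT eq_sym; apply/eqP => f0.
by apply: X0; exact: fro2_eq0.
Qed.

Lemma map_norm_kms (F : {linear M -> M}) X : X <> 0 ->
  kms_norm D (F X) <= map_norm (kms_norm D) F * kms_norm D X.
Proof.
move=> /eqP X0; have [K K0 Kb] := l1_linear_bound F.
have c1 Y : kms_norm D Y <= Num.sqrt smax * l1 Y.
  rewrite -ler_sqr ?nnegrE ?sqrtr_ge0 ?mulr_ge0 ?sqrtr_ge0 ?l1_ge0//.
  have /andP[_ h] := kms_norm_fro2 Y; apply: le_trans h _.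
  by rewrite exprMn (sqr_sqrtr (ltW smax_gt0)) ler_wpM2l ?fro2_le_l1// ltW.
have c2 Y : l1 Y <= (n * n)%:R / Num.sqrt smin * kms_norm D Y.
  apply: le_trans (l1_le_fro2 Y) _; rewrite -mulrA ler_wpM2l//.
  rewrite mulrC ler_pdivlMr ?sqrtr_gt0// -ler_sqr ?nnegrE ?mulr_ge0 ?sqrtr_ge0//.
  have /andP[h _] := kms_norm_fro2 Y; apply: le_trans h.
  by rewrite exprMn (sqr_sqrtr (ltW smin_gt0)) (sqr_sqrtr (fro2_ge0 _)) mulrC.
apply: (map_norm_bound _ _ K0 c1 c2 Kb X0); rewrite ?sqrtr_ge0//.
by rewrite divr_ge0 ?sqrtr_ge0.
Qed.

(** Expanding the squared norm of [N P - Z] gives 2 N Re <P, Z> <= N^2 |P|^2 + |Z|^2 <= 2 N^2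
    |P|^2. *)
Lemma kms_cauchy_schwarz (P Z : M) (N : R) : 0 < N -> kms_norm D Z <= N * kms_norm D P ->
  Re (kms D P Z) <= N * kms_norm D P ^+ 2.
Proof.
move=> N0 ZP.
have ZP2 : kms_norm D Z ^+ 2 <= N ^+ 2 * kms_norm D P ^+ 2.
  by rewrite -exprMn ler_sqr ?nnegrE ?mulr_ge0 ?sqrtr_ge0// ltW.
rewrite (Re_kms_weighted P) (kms_norm_weighted P); move: ZP2.
rewrite (kms_norm_weighted P) (kms_norm_weighted Z).
move: (U *m P *m U^t*) (U *m Z *m U^t*) => A B.
set nP := \sum_a \sum_b _ * nsq (A a b); set nZ := \sum_a _; set ip := \sum_a _.
move=> h; have : 0 <= \sum_a \sum_b q a * q b * nsq (N%:C * A a b - B a b).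
  by do 2 (apply: sumr_ge0 => ? _); rewrite mulr_ge0 ?nsq_ge0// mulr_ge0 ?sqrtr_ge0.
have -> : \sum_a \sum_b q a * q b * nsq (N%:C * A a b - B a b)
   = N ^+ 2 * nP - 2 * N * ip + nZ.
  rewrite /nP /ip /nZ !mulr_sumr -sumrB -big_split; apply: eq_bigr => a _ /=.
  rewrite !mulr_sumr -sumrB -big_split; apply: eq_bigr => b _ /=.
  by rewrite /nsq; case: (A a b) => x y; case: (B a b) => u v /=; ring.
move=> h2; exact: quadratic_bound N0 h h2.
Qed.

(** This is Tr (D P_k) for the [k]-th spectral projection in the frame [Q]: the distribution of the
    observable in the state. *)
Let pi (Q : M) k := \sum_i overlap U Q k i * s i.

Lemma pi_ge0 Q k : 0 <= pi Q k.
Proof. by apply: sumr_ge0 => i _; rewrite mulr_ge0 ?overlap_ge0// ltW. Qed.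

Lemma pi_sum1 Q : Q \is unitarymx -> \sum_k pi Q k = 1.
Proof.
move=> Qu; rewrite exchange_big -s_sum1; apply: eq_bigr => i _ /=.
by rewrite -mulr_suml (overlap_col Uu Qu) mul1r.
Qed.

Lemma rtr_rcalc Q x : Q \is unitarymx -> rtr (D *m rcalc Q x) = \sum_k pi Q k * x k.
Proof.
move=> Qu; rewrite /rtr tr_rcalcM; apply: eq_bigr => k _.
by rewrite mulr_suml; apply: eq_bigr => i _; rewrite mulrA.
Qed.

Lemma rcalcM Q x y : Q \is unitarymx ->
  rcalc Q x *m rcalc Q y = rcalc Q (fun k => x k * y k) :> M.
Proof.
move=> Qu; apply: etrans (ccalcM _ _ Qu) _.
by apply: eq_ccalc => k; rewrite -rmorphM.
Qed.

(** The right side is Tr (D X^2). In the eigenframe of [D] it weighs |X_ab|^2 by (s_a + s_b) / 2,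
    whereas the KMS norm weighs it by the geometric mean of s_a and s_b. *)
Lemma kms_norm_le Q x : Q \is unitarymx ->
  kms_norm D (rcalc Q x) ^+ 2 <= \sum_k pi Q k * x k ^+ 2.
Proof.
move=> Qu; rewrite -(rtr_rcalc _ Qu).
have -> : rcalc Q (fun k => x k ^+ 2) = rcalc Q x *m rcalc Q x.
  apply: esym; apply: etrans (rcalcM x x Qu) _.
  by apply: eq_ccalc => k; rewrite expr2.
have Xsa := selfadjoint_rcalc Q x; move: (rcalc Q x) Xsa => X Xsa.
rewrite kms_norm_weighted.
have X'sa : (U *m X *m U^t*)^t* = U *m X *m U^t* := frame_selfadjoint U Xsa.
have -> : rtr (D *m (X *m X)) = \sum_a \sum_b s a * nsq ((U *m X *m U^t*) a b).
  have := frame_trace_sq X (diag_mx (\row_i (s i)%:C)) Uu.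
  rewrite /rtr /D /rcalc {1}/ccalc => ->.
  rewrite -{2}X'sa; move: (U *m X *m U^t*) => A.
  rewrite Re_sum; apply: eq_bigr => a _; rewrite mul_diag_mx !mxE.
  rewrite Re_mulrC Re_sum mulr_sumr; apply: eq_bigr => b _.
  by rewrite !mxE mulr_conj.
move: (U *m X *m U^t*) X'sa => A Asa.
have sym a b : nsq (A a b) = nsq (A b a).
  by rewrite -[in LHS]Asa !mxE; case: (A b a) => u v; rewrite conjCE /nsq /= sqrrN.
have -> : \sum_a \sum_b s a * nsq (A a b) = \sum_a \sum_b (s a + s b) / 2 * nsq (A a b).
  have E : \sum_a \sum_b s a * nsq (A a b) = \sum_a \sum_b s b * nsq (A a b).
    rewrite exchange_big; apply: eq_bigr => a _; apply: eq_bigr => b _.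
    by rewrite sym.
  have -> : \sum_a \sum_b (s a + s b) / 2 * nsq (A a b) =
     2^-1 * (\sum_a \sum_b s a * nsq (A a b) + \sum_a \sum_b s b * nsq (A a b)).
    rewrite -big_split mulr_sumr; apply: eq_bigr => a _ /=.
    by rewrite -big_split mulr_sumr; apply: eq_bigr => b _ /=; ring.
  by rewrite -E; set t := \sum_a _; field.
apply: ler_sum => a _; apply: ler_sum => b _; rewrite ler_wpM2r ?nsq_ge0//.
have sq i : s i = q i ^+ 2 by rewrite sqr_sqrtr// ltW.
by rewrite (sq a) (sq b); have := sqr_ge0 (q a - q b); rewrite sqrrB; lra.
Qed.

End Gap.

Section CheegerConstants.
Variable R : realFieldType.
Implicit Types (h smin smax N W r E k : R).

(** [h / smax] is the isoperimetric constant of the weights, squared by the classical inequality;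
    [N / smin] bounds the degrees; the second [smin] comes from the lower comparison with the
    Dirichlet form. *)
Lemma cheeger_constants h smin smax N W r E k : 0 < smin -> 0 < smax -> 0 < N ->
  (h / smax) ^+ 2 * r <= 2 * (N / smin) * W -> smin * W <= E -> k <= r ->
  h ^+ 2 * smin ^+ 2 / (2 * smax ^+ 2 * N) * k <= E.
Proof.
move=> smin0 smax0 N0 h1 h2 kr.
have c0 : 0 <= h ^+ 2 * smin ^+ 2 / (2 * smax ^+ 2 * N).
  apply: divr_ge0; first by rewrite mulr_ge0 ?sqr_ge0.
  by rewrite mulr_ge0 ?(ltW N0)// mulr_ge0 ?sqr_ge0.
apply: le_trans (ler_wpM2l c0 kr) _; apply: le_trans h2.
have -> : h ^+ 2 * smin ^+ 2 / (2 * smax ^+ 2 * N) * r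
  = smin ^+ 2 / (2 * N) * ((h / smax) ^+ 2 * r).
  by field; rewrite !gt_eqF.
have -> : smin * W = smin ^+ 2 / (2 * N) * (2 * (N / smin) * W).
  by field; rewrite !gt_eqF.
by rewrite ler_wpM2l// divr_ge0 ?sqr_ge0// mulr_ge0// ltW.
Qed.

End CheegerConstants.

Section Shift.
Variables (C : numClosedFieldType) (n : nat).
Implicit Types (X Y S : 'M[C]_n) (c : C).

Lemma kms_shift_trace X S c : X^t* = X -> Num.conj c = c -> \tr (S *m S *m X) = 0 ->
  \tr ((X - c%:M)^t* *m S *m (X - c%:M) *m S) =
  \tr (X^t* *m S *m X *m S) + c ^+ 2 * \tr (S *m S).
Proof.
move=> Xsa cr tr0; have csa : (c%:M : 'M[C]_n)^t* = c%:M.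
  by rewrite tr_scalar_mx map_scalar_mx /= cr.
rewrite adjB Xsa csa mulmxBl mul_scalar_mx.
have -> : (X *m S - c *: S) *m (X - c%:M) *m S =
   X *m S *m X *m S - c *: (S *m X *m S) - (c *: (X *m S *m S) - c ^+ 2 *: (S *m S)).
  rewrite mulmxBr !mulmxBl mul_mx_scalar -!scalemxAl.
  by rewrite mul_mx_scalar -!scalemxAl scalerA expr2.
rewrite !raddfB /= !mxtraceZ.
have -> : \tr (S *m X *m S) = 0 by rewrite mxtrace_mulC mulmxA.
have -> : \tr (X *m S *m S) = 0 by rewrite -mulmxA mxtrace_mulC.
by ring.
Qed.

End Shift.

Section Cheeger.
Variables (R : realType) (n : nat).
Local Notation C := R[i].
Local Notation M := 'M[C]_n.
Local Notation Re := (@complex.Re R).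
Variables (U : M) (s : 'I_n -> R) (smin smax : R).
Hypothesis n_ge2 : (2 <= n)%N.
Hypothesis Uu : U \is unitarymx.
Hypothesis s_gt0 : forall i, 0 < s i.
Hypothesis s_min : forall i, smin <= s i.
Hypothesis s_max : forall i, s i <= smax.
Hypothesis smin_gt0 : 0 < smin.
Hypothesis s_sum1 : \sum_i s i = 1.
Let D : M := rcalc U s.
Variables (Phi : R -> {linear M -> M}) (L : {linear M -> M}).
Hypothesis genL : generator Phi L.
Hypothesis Phi_cp : forall t, 0 <= t -> completely_positive (Phi t).
Hypothesis Phi_1 : forall t, 0 <= t -> Phi t 1%:M = 1%:M.
Hypothesis Phi_inv : invariant_state Phi D.

Let n_gt0 : (0 < n)%N. Proof. exact: leq_trans n_ge2. Qed.
Let i0 : 'I_n := Ordinal n_gt0.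
Let i1 : 'I_n := Ordinal n_ge2.
Let h := conductance D L.
Let gap := spectral_gap D L.
Let N := map_norm (kms_norm D) L.

Let smax_gt0 : 0 < smax.
Proof. exact: lt_le_trans (s_gt0 i0) (s_max i0). Qed.

Let weights Q (Qu : Q \is unitarymx) :=
  dirichlet_weights i0 Uu s_gt0 s_min s_max Qu genL Phi_cp Phi_1 Phi_inv.

Lemma dirichlet_ge0 X : selfadjoint X -> 0 <= Re (kms D X (L X)).
Proof.
move=> /selfadjoint_diag[Q [x [Qu ->]]].
have [w [w0 _ /(_ x)/= /andP[lo _]]] := weights Qu; apply: le_trans lo.
rewrite mulr_ge0 ?(ltW smin_gt0)//; do 2 (apply: sumr_ge0 => ? _).
by rewrite mulr_ge0 ?sqr_ge0.
Qed.

Lemma spectral_gap_le X : selfadjoint X -> \tr (D *m X) = 0 ->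
  gap * kms_norm D X ^+ 2 <= Re (kms D X (L X)).
Proof.
move=> Xsa trX; case: (eqVneq X 0) => [X0|/eqP X0].
  have z : kms_norm D X = 0.
    by rewrite /kms_norm /kms X0 trmx0 map_mx0 !mul0mx mxtrace0 sqrtr0.
  by rewrite z expr0n mulr0 dirichlet_ge0.
have K0 := kms_norm_gt0 n_ge2 Uu s_gt0 s_min s_max smin_gt0 X0.
rewrite -ler_pdivlMr//; apply: ge_inf; last by exists X.
by exists 0 => _ [Y [_ Ysa _] <-]; rewrite divr_ge0 ?sqr_ge0 ?dirichlet_ge0.
Qed.

(** Lower bounds pass to the infimum only over a nonempty set. The witness is the indicator of one
    eigenvector of [D], centred; it is nonzero because a second eigenvector exists. *)
Lemma gap_test_exists : exists X : M, [/\ X <> 0, selfadjoint X & \tr (D *m X) = 0].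
Proof.
pose x i : R := (i == i0)%:R - s i0.
exists (rcalc U x); split.
- move=> X0; have := ccalc_row (fun i => (x i)%:C) i1 Uu.
  rewrite -/(rcalc U x) X0 mulmx0 => /esym/eqP; rewrite scaler_eq0.
  rewrite (negbTE (row_unitary_neq0 i1 Uu)) orbF (inj_eq (@complexI R) _ 0) /x /=.
  by rewrite sub0r oppr_eq0 gt_eqF.
- exact: selfadjoint_rcalc.
rewrite /D (rcalcM s x Uu) ccalc_tr// -rmorph_sum.
have -> : \sum_k s k * x k = 0; last by [].
rewrite (eq_bigr (fun k => s k * (k == i0)%:R - s k * s i0)); last first.
  by move=> k _; rewrite mulrBr.
rewrite sumrB -mulr_suml s_sum1 mul1r (bigD1 i0)//= ?eqxx mulr1 big1 ?addr0 ?subrr//.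
by move=> k /negbTE ->; rewrite mulr0.
Qed.

Lemma spectral_gap_ge0 : 0 <= gap.
Proof.
have [X Xin] := gap_test_exists.
apply: lb_le_inf; first by exists (Re (kms D X (L X)) / kms_norm D X ^+ 2), X.
by move=> _ [Y [_ Ysa _] <-]; rewrite divr_ge0 ?sqr_ge0 ?dirichlet_ge0.
Qed.

Let projection_state_ge0 P : projection P -> 0 <= rtr (D *m P).
Proof.
move=> [/selfadjoint_diag[Q [x [Qu PE]]] PP].
have -> : rtr (D *m P) = rtr (D *m rcalc Q (fun k => x k ^+ 2)).
  have <- : P *m P = rcalc Q (fun k => x k ^+ 2).
    rewrite PE; apply: etrans (rcalcM _ _ Qu) _.
    by apply: eq_ccalc => k; rewrite expr2.
  by rewrite PP.
rewrite /D (rtr_rcalc _ _ _ Qu).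
by apply: sumr_ge0 => k _; rewrite mulr_ge0 ?sqr_ge0// (pi_ge0 U s_gt0).
Qed.

Let rtr1 : rtr (D *m 1%:M) = 1.
Proof. by rewrite mulmx1 /rtr /D /rcalc (ccalc_tr _ Uu) Re_sum s_sum1. Qed.

Let projection_state_le1 P : projection P -> rtr (D *m P) <= 1.
Proof.
move=> [Psa PP]; have : projection (1%:M - P).
  split; first by rewrite /selfadjoint adjB Psa (adj1 _ n).
  by rewrite mulmxBl mul1mx mulmxBr mulmx1 PP subrr subr0.
move=> /projection_state_ge0; rewrite mulmxBr; move: rtr1; rewrite /rtr Re_trB => ->.
by rewrite subr_ge0.
Qed.

Let projection_min_ge0 P : projection P ->
  0 <= Num.min (rtr (D *m P)) (1 - rtr (D *m P)).
Proof.
by move=> Pp; rewrite le_min projection_state_ge0// subr_ge0 projection_state_le1.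
Qed.

Lemma conductance_ge0 : 0 <= h.
Proof.
rewrite /h /conductance; set A := (X in inf X).
(* The infimum of the empty set is 0 by convention, so no nontrivial projection has to be
   exhibited. *)
have [->|/set0P ne] := eqVneq A set0; first by rewrite inf0.
apply: lb_le_inf => // _ [P [Pp _ _] <-].
by apply: divr_ge0; [apply: dirichlet_ge0; case: Pp | exact: projection_min_ge0].
Qed.

(** The product form also covers the zero projection and the identity, where the minimum is 0. *)
Lemma conductance_mul_le P : projection P ->
  h * Num.min (rtr (D *m P)) (1 - rtr (D *m P)) <= Re (kms D P (L P)).
Proof.
move=> Pp; have [Psa _] := Pp; have E0 := dirichlet_ge0 Psa.
have := projection_min_ge0 Pp; rewrite le_eqVlt => /predU1P[<-|m0]; first by rewrite mulr0.
rewrite -ler_pdivlMr//; apply: ge_inf; last first.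
  exists P => //; split=> //.
    by move=> P0; move: m0; rewrite P0 mulmx0 /rtr mxtrace0 /= lt_min ltxx.
  by move=> P1; move: m0; rewrite P1 rtr1 subrr lt_min ltxx andbF.
exists 0 => _ [P' [Pp' _ _] <-].
by apply: divr_ge0; [apply: dirichlet_ge0; case: Pp' | exact: projection_min_ge0].
Qed.

Let mxpow_half_sq : mxpow D 2^-1 *m mxpow D 2^-1 = D.
Proof.
rewrite /mxpow (mxcalcE _ Uu (erefl D)); apply: etrans (rcalcM _ _ Uu) _.
by apply: eq_ccalc => i /=; rewrite powR12_sqrt ?(ltW (s_gt0 i))// -expr2 sqr_sqrtr// ltW.
Qed.

(** Constants are KMS-orthogonal to centred matrices. The classical inequality is centred at a
    median, and by this identity moving back to the mean can only lower the norm. *)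
Lemma kms_norm_shift X (m : R) : selfadjoint X -> \tr (D *m X) = 0 ->
  kms_norm D (X - m%:C%:M) ^+ 2 = kms_norm D X ^+ 2 + m ^+ 2.
Proof.
move=> Xsa trX; rewrite [LHS](kms_normE Uu s_gt0) [kms_norm D X ^+ 2](kms_normE Uu s_gt0) /kms.
rewrite (kms_shift_trace Xsa (conj_real m)); last by rewrite mxpow_half_sq.
rewrite mxpow_half_sq ReD; congr (_ + _).
by rewrite -rmorphXn Re_mulrC -/(rtr D) -[D]mulmx1 rtr1 mulr1.
Qed.

Section Basis.
Variable Q : M.
Hypothesis Qu : Q \is unitarymx.
Let pi k := \sum_i overlap U Q k i * s i.
Let proj (A : {set 'I_n}) : M := rcalc Q (fun k => (k \in A)%:R).

Let projP A : projection (proj A).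
Proof.
split; first exact: selfadjoint_rcalc.
apply: etrans (rcalcM _ _ Qu) _.
by apply: eq_ccalc => k; case: (k \in A); rewrite ?mulr1 ?mulr0.
Qed.

Let rtr_proj A : rtr (D *m proj A) = \sum_(k in A) pi k.
Proof.
rewrite /D (rtr_rcalc _ _ _ Qu) [RHS]big_mkcond; apply: eq_bigr => k _.
by case: ifP; rewrite ?mulr1 ?mulr0.
Qed.

(** Sums of spectral projections of the observable are projections, so the conductance of [L]
    becomes an isoperimetric constant [h / smax] for the weights. *)
Lemma cheeger_basis x : 0 < N ->
  h ^+ 2 * smin ^+ 2 / (2 * smax ^+ 2 * N) * kms_norm D (rcalc Q x) ^+ 2
    <= Re (kms D (rcalc Q x) (L (rcalc Q x))) \/ \tr (D *m rcalc Q x) != 0.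
Proof.
move=> N0; have [trX|] := eqVneq (\tr (D *m rcalc Q x)) 0; last by right.
left; have [w [w0 wd wE]] := weights Qu.
have pi0 k : 0 <= pi k := pi_ge0 U s_gt0 Q k.
have pi1 : \sum_k pi k = 1 := pi_sum1 Uu s_sum1 Qu.
have ind (A : {set 'I_n}) k l :
    ((k \in A)%:R - (l \in A)%:R) ^+ 2 = `|(k \in A)%:R - (l \in A)%:R| :> R.
  by case: (k \in A); case: (l \in A); rewrite ?subrr ?subr0 ?sub0r ?normrN ?sqrrN
     ?expr1n ?expr0n ?normr1 ?normr0.
have iso (A : {set 'I_n}) :
    h / smax * Num.min (\sum_(k in A) pi k) (1 - \sum_(k in A) pi k)
      <= total_variation w (fun k => (k \in A)%:R).
  rewrite mulrAC ler_pdivrMr// -rtr_proj [leRHS]mulrC.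
  apply: le_trans (conductance_mul_le (projP A)) _.
  have /andP[_ up] := wE (fun k => (k \in A)%:R); apply: le_trans up _.
  rewrite ler_wpM2l ?(ltW smax_gt0)//; apply: ler_sum => k _; apply: ler_sum => l _.
  by rewrite ind.
(* The Dirichlet form at the rank-one projection of index [k] is at least [smin] times the degree
   and at most [N] times the squared KMS norm, itself at most [pi k]. *)
have deg k : \sum_l (w k l + w l k) <= N / smin * pi k.
  pose A := [set k]%SET.
  have tw : \sum_i \sum_j w i j * ((i \in A)%:R - (j \in A)%:R) ^+ 2 = \sum_l (w k l + w l k).
    rewrite (bigD1 k)//= [RHS](bigD1 k)//= wd addr0 add0r big_split /=.
    congr (_ + _).
      rewrite (bigD1 k)//= wd mul0r add0r; apply: eq_bigr => j jk.
      by rewrite ind !inE eqxx (negbTE jk) subr0 normr1 mulr1.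
    apply: eq_bigr => i ik; rewrite (bigD1 k)//= big1 ?addr0.
      by rewrite ind !inE eqxx (negbTE ik) sub0r normrN normr1 mulr1.
    by move=> j jk; rewrite ind !inE (negbTE jk) (negbTE ik) subrr normr0 mulr0.
  have /andP[lo _] := wE (fun k => (k \in A)%:R); move: lo; rewrite tw => lo.
  rewrite mulrAC ler_pdivlMr// mulrC; apply: le_trans lo _.
  have nP : kms_norm D (proj A) ^+ 2 <= pi k.
    apply: le_trans (kms_norm_le Uu s_gt0 _ Qu) _.
    rewrite (bigD1 k)//= inE eqxx expr1n mulr1 [X in _ + X]big1 ?addr0// => j jk.
    by rewrite inE (negbTE jk) expr0n mulr0.
  change (Re (kms D (proj A) (L (proj A))) <= N * pi k).
  case: (eqVneq (proj A) 0) => [P0|/eqP P0].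
    rewrite P0 linear0 /kms mulmx0 mul0mx mxtrace0 /=.
    by rewrite mulr_ge0// ltW.
  apply: le_trans (ler_wpM2l (ltW N0) nP).
  apply: (kms_cauchy_schwarz Uu s_gt0 N0).
  exact: (map_norm_kms n_ge2 Uu s_gt0 s_min s_max smin_gt0).
have [m mE] := classical_cheeger w0 pi0 (divr_ge0 conductance_ge0 (ltW smax_gt0)) pi1 iso x deg.
apply: (cheeger_constants smin_gt0 smax_gt0 N0 mE).
  by have /andP[lo _] := wE x.
have shift : kms_norm D (rcalc Q (fun k => x k - m)) ^+ 2
   <= \sum_k pi k * (x k - m) ^+ 2 := kms_norm_le Uu s_gt0 _ Qu.
have E : rcalc Q (fun k => x k - m) = rcalc Q x - m%:C%:M.
  rewrite -scalemx1 -scaleNr -(ccalc_const _ Qu) ccalcZ ccalcD.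
  by apply: eq_ccalc => k; rewrite mulr1 rmorphB.
have := kms_norm_shift m (selfadjoint_rcalc Q x) trX; rewrite -E => sh.
have le_of (a b : R) : b = a + m ^+ 2 -> a <= b by move=> ->; rewrite lerDl sqr_ge0.
exact: le_trans (le_of _ _ sh) shift.
Qed.

End Basis.

Lemma cheeger : h ^+ 2 * smin ^+ 2 / (2 * smax ^+ 2 * N) <= gap.
Proof.
(* For [N <= 0] the left side is nonpositive, a zero denominator giving 0. *)
have [N0|N0] := ltP 0 N; last first.
  apply: le_trans spectral_gap_ge0; apply: mulr_ge0_le0.
    by rewrite mulr_ge0 ?sqr_ge0.
  by rewrite invr_le0; apply: mulr_ge0_le0 => //; rewrite mulr_ge0 ?sqr_ge0.
have [X0 X0in] := gap_test_exists.
apply: lb_le_inf; first by exists (Re (kms D X0 (L X0)) / kms_norm D X0 ^+ 2), X0.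
move=> _ [X [Xn0 Xsa trX] <-].
have K0 := kms_norm_gt0 n_ge2 Uu s_gt0 s_min s_max smin_gt0 Xn0.
rewrite ler_pdivlMr//.
have [Q [x [Qu XE]]] := selfadjoint_diag Xsa.
rewrite XE in trX *; have [//|] := cheeger_basis Qu x N0.
by rewrite trX eqxx.
Qed.
End Cheeger.

(** * Matrix powers on the strip *)

Section KmsAlgebra.
Variables (C : numClosedFieldType) (n : nat).
Local Notation M := 'M[C]_n.
Implicit Types (A B S X Y Z U V : M) (g h : 'I_n -> C).

Lemma kms_adj_trace S X Y : S^t* = S ->
  \tr ((X^t*)^t* *m S *m Y^t* *m S) = Num.conj (\tr (X^t* *m S *m Y *m S)).
Proof.
move=> Ssa; rewrite -tr_adj !adj_mul trmxCK Ssa.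
by rewrite -!mulmxA mxtrace_mulC -!mulmxA [RHS]mxtrace_mulC -!mulmxA mxtrace_mulC -!mulmxA.
Qed.

Lemma tr_ccalc_rows V g X :
  \tr (ccalc V g *m X) = \sum_i g i * (row i V *m X *m (row i V)^t*) 0 0.
Proof.
rewrite /ccalc -!mulmxA mxtrace_mulC -mulmxA /mxtrace; apply: eq_bigr => i _.
rewrite mul_diag_mx mxE; congr (_ * _); first by rewrite mxE.
rewrite -row_mul mxE [RHS]mxE.
by apply: eq_bigr => j _; move: (V *m X) => A; rewrite !mxE.
Qed.

(** The hypothesis says that the overlap matrix intertwines the two diagonal matrices; it is the
    form in which the equality case of the entropy arrives. *)
Lemma ccalc_eq U V g h : U \is unitarymx -> V \is unitarymx ->
  (forall i j, (V *m U^t*) i j = 0 \/ g i = h j) -> ccalc V g = ccalc U h.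
Proof.
move=> Uu Vu gh.
have E : diag_mx (\row_i g i) *m (V *m U^t*) = (V *m U^t*) *m diag_mx (\row_i h i).
  move: (V *m U^t*) gh => O gh; apply/matrixP => i j.
  rewrite mul_diag_mx mul_mx_diag !mxE.
  by case: (gh i j) => ->; rewrite ?mulr0 ?mul0r// mulrC.
have -> : ccalc V g = V^t* *m (diag_mx (\row_i g i) *m (V *m U^t*)) *m U.
  by rewrite /ccalc -!mulmxA (unitarymxV Uu) mulmx1.
by rewrite E /ccalc !mulmxA (unitarymxV Vu) mul1mx.
Qed.

End KmsAlgebra.

Section MatrixExpPoly.
Variables (R : realType) (n : nat).
Local Notation C := R[i].
Local Notation M := 'M[C]_n.
Implicit Types (G H : R -> R -> M).

Definition mx_exp_poly G : Prop := forall a b, exp_poly (fun x y => G x y a b).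

Lemma mx_exp_polyM G H : mx_exp_poly G -> mx_exp_poly H ->
  mx_exp_poly (fun x y => G x y *m H x y).
Proof.
move=> Gp Hp a b; pose t c x y := G x y a c * H x y c b.
apply: (@exp_poly_ext _ (fun x y => \sum_c t c x y)).
  by move=> x y; rewrite mxE.
by apply: exp_poly_sum => c; apply: exp_polyM.
Qed.

Lemma mx_exp_poly_const (A : M) : mx_exp_poly (fun _ _ => A).
Proof. by move=> a b; exact: exp_poly_const. Qed.

Lemma mx_exp_poly_linear (L : {linear M -> M}) G : mx_exp_poly G ->
  mx_exp_poly (fun x y => L (G x y)).
Proof.
move=> Gp a d; pose t b c x y := G x y b c * L (delta_mx b c) a d.
apply: (@exp_poly_ext _ (fun x y => \sum_b \sum_c t b c x y)).
  by move=> x y; rewrite [RHS]linear_entries.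
by do 2 (apply: exp_poly_sum => ?); apply: exp_polyM => //; exact: exp_poly_const.
Qed.

Lemma mx_exp_poly_tr G : mx_exp_poly G -> exp_poly (fun x y => \tr (G x y)).
Proof. by move=> Gp; apply: exp_poly_sum => a. Qed.

Lemma mx_exp_poly_ccalc (U : M) (s : 'I_n -> R) (k b : R) :
  mx_exp_poly (fun x y => ccalc U (fun i => cpow (s i) (k * x + b) (k * y))).
Proof.
move=> c d.
pose t i x y := Num.conj (U i c) * cpow (s i) (k * x + b) (k * y) * U i d.
apply: (@exp_poly_ext _ (fun x y => \sum_i t i x y)).
  by move=> x y; rewrite [RHS]ccalc_entry.
apply: exp_poly_sum => i; apply: exp_polyM; last exact: exp_poly_const.
by apply: exp_polyM; [exact: exp_poly_const | exact: exp_poly_cpow].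
Qed.

Definition mxcpow (U : M) (s : 'I_n -> R) (x y : R) : M :=
  ccalc U (fun i => cpow (s i) x y).

Lemma mxcpowD (U : M) s x y x' y' : U \is unitarymx ->
  mxcpow U s x y *m mxcpow U s x' y' = mxcpow U s (x + x') (y + y').
Proof.
move=> Uu; apply: etrans (ccalcM _ _ Uu) _.
by apply: eq_ccalc => i; rewrite cpowD.
Qed.

Lemma mxcpow0 (U : M) s : U \is unitarymx -> mxcpow U s 0 0 = 1%:M.
Proof.
move=> Uu; apply: etrans (_ : ccalc U (fun=> 1) = _); last exact: ccalc_const.
by apply: eq_ccalc => i; rewrite cpow0.
Qed.

Lemma mxcpow_adj (U : M) s x y : (mxcpow U s x y)^t* = mxcpow U s x (- y).
Proof.
apply: etrans (ccalc_adj _ _) _.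
by apply: eq_ccalc => i; rewrite conj_cpow.
Qed.

Lemma mxcpow_real (U : M) (s : 'I_n -> R) x : (forall i, 0 < s i) ->
  mxcpow U s x 0 = rcalc U (fun i => s i `^ x).
Proof. by move=> s0; apply: eq_ccalc => i; rewrite cpow_real. Qed.

Lemma mxcpow_mxpow (U : M) s x : U \is unitarymx -> (forall i, 0 < s i) ->
  mxpow (rcalc U s) x = mxcpow U s x 0.
Proof. by move=> Uu s0; rewrite mxcpow_real// /mxpow (mxcalcE _ Uu (erefl _)). Qed.

Lemma mxcpow_rcalc (U : M) s : (forall i, 0 < s i) -> rcalc U s = mxcpow U s 1 0.
Proof. by move=> s0; apply: eq_ccalc => i; rewrite cpow1. Qed.

End MatrixExpPoly.

(** * Properties of the generator *)

Section Polarization.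
Variables (C : numClosedFieldType) (n : nat).
Local Notation M := 'M[C]_n.
Implicit Types A S T X Z W : M.

(** A parallelogram identity. With [W] the adjoint of [Z], the matrices [Z + W] and ['i *: (Z - W)]
    are self-adjoint, which reduces a form on all matrices to self-adjoint ones. *)
Lemma cartesian_trace S Z W Z' W' :
  \tr ((Z + W)^t* *m S *m (Z' + W') *m S)
    + \tr (('i *: (Z - W))^t* *m S *m ('i *: (Z' - W')) *m S)
  = 2 * \tr (Z^t* *m S *m Z' *m S) + 2 * \tr (W^t* *m S *m W' *m S).
Proof.
rewrite adjZ adjD adjB conjCi -!scalemxAl -!scalemxAr -!scalemxAl scalerA.
rewrite mulNr -expr2 sqrCi opprK scale1r.
rewrite !(mulmxDl, mulmxDr, mulmxBl, mulmxBr, mulNmx, mulmxN, raddfD, raddfN) /=.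
by ring.
Qed.

Lemma cartesian_selfadjoint Z :
  (Z + Z^t*)^t* = Z + Z^t* /\ ('i *: (Z - Z^t*))^t* = 'i *: (Z - Z^t*).
Proof.
rewrite adjZ adjD adjB trmxCK conjCi addrC; split=> //.
by rewrite scaleNr -scalerN opprB.
Qed.

Lemma shift_left_trace X S T A Z (c : C) : A = X + c%:M -> S *m S = T -> Num.conj c = c ->
  \tr (A^t* *m S *m Z *m S) = \tr (X^t* *m S *m Z *m S) + c * \tr (T *m Z).
Proof.
move=> -> <- cr; have csa : (c%:M : M)^t* = c%:M by rewrite tr_scalar_mx map_scalar_mx /= cr.
rewrite adjD csa !mulmxDl mul_scalar_mx raddfD /= -!scalemxAl mxtraceZ.
by congr (_ + _ * _); rewrite mxtrace_mulC mulmxA.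
Qed.

Lemma tr_adjM S Z : S^t* = S -> \tr (S *m Z^t*) = Num.conj (\tr (S *m Z)).
Proof. by move=> Ssa; rewrite -tr_adj adj_mul Ssa mxtrace_mulC. Qed.

End Polarization.

Lemma conj_fixed_real (R : realType) (z : R[i]) : Num.conj z = z -> z = (complex.Re z)%:C.
Proof.
rewrite conjCE; case: z => x y /= [yN]; congr (_ +i* _).
by lra.
Qed.

Lemma Re_double (R : realType) (z : R[i]) : complex.Re (2 * z) = 2 * complex.Re z.
Proof. by rewrite !mulr_natl !mulr2n ReD. Qed.

Lemma quarter_le (R : realFieldType) (g a b z a' b' z' ta tb t : R) :
  a + b = 4 * z -> a' + b' = 4 * z' -> ta + tb = 4 * t ->
  g * (a - ta) <= a' -> g * (b - tb) <= b' -> g * (z - t) <= z'.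
Proof.
move=> nE fE tE gA gB; have : g * (a + b - (ta + tb)) <= a' + b' by lra.
by rewrite nE fE tE -mulrBr mulrCA ler_pM2l.
Qed.

Section GeneratorFacts.
Variables (R : realType) (n : nat).
Local Notation C := R[i].
Local Notation M := 'M[C]_n.
Local Notation Re := (@complex.Re R).
Variables (Phi : R -> {linear M -> M}) (L : {linear M -> M}).
Hypothesis n_gt0 : (0 < n)%N.
Hypothesis genL : generator Phi L.

Lemma generator_adj X : (forall t, 0 <= t -> completely_positive (Phi t)) ->
  L (X^t*) = (L X)^t*.
Proof.
move=> cp; have key B : Re (\tr (B *m L (X^t*))) = Re (\tr (B^t* *m L X)).
  apply/eqP; rewrite -subr_eq0 -mulN1r; apply/eqP.
  apply: (gen_diff_eq0 (gen_diffD (gen_diff_tr n_gt0 genL B (X^t*))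
    (gen_diffZ (-1) (gen_diff_tr n_gt0 genL (B^t*) X)))) => t t0.
  have z (G : M -> M) : G (X^t*) = (G X)^t* ->
      Re (\tr (B *m G (X^t*))) + -1 * Re (\tr (B^t* *m G X)) = 0.
    move=> ->; rewrite -[in X in X + _](trmxCK B) -adj_mul tr_adj ReJ.
    by rewrite mxtrace_mulC mulN1r subrr.
  by rewrite (z (Phi t)) ?(z id)//; exact: (cp_adj (cp _ (ltW t0))).
(* Tested against the adjoint of the difference, the trace identity [key] computes its squared
   Frobenius norm. *)
apply/eqP; rewrite -subr_eq0; apply/eqP/fro2_eq0.
rewrite -tr_gram; set E := _ - _; rewrite /E mulmxBr raddfB /= ReB (key (E^t*)) trmxCK.
by rewrite -[X in _ - Re (\tr X)]adj_mul tr_adj ReJ mxtrace_mulC subrr.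
Qed.

Lemma generator_inv D X : invariant_state Phi D -> Re (\tr (D *m L X)) = 0.
Proof.
move=> inv; apply: (gen_diff_eq0 (gen_diff_tr n_gt0 genL D X)) => t t0.
by rewrite inv// ltW.
Qed.

(** The real part of the matrix element equals 1 at [t = 0] and is at most 1 for every [Phi t] by
    [cp_contract]; its derivative at 0 is minus the quantity claimed nonnegative. *)
Lemma generator_accretive W (a b : 'rV[C]_n) :
  (forall t, 0 <= t -> completely_positive (Phi t)) ->
  (forall t, 0 <= t -> Phi t 1%:M = 1%:M) ->
  W *m W^t* = 1%:M -> (a *m a^t*) 0 0 = 1 -> (b *m b^t*) 0 0 = 1 ->
  (a *m W *m b^t*) 0 0 = 1 -> 0 <= Re ((a *m L W *m b^t*) 0 0).
Proof.
move=> cp ph1 WW aa bb ab.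
have E (X : M) : Re (\tr (b^t* *m a *m X)) = Re ((a *m X *m b^t*) 0 0).
  by rewrite -mulmxA mxtrace_mulC trace_mx11.
rewrite -E; apply: (gen_diff_ge0 (gen_diff_tr n_gt0 genL (b^t* *m a) W)) => t t0.
rewrite !E [_ 0 0 in leRHS]ab.
exact: (cp_contract (cp _ (ltW t0)) (ph1 _ (ltW t0)) WW aa bb).
Qed.

End GeneratorFacts.

Section ComplexGap.
Variables (R : realType) (n : nat).
Local Notation C := R[i].
Local Notation M := 'M[C]_n.
Local Notation Re := (@complex.Re R).
Variables (U : M) (s : 'I_n -> R) (L : {linear M -> M}) (gap : R).
Hypothesis Uu : U \is unitarymx.
Hypothesis s_gt0 : forall i, 0 < s i.
Hypothesis s_sum1 : \sum_i s i = 1.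
Let D : M := rcalc U s.
Let S : M := mxpow D 2^-1.
Hypothesis L_adj : forall X, L (X^t*) = (L X)^t*.
Hypothesis L_inv : forall X, Re (\tr (D *m L X)) = 0.
Hypothesis L_1 : L 1%:M = 0.
Hypothesis gap_le : forall X, selfadjoint X -> \tr (D *m X) = 0 ->
  gap * kms_norm D X ^+ 2 <= Re (kms D X (L X)).

Let Ssa : S^t* = S.
Proof. by rewrite /S (mxcpow_mxpow _ Uu s_gt0) mxcpow_adj oppr0. Qed.

Let Dsa : D^t* = D.
Proof. exact: selfadjoint_rcalc. Qed.

Let SS : S *m S = D.
Proof.
rewrite /S (mxcpow_mxpow _ Uu s_gt0) (mxcpowD _ _ _ _ _ Uu) addr0.
by rewrite -[2^-1]div1r -splitr; exact: esym (mxcpow_rcalc U s_gt0).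
Qed.

Let trD1 : \tr D = 1.
Proof. by rewrite /D ccalc_tr// -rmorph_sum s_sum1. Qed.

(** The variance of [A] is the squared norm of the centred matrix, and centring leaves the form
    unchanged: [L] kills constants, and Tr (D L X) has real part 0. *)
Lemma gap_selfadjoint A : selfadjoint A ->
  gap * (kms_norm D A ^+ 2 - Re (\tr (D *m A)) ^+ 2) <= Re (kms D A (L A)).
Proof.
move=> Asa; set m := Re (\tr (D *m A)).
have mE : \tr (D *m A) = m%:C.
  by apply: conj_fixed_real; rewrite -(tr_adjM _ Dsa) Asa.
pose X := A - m%:C%:M.
have Xsa : selfadjoint X.
  rewrite /selfadjoint /X adjB Asa; congr (_ - _).
  by rewrite tr_scalar_mx map_scalar_mx /= conjCE conjc_real.
have trX : \tr (D *m X) = 0.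
  by rewrite /X mulmxBr raddfB /= mE mul_mx_scalar mxtraceZ trD1 mulr1 subrr.
have AE : A = X - (- m)%:C%:M by rewrite /X rmorphN /= raddfN /= opprK subrK.
rewrite [X in gap * (kms_norm D X ^+ 2 - _)]AE (kms_norm_shift Uu s_gt0 s_sum1 _ Xsa trX).
rewrite sqrrN addrK.
have -> : Re (kms D A (L A)) = Re (kms D X (L X)); last exact: gap_le.
have -> : L A = L X.
  by rewrite /X raddfB /= -[m%:C%:M]scalemx1 linearZ /= L_1 scaler0 subr0.
have -> : kms D A (L X) = kms D X (L X) + m%:C * \tr (D *m L X).
  have AE' : A = X + m%:C%:M by rewrite /X subrK.
  exact: (shift_left_trace (L X) AE' SS (conj_real m)).
by rewrite ReD Re_mulrC L_inv mulr0 addr0.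
Qed.

(** Sum of the self-adjoint inequalities for [A] and [B] below; norm, squared mean and form each add
    up to 4 times their value at [Z]. *)
Lemma gap_complex Z :
  gap * (kms_norm D Z ^+ 2 - nsq (\tr (D *m Z))) <= Re (kms D Z (L Z)).
Proof.
have [Asa Bsa] := cartesian_selfadjoint Z.
pose A := Z + Z^t*; pose B := 'i%R *: (Z - Z^t*).
have norm2 : Re (kms D A A) + Re (kms D B B) = 4 * Re (kms D Z Z).
  rewrite -ReD [kms D A A + _](cartesian_trace S Z (Z^t*) Z (Z^t*)).
  rewrite (kms_adj_trace Z Z Ssa) ReD !Re_double ReJ; rewrite -/(kms D Z Z).
  by ring.
have form2 : Re (kms D A (L A)) + Re (kms D B (L B)) = 4 * Re (kms D Z (L Z)).
  have -> : L A = L Z + L (Z^t*) by rewrite raddfD.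
  have -> : L B = 'i%R *: (L Z - L (Z^t*)) by rewrite linearZ raddfB.
  rewrite -ReD [kms D A _ + _](cartesian_trace S Z (Z^t*) (L Z) (L (Z^t*))).
  rewrite L_adj (kms_adj_trace Z (L Z) Ssa) ReD !Re_double ReJ; rewrite -/(kms D Z (L Z)).
  by ring.
have trA : \tr (D *m A) = \tr (D *m Z) + Num.conj (\tr (D *m Z)).
  by rewrite mulmxDr raddfD /= (tr_adjM _ Dsa).
have trB : \tr (D *m B) = 'i%R * (\tr (D *m Z) - Num.conj (\tr (D *m Z))).
  by rewrite -scalemxAr mxtraceZ mulmxBr raddfB /= (tr_adjM _ Dsa).
have tr2 : Re (\tr (D *m A)) ^+ 2 + Re (\tr (D *m B)) ^+ 2 = 4 * nsq (\tr (D *m Z)).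
  rewrite trA trB; case: (\tr (D *m Z)) => x y.
  rewrite conjCE -complexiE /nsq /=; ring.
have gA := gap_selfadjoint Asa; have gB := gap_selfadjoint Bsa.
rewrite -/A in gA; rewrite -/B in gB.
rewrite (kms_normE Uu s_gt0 Z).
rewrite (kms_normE Uu s_gt0 A) in gA; rewrite (kms_normE Uu s_gt0 B) in gB.
exact: (quarter_le norm2 form2 tr2 gA gB).
Qed.

End ComplexGap.

(** * Interpolation of the Dirichlet form *)

Lemma mxcpow_sum (R : realType) (n : nat) (U : 'M[R[i]]_n) s (x y x' y' x2 y2 : R) :
  U \is unitarymx -> x + x' = x2 -> y + y' = y2 ->
  mxcpow U s x y *m mxcpow U s x' y' = mxcpow U s x2 y2.
Proof. by move=> Uu <- <-; exact: mxcpowD. Qed.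

Section TraceCycles.
Variables (C : numClosedFieldType) (n : nat).
Implicit Types A B S X E : 'M[C]_n.

Lemma adj_sandwich A B : (A *m B *m A)^t* = A^t* *m B^t* *m A^t*.
Proof. by rewrite !adj_mul mulmxA. Qed.

Lemma sandwich_unitary A B A' B' : A *m A' = 1%:M -> B *m B' = 1%:M ->
  A *m B *m A *m (A' *m B' *m A') = 1%:M.
Proof.
move=> AA BB; have -> : A *m B *m A *m (A' *m B' *m A') = A *m (B *m (A *m A') *m B') *m A'.
  by rewrite !mulmxA.
by rewrite AA mulmx1 BB mulmx1.
Qed.

Lemma sandwich_form m A A' B (v : 'M_(m, n)) : A *m A' = 1%:M -> A' *m A = 1%:M ->
  v *m A *m (A' *m B *m A') *m (A *m v^t*) = v *m B *m v^t*.
Proof.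
move=> AA AA'; have -> : v *m A *m (A' *m B *m A') *m (A *m v^t*)
  = v *m (A *m A') *m B *m (A' *m A) *m v^t* by rewrite !mulmxA.
by rewrite AA AA' !mulmx1.
Qed.

Lemma ccalc_row_form (V : 'M[C]_n) g i : V \is unitarymx ->
  (row i V *m ccalc V g *m (row i V)^t*) 0 0 = g i.
Proof. by move=> Vu; rewrite ccalc_row// -scalemxAl mxE row_unitary// eqxx mulr1. Qed.

Lemma tr_cycle_middle A B S X E : A *m S = E -> S *m A = E ->
  \tr (A *m B *m A *m S *m X *m S) = \tr (B *m (E *m X *m E)).
Proof. by move=> AS SA; rewrite -{1}AS -SA -!mulmxA mxtrace_mulC !mulmxA. Qed.

Lemma tr_cycle_cancel A B S A' B' : A *m S *m A' = 1%:M -> A' *m S *m A = 1%:M ->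
  \tr ((A *m B *m A) *m S *m (A' *m B' *m A') *m S) = \tr (B *m B').
Proof.
move=> c1 c2; have -> : A *m B *m A *m S *m (A' *m B' *m A') *m S =
  A *m B *m (A *m S *m A') *m B' *m A' *m S by rewrite !mulmxA.
rewrite c1 mulmx1; have -> : A *m B *m B' *m A' *m S = A *m (B *m B' *m (A' *m S)).
  by rewrite !mulmxA.
by rewrite mxtrace_mulC -[_ *m A]mulmxA c2 mulmx1.
Qed.

Lemma tr_cycle_outer E A B : \tr (E *m (A *m B *m A)) = \tr ((A *m E *m A) *m B).
Proof. by rewrite -!mulmxA mulmxA mxtrace_mulC -!mulmxA mxtrace_mulC -!mulmxA. Qed.

End TraceCycles.

Section Interpolation.
Variables (R : realType) (n : nat).
Local Notation C := R[i].
Local Notation M := 'M[C]_n.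
Local Notation Re := (@complex.Re R).
Variables (U V : M) (s w : 'I_n -> R) (L : {linear M -> M}) (gap : R).
Hypothesis Uu : U \is unitarymx.
Hypothesis Vu : V \is unitarymx.
Hypothesis s_gt0 : forall i, 0 < s i.
Hypothesis w_gt0 : forall i, 0 < w i.
Let D : M := rcalc U s.
Local Notation Dp := (mxcpow U s).
Local Notation Wp := (mxcpow V w).
Hypothesis L_accretive : forall W (a b : 'rV[C]_n), W *m W^t* = 1%:M ->
  (a *m a^t*) 0 0 = 1 -> (b *m b^t*) 0 0 = 1 ->
  (a *m W *m b^t*) 0 0 = 1 -> 0 <= Re ((a *m L W *m b^t*) 0 0).
Hypothesis L_gap : forall Z,
  gap * (kms_norm D Z ^+ 2 - nsq (\tr (D *m Z))) <= Re (kms D Z (L Z)).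

(** The [I_z] of the overview at z = x + i t, for Y with eigenframe [V] and eigenvalues [w]. *)
Definition interp (x t : R) : M :=
  Dp (- (x / 2)) (- (t / 2)) *m Wp x t *m Dp (- (x / 2)) (- (t / 2)).

Lemma interp_adj x t : (interp x t)^t* =
  Dp (- (x / 2)) (t / 2) *m Wp x (- t) *m Dp (- (x / 2)) (t / 2).
Proof.
apply: etrans (adj_sandwich (Dp _ _) (Wp _ _)) _.
by rewrite (mxcpow_adj U) (mxcpow_adj V) opprK.
Qed.

(** For z = x + i t, the point 1 - conj z is (1 - x) + i t. The conjugate offsets the
    conjugate-linearity of [kms] in its first argument, so that the form is an exponential
    polynomial in z. *)
Definition interp_form x t : C := kms D (interp (1 - x) t) (L (interp x t)).

Lemma mx_exp_poly_ext (G H : R -> R -> M) : (forall x y, G x y = H x y) ->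
  mx_exp_poly G -> mx_exp_poly H.
Proof. by move=> GH Gp a b; apply: exp_poly_ext (Gp a b) => x y; rewrite GH. Qed.

Lemma mx_exp_poly_mxcpow (Q : M) (d : 'I_n -> R) (k b : R) (e e' : R -> R) :
  (forall x, e x = k * x + b) -> (forall t, e' t = k * t) ->
  mx_exp_poly (fun x t => mxcpow Q d (e x) (e' t)).
Proof.
move=> eE e'E; apply: mx_exp_poly_ext (mx_exp_poly_ccalc Q d k b) => x t.
by rewrite eE e'E.
Qed.

Lemma interp_form_exp_poly : exp_poly interp_form.
Proof.
apply: mx_exp_poly_tr; apply: mx_exp_polyM; last exact: mx_exp_poly_const.
apply: mx_exp_polyM.
  apply: mx_exp_polyM; last exact: mx_exp_poly_const.
  apply: (mx_exp_poly_ext (fun x t => esym (interp_adj (1 - x) t))).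
  have h : mx_exp_poly (fun x t : R => Dp (- ((1 - x) / 2)) (t / 2)).
    by apply: (@mx_exp_poly_mxcpow _ _ (2^-1) (- 2^-1)) => x; field.
  apply: mx_exp_polyM => //; apply: mx_exp_polyM => //.
  by apply: (@mx_exp_poly_mxcpow _ _ (-1) (1)) => x; ring.
apply: mx_exp_poly_linear.
have h : mx_exp_poly (fun x t : R => Dp (- (x / 2)) (- (t / 2))).
  by apply: (@mx_exp_poly_mxcpow _ _ (- 2^-1) (0)) => x; field.
apply: mx_exp_polyM => //; apply: mx_exp_polyM => //.
by apply: (@mx_exp_poly_mxcpow _ _ (1) (0)) => x; ring.
Qed.

Let SE : mxpow D 2^-1 = Dp 2^-1 0.
Proof. exact: mxcpow_mxpow. Qed.

Lemma interp_imaginary_unitary t : interp 0 t *m (interp 0 t)^t* = 1%:M.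
Proof.
rewrite interp_adj /interp mul0r oppr0.
move: (mxcpowD s 0 (- (t / 2)) 0 (t / 2) Uu) (mxcpowD w 0 t 0 (- t) Vu).
rewrite addr0 addNr subrr (mxcpow0 _ Uu) (mxcpow0 _ Vu).
exact: sandwich_unitary.
Qed.

(** By cyclicity the form becomes a sum over the eigenvectors of Y with coefficients [w i] times a
    phase. The phase is moved into the unit vector [a]; then the matrix element of the unitary [W]
    between [a] and [b] is 1 and accretivity applies term by term. *)
Lemma interp_form_ge0 t : 0 <= Re (interp_form 0 t).
Proof.
pose A := Dp 0 (t / 2); pose W := interp 0 t.
have AE : Dp (- (1 / 2)) (t / 2) *m Dp 2^-1 0 = A.
  by apply: (mxcpow_sum _ Uu); rewrite ?addr0// div1r addNr.
have AE' : Dp 2^-1 0 *m Dp (- (1 / 2)) (t / 2) = A.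
  by apply: (mxcpow_sum _ Uu); rewrite ?add0r// div1r subrr.
have -> : interp_form 0 t = \sum_i cpow (w i) 1 (- t) *
    (row i V *m (A *m L W *m A) *m (row i V)^t*) 0 0.
  apply: etrans (tr_ccalc_rows _ _ _); rewrite /interp_form /kms subr0 interp_adj SE.
  exact: (tr_cycle_middle _ _ AE AE').
rewrite Re_sum; apply: sumr_ge0 => i _.
have cw x : cpow (w i) 0 x * cpow (w i) 0 (- x) = 1 by rewrite -cpowD addr0 subrr cpow0.
pose b := row i V *m Dp 0 (- (t / 2)); pose a := cpow (w i) 0 (- t) *: (row i V *m A).
have b_adj : b^t* = A *m (row i V)^t* by rewrite adj_mul (mxcpow_adj U) opprK.
have rowV : (row i V *m (row i V)^t*) 0 0 = 1 by rewrite row_unitary// eqxx.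
have AA : A *m Dp 0 (- (t / 2)) = 1%:M.
  by rewrite (mxcpowD _ _ _ _ _ Uu) addr0 subrr (mxcpow0 _ Uu).
have AA' : Dp 0 (- (t / 2)) *m A = 1%:M.
  by rewrite (mxcpowD _ _ _ _ _ Uu) addr0 addNr (mxcpow0 _ Uu).
have form X : cpow (w i) 1 (- t) * (row i V *m (A *m X *m A) *m (row i V)^t*) 0 0 =
    (w i)%:C * (a *m X *m b^t*) 0 0.
  have -> : cpow (w i) 1 (- t) = (w i)%:C * cpow (w i) 0 (- t).
    by rewrite -(cpow1 (w_gt0 i)) -cpowD addr0 add0r.
  rewrite -mulrA; congr (_ * _).
  have -> : a *m X *m b^t* = cpow (w i) 0 (- t) *: (row i V *m (A *m X *m A) *m (row i V)^t*).
    by rewrite b_adj /a -!scalemxAl !mulmxA.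
  by rewrite [RHS]mxE.
rewrite form Re_mulrC mulr_ge0 ?(ltW (w_gt0 i))//; apply: L_accretive.
- exact: interp_imaginary_unitary.
- rewrite /a adjZ -scalemxAl -scalemxAr scalerA conj_cpow opprK mulrC cw scale1r.
  by rewrite adj_mul (mxcpow_adj U) -mulmxA [A *m _]mulmxA AA mul1mx.
- by rewrite b_adj /b -mulmxA [Dp _ _ *m _]mulmxA AA' mul1mx.
rewrite /a /W /interp mul0r oppr0 b_adj -!scalemxAl.
rewrite (sandwich_form _ _ AA AA') mxE (ccalc_row_form _ _ Vu).
by rewrite mulrC cw.
Qed.

Let overlapsum := \sum_k \sum_i overlap U V k i * (Num.sqrt (w k) * Num.sqrt (s i)).

Lemma interp_half_norm t : kms_norm D (interp 2^-1 t) ^+ 2 = \sum_i w i.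
Proof.
have cancelD t1 t2 : t1 + t2 = 0 ->
    Dp (- (2^-1 / 2)) t1 *m Dp 2^-1 0 *m Dp (- (2^-1 / 2)) t2 = 1%:M.
  move=> t12; rewrite -(mxcpow0 s Uu) (mxcpowD _ _ _ _ _ Uu).
  by apply: (mxcpow_sum _ Uu); [field | rewrite addr0].
have c1 := cancelD (t / 2) (- (t / 2)) (subrr _).
have c2 := cancelD (- (t / 2)) (t / 2) (addNr _).
rewrite (kms_normE Uu s_gt0); have -> : kms D (interp 2^-1 t) (interp 2^-1 t) =
    \tr (Wp 2^-1 (- t) *m Wp 2^-1 t).
  by rewrite /kms interp_adj SE; exact: (tr_cycle_cancel _ _ c1 c2).
have -> : Wp 2^-1 (- t) *m Wp 2^-1 t = Wp 1 0.
  by apply: (mxcpow_sum _ Vu); [field | rewrite addNr].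
rewrite (ccalc_tr _ Vu) Re_sum; apply: eq_bigr => i _.
by rewrite (cpow1 (w_gt0 i)).
Qed.

(** Over the two eigenbases the trace is a sum of overlaps times products of complex powers of
    exponents 1/2 - i t and 1/2 + i t. The triangle inequality removes the phases, so the bound does
    not depend on [t]. *)
Lemma interp_half_trace t : nsq (\tr (D *m interp 2^-1 t)) <= overlapsum ^+ 2.
Proof.
have -> : \tr (D *m interp 2^-1 t) = \tr (Dp 2^-1 (- t) *m Wp 2^-1 t).
  apply: etrans (tr_cycle_outer _ _ _) _; congr (\tr (_ *m _)).
  have -> : D = Dp 1 0 := mxcpow_rcalc U s_gt0.
  rewrite (mxcpowD _ _ _ _ _ Uu).
  by apply: (mxcpow_sum _ Uu); field.
have nc (a : R) y : 0 < a -> Normc.normc (cpow a 2^-1 y) = Num.sqrt a.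
  move=> a0; apply/eqP; rewrite -(@eqrXn2 _ 2)// ?normc_ge0 ?sqrtr_ge0//.
  by rewrite normc_sqr nsq_cpow// powR12_sqrt// ltW.
rewrite tr_ccalcM -normc_sqr lerXn2r ?nnegrE ?normc_ge0//.
  by do 2 (apply: sumr_ge0 => ? _); rewrite mulr_ge0 ?overlap_ge0// mulr_ge0 ?sqrtr_ge0.
apply: le_trans (normc_sum _ _) _; apply: ler_sum => k _.
apply: le_trans (normc_sum _ _) _; apply: ler_sum => i _.
by rewrite mulr_conj !Normc.normcM !nc// normc_real ger0_norm ?nsq_ge0// mulrC [Num.sqrt (s i) * _]mulrC.
Qed.

Hypothesis gap_ge0 : 0 <= gap.

Lemma interp_form_half t :
  gap * (\sum_i w i - overlapsum ^+ 2) <= Re (interp_form 2^-1 t).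
Proof.
have -> : interp_form 2^-1 t = kms D (interp 2^-1 t) (L (interp 2^-1 t)).
  have e : 1 - 2^-1 = 2^-1 :> R by field.
  by rewrite /interp_form e.
apply: le_trans (L_gap _); rewrite interp_half_norm ler_wpM2l//.
by rewrite lerD2l lerN2 interp_half_trace.
Qed.

Hypothesis L_sym : forall X Y, Re (kms D X (L Y)) = Re (kms D Y (L X)).

Lemma interp_form_lower_bound x : 0 <= x <= 1 ->
  2 * (gap * (\sum_i w i - overlapsum ^+ 2)) * Num.min x (1 - x) <= Re (interp_form x 0).
Proof.
have half y : 0 <= y <= 2^-1 ->
    2 * (gap * (\sum_i w i - overlapsum ^+ 2)) * y <= Re (interp_form y 0).
  move=> y01; apply: exp_poly_three_lines y01.
  - exact: interp_form_exp_poly.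
  - exact: interp_form_ge0.
  - exact: interp_form_half.
move=> /andP[x0 x1]; case: (lerP x (1 - x)) => xx.
  by apply: half; rewrite x0 /=; lra.
have -> : Re (interp_form x 0) = Re (interp_form (1 - x) 0).
  by rewrite /interp_form subKr; exact: L_sym.
by apply: half; apply/andP; split; lra.
Qed.

End Interpolation.

(** * Logarithmic Sobolev inequality *)

Section WeightedSpectrum.
Variables (R : realType) (n : nat).
Local Notation C := R[i].
Local Notation M := 'M[C]_n.
Local Notation Re := (@complex.Re R).

Lemma posdef_congruence (A A' X : M) : A^t* = A -> A *m A' = 1%:M ->
  posdef X -> posdef (A *m X *m A).
Proof.
move=> Asa AA [Xsa Xpos]; split; first by rewrite /selfadjoint adj_sandwich Asa Xsa.
move=> v v0; have -> : v *m (A *m X *m A) *m v^t* = (v *m A) *m X *m (v *m A)^t*.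
  by rewrite adj_mul Asa !mulmxA.
apply: Xpos; apply: contraNneq v0 => vA0.
by rewrite -[v]mulmx1 -AA mulmxA vA0 mul0mx.
Qed.

Variables (U : M) (s : 'I_n -> R) (p : R).
Hypothesis Uu : U \is unitarymx.
Hypothesis s_gt0 : forall i, 0 < s i.
Hypothesis p_gt1 : 1 < p.
Let D : M := rcalc U s.
Local Notation Dp := (mxcpow U s).

Let p_gt0 : 0 < p. Proof. by rewrite (lt_trans _ p_gt1). Qed.
Let p_neq0 : p != 0. Proof. by rewrite gt_eqF. Qed.
Let p1_neq0 : p - 1 != 0. Proof. by rewrite gt_eqF// subr_gt0. Qed.

Let weightE : mxpow D (2 * p)^-1 = Dp (2 * p)^-1 0.
Proof. exact: mxcpow_mxpow. Qed.

Let Dp_cancel x : Dp x 0 *m Dp (- x) 0 = 1%:M.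
Proof. by rewrite -(mxcpow0 s Uu); apply: (mxcpow_sum _ Uu); rewrite ?subrr ?addr0. Qed.

Let Dp_cancel' x : Dp (- x) 0 *m Dp x 0 = 1%:M.
Proof. by rewrite -(mxcpow0 s Uu); apply: (mxcpow_sum _ Uu); rewrite ?addNr ?addr0. Qed.

Lemma weighted_diag X : posdef X ->
  exists V h, [/\ V \is unitarymx, forall i, 0 < h i & weighted D p X = rcalc V h].
Proof.
move=> Xpos; have Wpos : posdef (weighted D p X).
  rewrite /weighted weightE; apply: (posdef_congruence _ (Dp_cancel _) Xpos).
  by rewrite mxcpow_adj oppr0.
have [V [h [Vu WE]]] := selfadjoint_diag Wpos.1.
by exists V, h; split=> //; rewrite WE in Wpos; move/(posdef_rcalcP _ Vu): Wpos.
Qed.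

Variables (V : M) (h : 'I_n -> R) (X : M).
Hypothesis Vu : V \is unitarymx.
Hypothesis h_gt0 : forall i, 0 < h i.
Hypothesis XE : weighted D p X = rcalc V h.
Let w i := h i `^ p.

Let w_gt0 i : 0 < w i.
Proof. by rewrite powR_gt0. Qed.

Let interpE x : interp U V s w x 0 = mxpow D (- (x / 2)) *m mxcpow V w x 0 *m mxpow D (- (x / 2)).
Proof. by rewrite /interp mul0r oppr0 (mxcpow_mxpow _ Uu s_gt0). Qed.

Lemma weighted_interp : X = interp U V s w p^-1 0.
Proof.
rewrite interpE (mxcpow_real _ _ w_gt0).
have -> : rcalc V (fun i => w i `^ p^-1) = rcalc V h.
  by apply: eq_ccalc => i; rewrite /w -powRrM mulfV// powRr1// ltW.
rewrite -XE /weighted.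
have -> : - (p^-1 / 2) = - (2 * p)^-1 by congr (- _); field.
have -> : mxpow D (- (2 * p)^-1) = Dp (- (2 * p)^-1) 0 by exact: mxcpow_mxpow.
rewrite weightE; have := Dp_cancel' (2 * p)^-1; have := Dp_cancel (2 * p)^-1.
move: (Dp (2 * p)^-1 0) (Dp (- (2 * p)^-1) 0) => A A' AA AA'.
have -> : A' *m (A *m X *m A) *m A' = (A' *m A) *m X *m (A *m A') by rewrite !mulmxA.
by rewrite AA AA' mul1mx mulmx1.
Qed.

(** The conjugate exponent p / (p - 1) has inverse 1 - 1 / p, and h^(p - 1) = w^(1 - 1 / p). *)
Lemma power_map_interp : power_map D (p / (p - 1)) p X = interp U V s w (1 - p^-1) 0.
Proof.
rewrite interpE /power_map XE.
have -> : - (2 * (p / (p - 1)))^-1 = - ((1 - p^-1) / 2).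
  by congr (- _); field; rewrite p_neq0 p1_neq0.
have -> : p / (p / (p - 1)) = p - 1 by field; rewrite p_neq0 p1_neq0.
rewrite (mxcpow_real _ _ w_gt0) /mxpow (mxcalcE _ Vu (erefl (rcalc V h))).
suff -> : rcalc V ((fun x => x `^ (p - 1)) \o h) = rcalc V (fun i => w i `^ (1 - p^-1)) by [].
have e : p * (1 - p^-1) = p - 1 by field.
by apply: eq_ccalc => i /=; rewrite /w -powRrM e.
Qed.

Lemma dirichlet_interp (L : {linear M -> M}) :
  dirichlet D p L X = p / (2 * (p - 1)) * Re (interp_form U V s w L p^-1 0).
Proof. by rewrite /dirichlet power_map_interp {1}weighted_interp. Qed.

Lemma Ent_coupled : Ent D p X = p^-1 * coupled_entropy (overlap U V) w s.
Proof.
have absE : mxabs (weighted D p X) = rcalc V h.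
  rewrite /mxabs XE (selfadjoint_rcalc V h) (rcalcM _ _ Vu) /mxpow (mxcalcE _ Vu (erefl _)).
  apply: eq_ccalc => i /=; rewrite powR12_sqrt ?mulr_ge0 ?(ltW (h_gt0 i))//.
  by rewrite -expr2 sqrtr_sqr gtr0_norm.
have YE : mxpow (mxabs (weighted D p X)) p = rcalc V w.
  by rewrite absE; exact: (mxcalcE _ Vu (erefl (rcalc V h))).
have tau_ge0 : 0 <= \sum_i w i by apply: sumr_ge0 => i _; exact: ltW.
have trY : rtr (rcalc V w) = \sum_i w i by rewrite /rtr (ccalc_tr _ Vu) Re_sum.
have normE : pnorm D p X `^ p = \sum_i w i.
  by rewrite /pnorm YE trY -powRrM mulVf// powRr1.
rewrite /Ent YE normE /mxlog (mxcalcE _ Vu (erefl (rcalc V w))) (mxcalcE _ Uu (erefl D)).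
have -> : rtr (rcalc V w *m (rcalc V (@ln R \o w) - rcalc U (@ln R \o s))) =
   \sum_i w i * ln (w i) - \sum_k \sum_i overlap U V k i * (w k * ln (s i)).
  rewrite /rtr mulmxBr raddfB /= ReB; congr (_ - _).
    by rewrite (rcalcM _ _ Vu) (ccalc_tr _ Vu) Re_sum.
  rewrite mxtrace_mulC tr_rcalcM; apply: eq_bigr => k _; apply: eq_bigr => i _.
  by rewrite [_ * w k]mulrC.
by rewrite -mulrBr.
Qed.

(** Makes the denominator of the log-Sobolev quotient positive. Vanishing entropy forces Y = tau D,
    and then [X] is the scalar tau^(1 / p). *)
Lemma coupled_entropy_gt0 : \sum_i s i = 1 ->
  ~ (exists c : C, X = c%:M) -> 0 < coupled_entropy (overlap U V) w s.
Proof.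
move=> s_sum1 nscalar; rewrite ltNge; apply/negP => ent0; apply: nscalar.
set tau := \sum_i w i; have tau_ge0 : 0 <= tau by apply: sumr_ge0 => i _; exact: ltW.
have prop := coupled_entropy_eq0 (overlap_ge0 U V) (overlap_row Uu Vu) (overlap_col Uu Vu)
  w_gt0 s_gt0 s_sum1 ent0.
pose c := (tau `^ p^-1)%:C : C.
have WE : mxcpow V w p^-1 0 = c *: Dp p^-1 0.
  apply: etrans (esym (ccalcZ _ _ _)); apply: (ccalc_eq Uu Vu) => k i.
  have [/eqP O0|wE] := prop k i; [left | right].
    by apply/eqP; rewrite -nsq_eq0.
  by rewrite !cpow_real// wE powRM ?(ltW (s_gt0 i))// rmorphM.
exists c; rewrite weighted_interp /interp mul0r oppr0 WE -scalemxAr -scalemxAl.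
have -> : Dp (- (p^-1 / 2)) 0 *m Dp p^-1 0 = Dp (p^-1 / 2) 0.
  by apply: (mxcpow_sum _ Uu); [field | rewrite addr0].
by rewrite Dp_cancel scalemx1.
Qed.

End WeightedSpectrum.

(** The quotient is at least [g / l] times min (p, p / (p - 1)); the two hypotheses [k <= p] and
    [k * (p - 1) <= p] say that [k] is below this minimum. *)
Lemma log_sobolev_ratio (R : realFieldType) (p k g l v e f : R) :
  1 < p -> 0 <= k -> k <= p -> k * (p - 1) <= p -> 0 <= g -> 0 < l -> 0 < e -> e <= l * v ->
  2 * (g * v) * Num.min p^-1 (1 - p^-1) <= f ->
  k * g / l <= p / (2 * (p - 1)) * f / (p^-1 * e).
Proof.
move=> p1 k0 kp kp' g0 l0 e0 elv fle.
have p0 : 0 < p by lra.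
have q0 : 0 < p - 1 by lra.
have v0 : 0 < v by rewrite -(pmulr_rgt0 _ l0); exact: lt_le_trans elv.
have gv0 : 0 <= g * v by rewrite mulr_ge0// ltW.
rewrite ler_pdivlMr ?mulr_gt0 ?invr_gt0//.
apply: le_trans (_ : k * g / l * (p^-1 * (l * v)) <= _).
  by rewrite ler_wpM2l ?ler_wpM2l ?invr_ge0 ?(ltW p0)// divr_ge0 ?mulr_ge0// ltW.
have -> : k * g / l * (p^-1 * (l * v)) = (g * v) * (k / p) by field; rewrite !gt_eqF.
have c0 : 0 <= p / (2 * (p - 1)) by rewrite divr_ge0 ?mulr_ge0// ltW.
apply: le_trans (ler_wpM2l c0 fle).
have -> : p / (2 * (p - 1)) * (2 * (g * v) * Num.min p^-1 (1 - p^-1))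
  = (g * v) * (p / (p - 1) * Num.min p^-1 (1 - p^-1)) by field; rewrite gt_eqF.
rewrite ler_wpM2l// ler_pdivrMr//; case: (lerP p^-1 (1 - p^-1)) => _.
  have -> : p / (p - 1) * p^-1 * p = p / (p - 1) by field; rewrite !gt_eqF.
  by rewrite ler_pdivlMr.
by have -> : p / (p - 1) * (1 - p^-1) * p = p by field; rewrite !gt_eqF.
Qed.

Section LogSobolev.
Variables (R : realType) (n : nat).
Local Notation C := R[i].
Local Notation M := 'M[C]_n.
Local Notation Re := (@complex.Re R).
Variables (U : M) (s : 'I_n -> R) (smin smax : R).
Hypothesis n_ge2 : (2 <= n)%N.
Hypothesis Uu : U \is unitarymx.
Hypothesis s_gt0 : forall i, 0 < s i.
Hypothesis s_min : forall i, smin <= s i.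
Hypothesis s_max : forall i, s i <= smax.
Hypothesis smin_gt0 : 0 < smin.
Hypothesis s_sum1 : \sum_i s i = 1.
Let D : M := rcalc U s.
Variables (Phi : R -> {linear M -> M}) (L : {linear M -> M}).
Hypothesis genL : generator Phi L.
Hypothesis Phi_cp : forall t, 0 <= t -> completely_positive (Phi t).
Hypothesis Phi_1 : forall t, 0 <= t -> Phi t 1%:M = 1%:M.
Hypothesis Phi_inv : invariant_state Phi D.
Hypothesis Phi_kms : kms_symmetric D Phi.
Hypothesis L_1 : L 1%:M = 0.

Let n_gt0 : (0 < n)%N. Proof. exact: leq_trans n_ge2. Qed.
Let i0 : 'I_n := Ordinal n_gt0.
Let i1 : 'I_n := Ordinal n_ge2.
Let gap := spectral_gap D L.

Let gap_ge0 : 0 <= gap.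
Proof. exact: (spectral_gap_ge0 n_ge2 Uu s_gt0 s_min s_max smin_gt0 s_sum1 genL Phi_cp Phi_1 Phi_inv). Qed.

Lemma generator_kms_sym X Y : Re (kms D X (L Y)) = Re (kms D Y (L X)).
Proof.
apply/eqP; rewrite -subr_eq0 -mulN1r; apply/eqP.
apply: (gen_diff_eq0 (gen_diffD (gen_diff_kms U s i0 genL X Y)
  (gen_diffZ (-1) (gen_diff_kms U s i0 genL Y X)))) => t t0.
have z (F : M -> M) : kms D X (F Y) = kms D (F X) Y ->
    Re (kms D X (F Y)) + -1 * Re (kms D Y (F X)) = 0.
  by move=> ->; rewrite (Re_kmsC Uu s_gt0 Y (F X)) mulN1r subrr.
by rewrite (z (Phi t) (Phi_kms (ltW t0) X Y)) (z id erefl).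
Qed.

Let gap_bound Z : gap * (kms_norm D Z ^+ 2 - nsq (\tr (D *m Z))) <= Re (kms D Z (L Z)).
Proof.
apply: (gap_complex Uu s_gt0 s_sum1 _ _ L_1).
- by move=> X; exact: (generator_adj n_gt0 genL X Phi_cp).
- by move=> X; exact: (generator_inv n_gt0 genL X Phi_inv).
- by move=> X; exact: (spectral_gap_le n_ge2 Uu s_gt0 s_min s_max smin_gt0 genL Phi_cp Phi_1 Phi_inv).
Qed.

Lemma log_smin_ge0 : 0 <= ln smin^-1.
Proof.
rewrite ln_ge0// invf_ge1//; apply: le_trans (s_min i0) _.
by rewrite -s_sum1 (bigD1 i0)//= lerDl sumr_ge0// => i _; exact: ltW.
Qed.

Lemma log_sobolev_test_exists : exists X : M, posdef X /\ ~ exists c : C, X = c%:M.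
Proof.
(* Eigenvalue 2 once and 1 otherwise; not scalar because [n >= 2]. *)
pose x i : R := 1 + (i == i0)%:R; exists (rcalc U x); split.
  by apply/(posdef_rcalcP _ Uu) => i; rewrite ltr_wpDr.
move=> [c XE]; have val i : (x i)%:C = c.
  have := ccalc_row (fun i => (x i)%:C) i Uu; rewrite -/(rcalc U x) XE mul_mx_scalar.
  move/eqP; rewrite -subr_eq0 -scalerBl scaler_eq0 (negbTE (row_unitary_neq0 i Uu)) orbF.
  by rewrite subr_eq0 => /eqP.
have : x i0 = x i1 by apply: complexI; rewrite !val.
by rewrite /x eqxx /= => /eqP; rewrite (inj_eq (addrI _)) oner_eq0.
Qed.

Lemma log_sobolev_ge (p k : R) : 1 < p -> 0 <= k -> k <= p -> k * (p - 1) <= p ->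
  k * gap / (ln smin^-1 + 2) <= log_sobolev D p L.
Proof.
move=> p1 k0 kp kp'; have [X0 X0in] := log_sobolev_test_exists.
apply: lb_le_inf; first by exists (dirichlet D p L X0 / Ent D p X0), X0.
move=> _ [X [Xpos Xns] <-].
have [V [h [Vu h0 XE]]] := weighted_diag p Uu s_gt0 Xpos.
pose w i := h i `^ p; have w0 i : 0 < w i by rewrite powR_gt0.
rewrite (dirichlet_interp Uu s_gt0 p1 Vu h0 XE) (Ent_coupled Uu p1 Vu h0 XE).
apply: (log_sobolev_ratio p1 k0 kp kp' gap_ge0 (v := \sum_i w i -
  (\sum_i \sum_j overlap U V i j * (Num.sqrt (w i) * Num.sqrt (s j))) ^+ 2)).
- by rewrite ltr_wpDl// log_smin_ge0.
- exact: (coupled_entropy_gt0 Uu s_gt0 p1 Vu h0 XE s_sum1 Xns).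
- exact: (coupled_entropy_le (overlap_ge0 U V) (overlap_row Uu Vu) (overlap_col Uu Vu)
    w0 s_gt0 s_sum1 smin_gt0 s_min).
apply: (interp_form_lower_bound Uu Vu s_gt0 w0 _ gap_bound gap_ge0 generator_kms_sym).
  by move=> W a b; exact: (generator_accretive n_gt0 genL Phi_cp Phi_1).
by rewrite invr_ge0 (ltW (lt_trans ltr01 p1)) invf_le1 ?(ltW p1)// (lt_trans ltr01).
Qed.

End LogSobolev.

Theorem theorem7p3 (R : realType) (n : nat)
    (Phi : R -> {linear 'M[R[i]]_n -> 'M[R[i]]_n})
    (L : {linear 'M[R[i]]_n -> 'M[R[i]]_n})
    (D : 'M[R[i]]_n) :
  (2 <= n)%N ->
  quantum_markov_semigroup Phi ->
  generator Phi L ->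
  primitive Phi L ->
  faithful_state D ->
  invariant_state Phi D ->
  kms_symmetric D Phi ->
  let smin := min_eig D in
  let smax := max_eig D in
  let gap := spectral_gap D L in
  let h := conductance D L in
  let normL := map_norm (kms_norm D) L in
  (forall p : R, 1 < p ->
     log_sobolev D p L >= gap / (ln smin^-1 + 2) /\
     gap / (ln smin^-1 + 2) >=
       h ^+ 2 * smin ^+ 2 / (2 * smax ^+ 2 * normL) * (1 / (ln smin^-1 + 2)))
  /\
  (log_sobolev D 2 L >= 2 * gap / (ln smin^-1 + 2) /\
   2 * gap / (ln smin^-1 + 2) >=
     2 * h ^+ 2 * smin ^+ 2 / (2 * smax ^+ 2 * normL)
       * (1 / (ln smin^-1 + 2))).
Proof.
move=> n_ge2 [Phi_cp Phi_1 _ _ _] genL [_ kerL] [Dpos trD] Phi_inv Phi_kms smin smax.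
have L_1 : L 1%:M = 0 by apply/kerL; exists 1.
have [U [s [Uu DE]]] := selfadjoint_diag Dpos.1.
rewrite /smin /smax {smin smax}; subst D.
have s_gt0 : forall i, 0 < s i by apply/(posdef_rcalcP _ Uu).
have s_sum1 : \sum_i s i = 1.
  by apply: complexI; rewrite rmorph_sum -(ccalc_tr _ Uu).
have i0 : 'I_n := Ordinal (leq_trans (isT : (0 < 2)%N) n_ge2).
have [s_min [i minE]] := min_eigP s i0 Uu.
have [s_max _] := max_eigP s i0 Uu.
have smin_gt0 : 0 < min_eig (rcalc U s) by rewrite minE.
have ls := log_sobolev_ge n_ge2 Uu s_gt0 s_min s_max smin_gt0 s_sum1 genL Phi_cp Phi_1
  Phi_inv Phi_kms L_1.
have chg := cheeger n_ge2 Uu s_gt0 s_min s_max smin_gt0 s_sum1 genL Phi_cp Phi_1 Phi_inv.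
have l0 : 0 < ln (min_eig (rcalc U s))^-1 + 2.
  by rewrite ltr_wpDl// (log_smin_ge0 n_ge2 s_gt0 s_min smin_gt0 s_sum1).
split=> [p p1|]; split.
- by have := ls p 1 p1; rewrite !mul1r; apply=> //; [exact: ltW | rewrite gerBl].
- by rewrite div1r ler_pM2r ?invr_gt0.
(* With [k = 2] both constraints on [k] are equalities at [p = 2]. *)
- by apply: ls; rewrite ?ltr1n//; lra.
have assoc (a b c : R) : 2 * a * b / c = 2 * (a * b / c) by rewrite !mulrA.
rewrite div1r ler_pM2r ?invr_gt0// assoc.
exact: (ler_wpM2l (ler0n R 2) chg).
Qed.
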